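(* Let $N\geq 2$, $p>1$, let $\Omega\subset\mathbb{R}^N$ be a bounded and smooth domain, let $\lambda>0$ and let $u_\lambda:=\left(\frac{\lambda|\Omega|}{\mu(\Omega)}\right)^{1/p}u$, where $u$ is the weak solution of $$-\Delta_p w=\frac{\mu(\Omega)}{|\Omega|}w^{-1}\ \text{in }\Omega,\qquad w>0\ \text{in }\Omega,\qquad w=0\ \text{on }\partial\Omega.$$ Then the functional $J_\lambda:W_0^{1,p}(\Omega)\to(-\infty,\infty]$ given by $$J_\lambda(v):=\frac1p\int_\Omega|\nabla v|^p\,dx-\lambda\int_\Omega\log|v|\,dx\quad\text{if }\int_\Omega\log|v|\,dx\in(-\infty,\infty),$$ and $J_\lambda(v):=\infty$ if $\int_\Omega\log|v|\,dx=-\infty$, attains its minimum value $$\frac{\lambda|\Omega|}{p}\left(1-\log\left(\frac{\lambda|\Omega|}{\mu(\Omega)}\right)\right)$$ only at the functions $u_\lambda$ and $-u_\lambda$.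
   Context: $|\Omega|$ denotes the $N$-dimensional Lebesgue measure of $\Omega$, $\|\cdot\|_p$ the norm of $L^p(\Omega)$, and $\Delta_p v=\operatorname{div}(|\nabla v|^{p-2}\nabla v)$. For $q\in(0,1)$, $$\lambda_q(\Omega):=\inf\left\{\|\nabla v\|_p^p : v\in W_0^{1,p}(\Omega)\ \text{and}\ \int_\Omega |v|^q\,dx=1\right\},\qquad \mu(\Omega):=\lim_{q\to0^+}\lambda_q(\Omega)|\Omega|^{p/q}\in(0,\infty).$$ Integrals $\int_\Omega\log|v|\,dx$ with $v\in L^1(\Omega)$ take values in $[-\infty,\infty)$, with $\log 0=-\infty$. For $\lambda>0$, a weak solution of $-\Delta_p w=\lambda w^{-1}$ in $\Omega$, $w>0$ in $\Omega$, $w=0$ on $\partial\Omega$, is a function $w\in W_0^{1,p}(\Omega)$ with $\operatorname{ess\,inf}_K w>0$ for each compact $K\subset\Omega$ and $\int_\Omega|\nabla w|^{p-2}\nabla w\cdot\nabla\varphi\,dx=\lambda\int_\Omega w^{-1}\varphi\,dx$ for all $\varphi\in W_0^{1,p}(\Omega)$. For $\lambda=\mu(\Omega)/|\Omega|$ such a solution exists and is unique. *)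

(* Defs.v *)
From HB Require Import structures.
From mathcomp Require Import all_boot all_order all_algebra.
From mathcomp Require Import all_classical all_reals all_analysis.
From mathcomp Require Import ess_sup_inf.

Set Implicit Arguments.
Unset Strict Implicit.
Unset Printing Implicit Defensive.

Import Order.TTheory GRing.Theory Num.Theory.
Import numFieldNormedType.Exports.

Local Open Scope classical_set_scope.
Local Open Scope ring_scope.

(** * Lebesgue measure on R^n, with R^n := 'rV[R]_n

    The sigma-algebra on ['rV[R]_n] is the one generated by the coordinates,
    i.e. the Borel sigma-algebra, and [lebesgue_rV n] is the n-fold product of
    the one-dimensional Lebesgue measure. *)

Definition measure_rV_display : measure_display.
Proof. exact: default_measure_display. Qed.

Section measurable_rV.
Context {R : realType} {n : nat}.

Definition rV_coord (i : 'I_n) (x : 'rV[R]_n) : R := x 0 i.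

Let rV_set0 : g_sigma_preimage rV_coord set0.
Proof. exact: sigma_algebra0. Qed.

Let rV_setC A : g_sigma_preimage rV_coord A -> g_sigma_preimage rV_coord (~` A).
Proof. exact: sigma_algebraC. Qed.

Let rV_bigcup (F : (set 'rV[R]_n)^nat) :
  (forall i, g_sigma_preimage rV_coord (F i)) ->
  g_sigma_preimage rV_coord (\bigcup_i (F i)).
Proof. exact: sigma_algebra_bigcup. Qed.

HB.instance Definition _ := @isMeasurable.Build measure_rV_display
  'rV[R]_n (g_sigma_preimage rV_coord) rV_set0 rV_setC rV_bigcup.

Lemma measurable_rV_coord (i : 'I_n) : measurable_fun [set: 'rV[R]_n] (rV_coord i).
Proof.
move=> _ Y mY; rewrite setTI; apply: sub_sigma_algebra => /=.
rewrite -bigcup_seq/=; exists i => /=; first by rewrite mem_index_enum.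
by exists Y => //; rewrite setTI.
Qed.

End measurable_rV.

Lemma measurable_fun_rV {R : realType} {n : nat} d (T : measurableType d)
    (f : T -> 'rV[R]_n) :
  (forall i, measurable_fun [set: T] (fun x => rV_coord i (f x))) ->
  measurable_fun [set: T] f.
Proof.
move=> mf.
have H : g_sigma_preimage (@rV_coord R n) `<=`
         [set A | measurable (f @^-1` A)].
  apply: smallest_sub.
    split => /=.
    - by rewrite preimage_set0; exact: measurable0.
    - by move=> A mA /=; rewrite setTD preimage_setC; exact: measurableC.
    - by move=> F mF /=; rewrite preimage_bigcup; exact: bigcup_measurable.
  rewrite -bigcup_seq/= => A [i _] [B mB <-] /=; rewrite setTI.
  by rewrite -[X in measurable X]setTI; exact: mf.
by move=> _ A mA; rewrite setTI; exact: H.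
Qed.

Lemma product_sigma_finite d1 d2 (T1 : measurableType d1)
    (T2 : measurableType d2) (R : realType)
    (m1 : {sigma_finite_measure set T1 -> \bar R})
    (m2 : {sigma_finite_measure set T2 -> \bar R}) :
  sigma_finite setT (m1 \x m2)%E.
Proof.
have /sigma_finiteP[F [TF ndF Foo]] := sigma_finiteT m1.
have /sigma_finiteP[G [TG ndG Goo]] := sigma_finiteT m2.
exists (fun n => F n `*` G n).
  rewrite -setXTT TF TG predeqE => -[x y]; split.
    move=> [/= [n _ Fnx] [k _ Gky]]; exists (maxn n k) => //; split.
    - by move: x Fnx; exact/subsetPset/ndF/leq_maxl.
    - by move: y Gky; exact/subsetPset/ndG/leq_maxr.
  by move=> [n _ []/= ? ?]; split; exists n.
move=> k; have [? ?] := Foo k; have [? ?] := Goo k.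
split; first exact: measurableX.
by rewrite product_measure1E// lte_mul_pinfty// ge0_fin_numE.
Qed.

Section lebesgue_rV.
Context {R : realType}.

Definition rV_cons {n} (x : R * 'rV[R]_n) : 'rV[R]_n.+1 :=
  \row_i (if unlift ord0 i is Some j then x.2 0 j else x.1).

Definition rV_uncons {n} (y : 'rV[R]_n.+1) : R * 'rV[R]_n :=
  (y 0 ord0, \row_j y 0 (lift ord0 j)).

Lemma rV_consK n : cancel (@rV_cons n) rV_uncons.
Proof.
move=> [x v]; rewrite /rV_uncons/rV_cons mxE unlift_none /=; congr pair.
by apply/rowP => j; rewrite !mxE liftK.
Qed.

Lemma measurable_rV_cons n : measurable_fun setT (@rV_cons n).
Proof.
apply: measurable_fun_rV => i; rewrite /rV_coord.
case: (unliftP ord0 i) => [j ->|->].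
  rewrite [X in measurable_fun _ X](_ : _ = rV_coord j \o snd); last first.
    by apply/funext => x /=; rewrite mxE liftK.
  by apply: measurableT_comp => //; exact: measurable_rV_coord.
rewrite [X in measurable_fun _ X](_ : _ = fst) //.
by apply/funext => x /=; rewrite mxE unlift_none.
Qed.

Lemma measurable_rV_uncons n : measurable_fun setT (@rV_uncons n).
Proof.
apply: measurable_fun_pair => /=; first exact: (measurable_rV_coord ord0).
apply: measurable_fun_rV => j.
rewrite [X in measurable_fun _ X](_ : _ = rV_coord (lift ord0 j)).
  exact: measurable_rV_coord.
by apply/funext => x; rewrite /rV_coord mxE.
Qed.

Section step.
Variables (n : nat) (m : {sigma_finite_measure set 'rV[R]_n -> \bar R}).

Definition lebesgue_rV_step : set 'rV[R]_n.+1 -> \bar R :=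
  pushforward (lebesgue_measure \x m)%E rV_cons.

Let step0 : lebesgue_rV_step set0 = 0%E.
Proof. by rewrite /lebesgue_rV_step /pushforward preimage_set0 measure0. Qed.

Let step_ge0 A : (0 <= lebesgue_rV_step A)%E.
Proof. by rewrite /lebesgue_rV_step /pushforward measure_ge0. Qed.

Let step_sigma_additive : semi_sigma_additive lebesgue_rV_step.
Proof.
move=> F mF tF mUF; rewrite /lebesgue_rV_step /pushforward preimage_bigcup.
apply: measure_semi_sigma_additive.
- by move=> i; rewrite -[X in measurable X]setTI; exact: measurable_rV_cons.
- apply/trivIsetP => i j _ _ ij; rewrite -preimage_setI.
  by move/trivIsetP : tF => ->//; rewrite preimage_set0.
- rewrite -preimage_bigcup -[X in measurable X]setTI.
  exact: measurable_rV_cons.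
Qed.

HB.instance Definition _ := isMeasure.Build _ _ _ lebesgue_rV_step
  step0 step_ge0 step_sigma_additive.

Let step_sigma_finite : sigma_finite setT lebesgue_rV_step.
Proof.
have [F FT mF] := product_sigma_finite lebesgue_measure m.
exists (fun k => rV_uncons @^-1` F k).
  by rewrite -preimage_bigcup -FT preimage_setT.
move=> k; have [mFk Fk] := mF k; split.
  by rewrite -[X in measurable X]setTI; exact: measurable_rV_uncons.
rewrite /lebesgue_rV_step /pushforward -comp_preimage.
by rewrite (_ : rV_uncons \o _ = id)//; apply/funext => x; exact: rV_consK.
Qed.

HB.instance Definition _ := Measure_isSigmaFinite.Build _ _ _ lebesgue_rV_step
  step_sigma_finite.

End step.

Fixpoint lebesgue_rV (n : nat) : {sigma_finite_measure set 'rV[R]_n -> \bar R} :=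
  match n with
  | 0 => \d_(0 : 'rV[R]_0)
  | n'.+1 => lebesgue_rV_step (lebesgue_rV n')
  end.

End lebesgue_rV.

(** * Smooth functions and domains of R^N *)

Section euclidean.
Context {R : realType} {N : nat}.
Implicit Types (f : 'rV[R]_N -> R) (Omega : set 'rV[R]_N).

(* The library norm on ['rV[R]_N] is the sup norm. *)
Definition dotr (x y : 'rV[R]_N) : R := \sum_i x 0 i * y 0 i.
Definition enorm (x : 'rV[R]_N) : R := Num.sqrt (dotr x x).

Definition partial (i : 'I_N) f : 'rV[R]_N -> R := 'D_(delta_mx 0 i) f.

Definition grad f (x : 'rV[R]_N) : 'rV[R]_N := \row_i partial i f x.

(* C^oo: all iterated partial derivatives exist and are continuous *)
Definition smooth f := forall s : seq 'I_N,
  continuous (foldr partial f s) /\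
  forall i x, derivable (foldr partial f s) x (delta_mx 0 i).

(* Each boundary point has a neighborhood in which Omega is the negativity set
   of a C^oo function with nonvanishing gradient at that point. By the implicit
   function theorem, this says that Omega lies locally on one side of the graph
   of a C^oo function. *)
Definition smooth_boundary Omega := forall x, (closure Omega `\` Omega°) x ->
  exists (U : set 'rV[R]_N) (rho : 'rV[R]_N -> R),
    [/\ open_nbhs x U, smooth rho, grad rho x != 0 &
        Omega `&` U = [set y | rho y < 0] `&` U].

Definition smooth_bounded_domain Omega :=
  [/\ open Omega, connected Omega, Omega !=set0, bounded_set Omega &
      smooth_boundary Omega].

Definition vol Omega : R := fine (lebesgue_rV N Omega).

End euclidean.

(** * Sobolev spaces

    Elements of Lebesgue and Sobolev spaces on Omega are represented by
    functions defined on the whole of R^N, of which only the restriction to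
    Omega matters, up to equality almost everywhere in Omega. Representatives
    are Borel, which is no restriction: every Lebesgue measurable function
    coincides a.e. with a Borel one. *)

Section sobolev.
Context {R : realType} {N : nat}.
Variables (Omega : set 'rV[R]_N) (p : R).
Implicit Types (v w phi : 'rV[R]_N -> R) (g : 'rV[R]_N -> 'rV[R]_N).

Local Notation leb := (lebesgue_rV N).

Definition test_function phi := smooth phi /\
  exists K, [/\ compact K, K `<=` Omega & forall x, ~ K x -> phi x = 0].

Definition normLp v : \bar R := ('N[leb]_p%:E [(EFin \o v) \_ Omega])%E.

Definition Lp v := measurable_fun Omega v /\ (normLp v < +oo)%E.

Definition weak_gradient v g :=
  (forall i, Lp (fun x => g x 0 i)) /\
  forall phi, test_function phi -> forall i,
    \int[leb]_(x in Omega) (v x * partial i phi x) =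
    - \int[leb]_(x in Omega) (g x 0 i * phi x).

Definition W1p v := Lp v /\ exists g, weak_gradient v g.

(* The weak gradient of [v], unique up to equality a.e. in Omega; the default
   value is only used when [v] has no weak gradient in L^p. *)
Definition wgrad v : 'rV[R]_N -> 'rV[R]_N :=
  xget (cst 0) [set g | weak_gradient v g].

(* Closure of the test functions in W^{1,p}(Omega); on test functions the weak
   gradient is the classical one. *)
Definition W01p v := W1p v /\
  exists phi : nat -> 'rV[R]_N -> R,
    [/\ forall n, test_function (phi n),
        normLp (phi n \- v) @[n --> \oo] --> 0%E &
        normLp (fun x => enorm (grad (phi n) x - wgrad v x)) @[n --> \oo]
          --> 0%E].

Definition lambda_q (q : R) : \bar R :=
  ereal_inf [set (normLp (enorm \o wgrad v) `^ p)%E | v in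
    [set v | W01p v /\ (\int[leb]_(x in Omega) (`|v x| `^ q)%:E = 1)%E]].

(* The limit is taken in the extended reals; it lies in (0, +oo) for bounded
   smooth domains, so that [fine] loses nothing. *)
Definition mu : R :=
  fine (lim ((lambda_q q * (vol Omega `^ (p / q))%:E)%E @[q --> 0^'+])).

(* The value +oo outside of [K] does not affect the essential infimum. *)
Definition ess_inf_on (K : set 'rV[R]_N) w : \bar R :=
  ess_inf leb (patch (cst +oo%E) K (EFin \o w)).

(* Weak solution of -Delta_p w = lam / w, w > 0 in Omega, w = 0 on the
   boundary. The left-hand side of the equation is finite, and for [lam != 0]
   the equality of extended reals entails the integrability of [phi / w]. *)
Definition weak_solution (lam : R) w :=
  [/\ W01p w,
      forall K, compact K -> K `<=` Omega -> (0 < ess_inf_on K w)%E &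
      forall phi, W01p phi ->
        (\int[leb]_(x in Omega)
           (enorm (wgrad w x) `^ (p - 2) * dotr (wgrad w x) (wgrad phi x))%:E =
         lam%:E * \int[leb]_(x in Omega) ((w x)^-1 * phi x)%:E)%E].

(* [lne] is the extended logarithm, with [lne 0 = -oo] *)
Definition int_log v : \bar R :=
  (\int[leb]_(x in Omega) lne (`|v x|%R)%:E)%E.

Definition J (lam : R) v : \bar R :=
  if int_log v == -oo%E then +oo%E
  else (p^-1%:E * \int[leb]_(x in Omega) (enorm (wgrad v x) `^ p)%:E
        - lam%:E * int_log v)%E.

Definition eq_ae v w := v = w %[ae leb in Omega].

End sobolev.

(* Main.v *)
Require Import Defs.
From HB Require Import structures.
From mathcomp Require Import all_boot all_order all_algebra.
From mathcomp Require Import all_classical all_reals all_analysis.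
From mathcomp Require Import ess_sup_inf measurable_realfun ring lra.
Import Order.TTheory GRing.Theory Num.Theory.
Import numFieldNormedType.Exports.
Set Implicit Arguments.
Unset Strict Implicit.
Unset Printing Implicit Defensive.
Local Open Scope classical_set_scope.
Local Open Scope ring_scope.

(** Let V be the volume of the domain. Testing the equation of u with |v| and
applying Hoelder's inequality gives the sharp bound
[[
  mu * (V^-1 * int |v|/u)^p <= int |Dv|^p,
]]
with equality for the multiples of u ([key_inequality], [energy_lower_bound]).
Since ln lies below its tangent lines,
[[
  ln |v| <= ln u + ln s + |v|/(s u) - 1     for s^p = lam * V / mu,
]]
with equality only where |v| = s u. If the integral of ln u is zero, the two
inequalities bound J v from below by a function of the number int |v|/u alone,
and the Bernoulli inequality z^p >= 1 + p (z - 1) gives the asserted minimum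
([J_lower_bound]). Equality forces |v| = s u almost everywhere, and the converse is
a computation ([J_eq_abs], [J_minimizer]).

That the integral of ln u is zero is the only place where the definition of mu as a
limit enters ([geometric_mean_solution]). By Hoelder's inequality and the sharp
bound, lambda_q V^(p/q) is at least mu times the power -p of a normalized power mean
of u whose order tends to 0 with q; testing lambda_q with a multiple of u bounds it
from above by mu times the power -p of the geometric mean of u. Power means tend to
the geometric mean as the order tends to 0, so the limit of lambda_q V^(p/q), which
is mu, equals mu times the power -p of the geometric mean; hence this mean is 1. It
cannot be 0, as then the limit would be +oo, of which [fine] makes mu = 0;
but mu is the energy of u ([mu_energy]), and a function of zero energy with zero
boundary values vanishes ([energy_eq0]).

It remains to see that v has a constant sign when |v| = s u. On a box inside the
domain |v| is bounded below by a positive constant, so a step of class C^1 turns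
v into the indicator of its positivity set, with zero gradient; by the Poincare
inequality on boxes ([poincare_cbox]) the indicator is constant there ([sign_on_box]), and
connectedness extends this to the domain ([constant_sign]).

Everything is done with test functions approximating v: |v| is replaced by smooth
functions of them ([soft_abs]), and weak gradients are unique by the fundamental
lemma of the calculus of variations ([fundamental_lemma]), proved with bump functions
on boxes. *)

(** * Boxes and the Borel structure of R^n *)

Section boxes.
Context {R : realType} {n : nat}.
Implicit Types (a b x : 'rV[R]_n) (A U : set 'rV[R]_n).

Definition obox a b : set 'rV[R]_n := [set x | forall i, a 0 i < x 0 i < b 0 i].
Definition cbox a b : set 'rV[R]_n := [set x | forall i, a 0 i <= x 0 i <= b 0 i].

Lemma obox_sub_cbox a b : obox a b `<=` cbox a b.
Proof. by move=> x abx i; have /andP[/ltW -> /ltW ->] := abx i. Qed.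

Lemma measurable_coord_cap (I : 'I_n -> set R) : (forall i, measurable (I i)) ->
  measurable [set x : 'rV[R]_n | forall i, I i (x 0 i)].
Proof.
move=> mI; rewrite (_ : mkset _ =
    \bigcap_(i in [set: 'I_n]) (@rV_coord R n i @^-1` I i)).
  apply: fin_bigcap_measurable => // i _; rewrite -[X in measurable X]setTI.
  exact: measurable_rV_coord.
by apply/seteqP; split => [x H i _|x H i]; [exact: H|exact: H].
Qed.

Lemma measurable_obox a b : measurable (obox a b).
Proof.
rewrite (_ : obox a b = [set x | forall i, `]a 0 i, b 0 i[%classic (x 0 i)]).
  by apply: (measurable_coord_cap (fun i => measurable_itv _)).
by apply/seteqP; split => x H i; have := H i; rewrite /= in_itv.
Qed.

Lemma measurable_cbox a b : measurable (cbox a b).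
Proof.
rewrite (_ : cbox a b = [set x | forall i, `[a 0 i, b 0 i]%classic (x 0 i)]).
  by apply: (measurable_coord_cap (fun i => measurable_itv _)).
by apply/seteqP; split => x H i; have := H i; rewrite /= in_itv.
Qed.

Lemma compact_cbox a b : compact (cbox a b).
Proof.
rewrite (_ : cbox a b = [set x | forall i, `[a 0 i, b 0 i]%classic (x 0 i)]).
  by apply: (@rV_compact _ _ (fun i => `[a 0 i, b 0 i]%classic)) => i; exact: segment_compact.
by apply/seteqP; split => x H i; have := H i; rewrite /= in_itv.
Qed.

Lemma oboxI a b a' b' : obox a b `&` obox a' b' =
  obox (\row_i Num.max (a 0 i) (a' 0 i)) (\row_i Num.min (b 0 i) (b' 0 i)).
Proof.
apply/seteqP; split => [x [H H'] i|x H].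
  have /andP[h1 h2] := H i; have /andP[h3 h4] := H' i.
  by rewrite !mxE gt_max lt_min h1 h2 h3 h4.
by split => i; have := H i; rewrite !mxE gt_max lt_min =>
  /andP[/andP[h1 h2] /andP[h3 h4]]; apply/andP.
Qed.

Lemma in_ball_rV x (e : R) y : 0 < e ->
  ball x e y <-> forall i, `|x 0 i - y 0 i| < e.
Proof.
move=> e0; split => [[_ H] i|H]; first by have := H 0 i; rewrite -ball_normE.
by split => // i j; rewrite ord1 -ball_normE; exact: H.
Qed.

(** Rational corners suffice to describe open sets, so that countably many
boxes do. *)
Definition rat_box (k : nat) : 'rV[R]_n * 'rV[R]_n :=
  if unpickle k is Some (a, b)
  then (map_mx (@ratr R) (a : 'rV[rat]_n), map_mx (@ratr R) (b : 'rV[rat]_n))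
  else (0, 0).

Definition rat_obox k := obox (rat_box k).1 (rat_box k).2.
Definition rat_cbox k := cbox (rat_box k).1 (rat_box k).2.

Lemma open_rat_box U x : open U -> U x ->
  exists k, rat_obox k x /\ rat_cbox k `<=` U.
Proof.
move=> oU Ux; have /nbhs_ballP[e /= e0 xeU] := open_nbhs_nbhs (conj oU Ux).
have ra i : {q : rat | ratr q \in `]x 0 i - e, x 0 i[}.
  by apply/cid; apply: rat_in_itvoo; rewrite ltrBlDr ltrDl.
have rb i : {q : rat | ratr q \in `]x 0 i, x 0 i + e[}.
  by apply/cid; apply: rat_in_itvoo; rewrite ltrDl.
exists (pickle (\row_i sval (ra i), \row_i sval (rb i))).
rewrite /rat_obox /rat_cbox /rat_box pickleK /=; split.
  move=> i; rewrite !mxE; case: (ra i) => q /=; case: (rb i) => r /=.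
  by rewrite !in_itv/= => /andP[-> _] /andP[_ ->].
move=> y yc; apply: xeU; apply/in_ball_rV => // i; have := yc i; rewrite !mxE.
case: (ra i) => q /=; case: (rb i) => r /=; rewrite !in_itv/=.
move=> /andP[r1 r2] /andP[q1 q2] /andP[y1 y2].
by rewrite ltr_norml; apply/andP; split; lra.
Qed.

Lemma open_bigcup_rat_box U : open U ->
  U = \bigcup_(k in [set k | rat_cbox k `<=` U]) rat_obox k.
Proof.
move=> oU; apply/seteqP; split => [x Ux|x [k kU kx]].
  by have [k [kx kU]] := open_rat_box oU Ux; exists k.
by apply: kU; exact: obox_sub_cbox.
Qed.

Lemma measurable_open_rV U : open U -> measurable U.
Proof.
move=> oU; rewrite (open_bigcup_rat_box oU).
by apply: bigcup_measurable => k _; exact: measurable_obox.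
Qed.

Lemma continuous_measurable_rV (f : 'rV[R]_n -> R) :
  continuous f -> measurable_fun setT f.
Proof.
move=> cf; apply: (measurability _ (RGenOpens.measurableE R)).
move=> _ [_ [a [b ->] <-]]; rewrite setTI; apply: measurable_open_rV.
by move/continuousP : cf; apply; exact: interval_open.
Qed.

Lemma coord_continuous_rV i : continuous (fun x : 'rV[R]_n => x 0 i).
Proof. exact: coord_continuous. Qed.

Lemma continuous_to_rV (T : topologicalType) (f : T -> 'rV[R]_n) :
  (forall i, continuous (fun t => f t 0 i)) -> continuous f.
Proof.
move=> cf t; apply/cvg_ballP => e e0.
have : \forall s \near t, forall i, ball (f t 0 i) e (f s 0 i).
  apply: (@filter_forall _ _ (fun i s => ball (f t 0 i) e (f s 0 i)) (nbhs t)) => i.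
  by have /cvg_ballP/(_ e e0) := cf i t.
by apply: filterS => s H; split => // i j; rewrite ord1; exact: H.
Qed.

Lemma measurable_generated_obox :
  @measurable _ 'rV[R]_n = <<s [set A | exists a b, A = obox a b] >>.
Proof.
apply/seteqP; split; last first.
  apply: smallest_sub; first exact: sigma_algebra_measurable.
  by move=> _ [a [b ->]]; exact: measurable_obox.
apply: smallest_sub; first exact: smallest_sigma_algebra.
rewrite -bigcup_seq/= => A [i _] [B mB <-] /=; rewrite setTI.
set S := <<s _ >>.
have : (@ocitv R).-sigma.-measurable B by [].
have sS : sigma_algebra setT S by exact: smallest_sigma_algebra.
have [S0 SC SU] := sS.
rewrite RGenOpens.measurableE.
pose P := [set B | S (@rV_coord R n i @^-1` B)].
have PS : sigma_algebra setT P.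
  split => /=.
  - by rewrite /P/= preimage_set0.
  - by move=> C; rewrite /P/= => SCC; rewrite setTD preimage_setC -setTD; exact: SC.
  - by move=> F; rewrite /P/= => SF; rewrite preimage_bigcup; exact: SU.
apply: (smallest_sub PS) => _ [c [d ->]]; rewrite /P/=.
rewrite (_ : _ @^-1` _ = \bigcup_k obox
   (\row_j (if j == i then c else - k%:R)) (\row_j (if j == i then d else k%:R))).
  by apply: SU => k; apply: sub_sigma_algebra => /=; do 2 eexists.
apply/seteqP; split => [x|x [k _ H]].
  rewrite /= in_itv/= /rV_coord => /andP[cx xd].
  pose m := Num.truncn (\sum_j `|x 0 j|).
  exists m.+1 => // j; rewrite !mxE; case: eqP => [->|_]; first by rewrite cx.
  rewrite -ltr_norml; apply: le_lt_trans (truncnS_gt _).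
  by rewrite (bigD1 j)//= lerDl sumr_ge0.
by have := H i; rewrite !mxE eqxx /= in_itv.
Qed.

End boxes.

(** * Slicing Lebesgue measure along the first coordinate *)

Section slicing.
Context {R : realType} {n : nat}.
Local Notation leb k := (@lebesgue_rV R k).
Local Notation leb1 := (@lebesgue_measure R).
Local Open Scope ereal_scope.
Implicit Types f : 'rV[R]_n.+1 -> \bar R.

Lemma ge0_integral_rV_cons f : measurable_fun setT f -> (forall x, 0 <= f x) ->
  \int[leb n.+1]_x f x = \int[leb1 \x leb n]_z f (rV_cons z).
Proof.
move=> mf f0.
have := @ge0_integral_pushforward _ _ (measurableTypeR R * 'rV[R]_n)%type _ R _ (@measurable_rV_cons R n)
  (leb1 \x leb n) setT f measurableT mf (fun x _ => f0 x).
rewrite preimage_setT => <-; apply: eq_measure_integral => //.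
exact: measurable_rV_cons.
Qed.

Lemma tonelli_rV f : measurable_fun setT f -> (forall x, 0 <= f x) ->
  \int[leb n.+1]_x f x = \int[leb1]_t \int[leb n]_x f (rV_cons (t, x)).
Proof.
move=> mf f0; rewrite ge0_integral_rV_cons//.
apply: (@fubini_tonelli1 _ _ (measurableTypeR R) _ _ leb1 (leb n) (f \o rV_cons)) => //=.
by apply: measurableT_comp => //; exact: measurable_rV_cons.
Qed.

Lemma tonelli_rV_swap f : measurable_fun setT f -> (forall x, 0 <= f x) ->
  \int[leb n.+1]_x f x = \int[leb n]_x \int[leb1]_t f (rV_cons (t, x)).
Proof.
move=> mf f0; rewrite ge0_integral_rV_cons//.
apply: (@fubini_tonelli2 _ _ (measurableTypeR R) _ _ leb1 (leb n) (f \o rV_cons)) => //=.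
by apply: measurableT_comp => //; exact: measurable_rV_cons.
Qed.

Lemma measurable_slice_integral f : measurable_fun setT f -> (forall x, 0 <= f x) ->
  measurable_fun setT (fun t => \int[leb n]_x f (rV_cons (t, x))).
Proof.
move=> mf f0.
apply: (@measurable_fun_fubini_tonelli_F _ _ (measurableTypeR R) _ _ (leb n) (f \o rV_cons)) => //=.
by apply: measurableT_comp => //; exact: measurable_rV_cons.
Qed.

Lemma measurable_slice_integral_swap f : measurable_fun setT f -> (forall x, 0 <= f x) ->
  measurable_fun setT (fun x => \int[leb1]_t f (rV_cons (t, x))).
Proof.
move=> mf f0.
apply: (@measurable_fun_fubini_tonelli_G _ _ (measurableTypeR R) _ _ leb1 (f \o rV_cons)) => //=.
by apply: measurableT_comp => //; exact: measurable_rV_cons.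
Qed.

Lemma integrable_rV_cons f : (leb n.+1).-integrable setT f ->
  (leb1 \x leb n).-integrable setT (f \o rV_cons).
Proof.
move=> /integrableP[mf foo]; apply/integrableP; split.
  by apply: measurableT_comp => //; exact: measurable_rV_cons.
rewrite -(@ge0_integral_rV_cons (abse \o f))//; last by move=> x /=.
exact: measurableT_comp.
Qed.

Lemma integral_rV_cons f : (leb n.+1).-integrable setT f ->
  \int[leb n.+1]_x f x = \int[leb1 \x leb n]_z f (rV_cons z).
Proof.
move=> intf; have mf := measurable_int _ intf.
have := @integral_pushforward _ _ (measurableTypeR R * 'rV[R]_n)%type _ R _ (@measurable_rV_cons R n)
  (leb1 \x leb n) setT f mf (integrable_rV_cons intf) measurableT.
rewrite preimage_setT => <-; apply: eq_measure_integral => //.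
exact: measurable_rV_cons.
Qed.

Lemma fubini_rV f : (leb n.+1).-integrable setT f ->
  \int[leb n.+1]_x f x = \int[leb1]_t \int[leb n]_x f (rV_cons (t, x)).
Proof.
move=> intf; rewrite integral_rV_cons//.
by rewrite -integral12_prod_meas1//; exact: integrable_rV_cons.
Qed.

Lemma fubini_rV_swap f : (leb n.+1).-integrable setT f ->
  \int[leb n.+1]_x f x = \int[leb n]_x \int[leb1]_t f (rV_cons (t, x)).
Proof.
move=> intf; rewrite integral_rV_cons//.
by rewrite -integral21_prod_meas1//; exact: integrable_rV_cons.
Qed.

Lemma rV_cons0 (t : R) (x : 'rV[R]_n) : rV_cons (t, x) 0%R ord0 = t.
Proof. by rewrite mxE unlift_none. Qed.

Lemma rV_consS (t : R) (x : 'rV[R]_n) j :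
  rV_cons (t, x) 0%R (lift ord0 j) = x 0%R j.
Proof. by rewrite mxE liftK. Qed.

Definition rV_behead (y : 'rV[R]_n.+1) : 'rV[R]_n := (rV_uncons y).2.

Lemma cbox_rV_cons a b t x : cbox a b (rV_cons (t, x)) <->
  (t \in `[a 0%R ord0, b 0%R ord0]) /\ cbox (rV_behead a) (rV_behead b) x.
Proof.
split=> [H|[t01 H] i].
  split; first by have := H ord0; rewrite rV_cons0 in_itv.
  by move=> j; have := H (lift ord0 j); rewrite rV_consS !mxE.
case: (unliftP ord0 i) => [j ->|->]; last by rewrite rV_cons0; move: t01; rewrite in_itv.
by rewrite rV_consS; have := H j; rewrite !mxE.
Qed.

Lemma obox_rV_cons a b t x : obox a b (rV_cons (t, x)) <->
  (t \in `]a 0%R ord0, b 0%R ord0[) /\ obox (rV_behead a) (rV_behead b) x.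
Proof.
split=> [H|[t01 H] i].
  split; first by have := H ord0; rewrite rV_cons0 in_itv.
  by move=> j; have := H (lift ord0 j); rewrite rV_consS !mxE.
case: (unliftP ord0 i) => [j ->|->]; last by rewrite rV_cons0; move: t01; rewrite in_itv.
by rewrite rV_consS; have := H j; rewrite !mxE.
Qed.

Lemma lebesgue_rV_cbox_cons (a b : 'rV[R]_n.+1) : leb n.+1 (cbox a b) =
  leb1 `[a 0%R ord0, b 0%R ord0]%classic * leb n (cbox (rV_behead a) (rV_behead b)).
Proof.
rewrite -product_measure1E//; last exact: measurable_cbox.
rewrite [LHS]/= /lebesgue_rV_step /pushforward; congr (_ _).
apply/seteqP; split => -[t x] /=.
  by move=> /cbox_rV_cons[].
by move=> [? ?]; apply/cbox_rV_cons.
Qed.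

Lemma lebesgue_rV_obox_cons (a b : 'rV[R]_n.+1) : leb n.+1 (obox a b) =
  leb1 `]a 0%R ord0, b 0%R ord0[%classic * leb n (obox (rV_behead a) (rV_behead b)).
Proof.
rewrite -product_measure1E//; last exact: measurable_obox.
rewrite [LHS]/= /lebesgue_rV_step /pushforward; congr (_ _).
apply/seteqP; split => -[t x] /=.
  by move=> /obox_rV_cons[].
by move=> [? ?]; apply/obox_rV_cons.
Qed.

End slicing.

Lemma lebesgue_cbox_lty {R : realType} n (a b : 'rV[R]_n) :
  (lebesgue_rV n (cbox a b) < +oo)%E.
Proof.
elim: n a b => [a b|n IH a b]; first by rewrite /= diracE ltry.
rewrite lebesgue_rV_cbox_cons lebesgue_measure_itv/=.
by apply: lte_mul_pinfty; [case: ifP => //; rewrite lte_fin -subr_gt0 => /ltW|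
  case: ifP|exact: IH].
Qed.

Lemma lebesgue_obox_gt0 {R : realType} n (a b : 'rV[R]_n) :
  (forall i, a 0 i < b 0 i) -> (0 < lebesgue_rV n (obox a b))%E.
Proof.
elim: n a b => [a b _|n IH a b ab].
  by rewrite /= diracE mem_set// => -[].
rewrite lebesgue_rV_obox_cons lebesgue_measure_itv/= lte_fin ab.
by rewrite mule_gt0 ?lte_fin ?subr_gt0 ?ab// IH// => i; rewrite !mxE ab.
Qed.

Lemma lebesgue_open_gt0 {R : realType} n (U : set 'rV[R]_n) :
  open U -> U !=set0 -> (0 < lebesgue_rV n U)%E.
Proof.
move=> oU [x Ux]; have [k [kx kU]] := open_rat_box oU Ux.
apply: lt_le_trans (_ : lebesgue_rV n (rat_obox k) <= _)%E.
  by apply: lebesgue_obox_gt0 => i; have /andP[h1 h2] := kx i; exact: lt_trans h1 h2.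
apply: le_measure; rewrite ?inE.
- exact: measurable_obox.
- exact: measurable_open_rV.
- by apply: subset_trans kU; exact: obox_sub_cbox.
Qed.

Lemma bounded_sub_cbox {R : realType} n (A : set 'rV[R]_n) : bounded_set A ->
  exists M : R, 0 < M /\ A `<=` cbox (const_mx (- M)) (const_mx M).
Proof.
move=> [M [_ AM]]; exists (`|M| + 1); split; first by rewrite ltr_wpDl.
move=> x /AM -/(_ (`|M| + 1)) H i; rewrite !mxE -ler_norml.
have {}H : `|x| <= `|M| + 1 by apply: H; rewrite (le_lt_trans (ler_norm _))// ltrDl.
apply: le_trans H; rewrite [leRHS]/Num.norm /= mx_normrE.
by apply/bigmax_geP; right => /=; exists (0, i).
Qed.

(** * Continuously differentiable functions and their slices *)

Section C1_functions.
Context {R : realType}.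

(** Directional derivatives only see the function along the line, so that those
of a slice are those of the whole function. *)
Lemma derivable_congr (V W : normedModType R) (f : V -> R) (g : W -> R)
    (x v : V) (y w : W) :
  (forall h : R, g (h *: w + y) = f (h *: v + x)) ->
  'D_w g y = 'D_v f x /\ (derivable f x v -> derivable g y w).
Proof.
move=> gf; rewrite /derive /derivable.
suff -> : (fun h : R => h^-1 *: ((g \o shift y) (h *: w) - g y)) =
  (fun h : R => h^-1 *: ((f \o shift x) (h *: v) - f x)) by [].
apply/funext => h /=; rewrite gf.
by have := gf 0; rewrite !scale0r !add0r => ->.
Qed.

Definition C1 n (f : 'rV[R]_n -> R) :=
  [/\ continuous f, (forall i x, derivable f x (delta_mx 0 i)) &
      forall i, continuous (partial i f)].

Lemma smooth_C1 n (f : 'rV[R]_n -> R) : smooth f -> C1 f.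
Proof.
move=> sf; split; [exact: (sf [::]).1|exact: (sf [::]).2|].
by move=> i; exact: (sf [:: i]).1.
Qed.

Lemma continuous_rV_cons_l n (x : 'rV[R]_n) : continuous (fun t : R => rV_cons (t, x)).
Proof.
apply: continuous_to_rV => i; case: (unliftP ord0 i) => [j ->|->].
  under eq_fun do rewrite rV_consS.
  exact: cst_continuous.
by under eq_fun do rewrite rV_cons0.
Qed.

Lemma continuous_rV_cons_r n (t : R) : continuous (fun x : 'rV[R]_n => rV_cons (t, x)).
Proof.
apply: continuous_to_rV => i; case: (unliftP ord0 i) => [j ->|->].
  under eq_fun do rewrite rV_consS.
  exact: coord_continuous_rV.
under eq_fun do rewrite rV_cons0.
exact: cst_continuous.
Qed.

Lemma C1_slice_r n (f : 'rV[R]_n.+1 -> R) t : C1 f ->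
  C1 (fun x => f (rV_cons (t, x))) /\
  forall j x, partial j (fun x => f (rV_cons (t, x))) x =
              partial (lift ord0 j) f (rV_cons (t, x)).
Proof.
move=> [cf df cpf].
have E j (x : 'rV[R]_n) := @derivable_congr _ _ f (fun x => f (rV_cons (t, x)))
  (rV_cons (t, x)) (delta_mx 0 (lift ord0 j)) x (delta_mx 0 j).
have {}E j x : partial j (fun x => f (rV_cons (t, x))) x =
    partial (lift ord0 j) f (rV_cons (t, x)) /\
    derivable (fun x => f (rV_cons (t, x))) x (delta_mx 0 j).
  have [|e d] := E j x.
    move=> h; congr f; apply/rowP => i; rewrite [RHS]mxE [X in _ = X + _]mxE.
    case: (unliftP ord0 i) => [k ->|->].
      by rewrite !rV_consS !mxE/= (inj_eq lift_inj).
    by rewrite !rV_cons0 mxE/= mulr0 add0r.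
  by split=> //; apply: d; exact: df.
split; last by move=> j x; exact: (E j x).1.
split.
- by move=> x; apply: continuous_comp; [exact: continuous_rV_cons_r|exact: cf].
- by move=> i x; exact: (E i x).2.
- move=> i; rewrite (_ : partial i _ = fun x => partial (lift ord0 i) f (rV_cons (t, x))).
    by move=> x; apply: continuous_comp; [exact: continuous_rV_cons_r|exact: cpf].
  by apply/funext => x; exact: (E i x).1.
Qed.

Lemma C1_slice_l n (f : 'rV[R]_n.+1 -> R) x : C1 f ->
  (forall t : R, is_derive t 1 (fun t => f (rV_cons (t, x)))
     (partial ord0 f (rV_cons (t, x)))) /\
  continuous (fun t => partial ord0 f (rV_cons (t, x))).
Proof.
move=> [cf df cpf]; split.
  move=> t; have [|e d] := @derivable_congr _ _ f (fun t => f (rV_cons (t, x)))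
      (rV_cons (t, x)) (delta_mx 0 ord0) t 1.
    move=> h; congr f; apply/rowP => i; rewrite [RHS]mxE [X in _ = X + _]mxE.
    case: (unliftP ord0 i) => [k ->|->].
      by rewrite !rV_consS !mxE/= mulr0 add0r.
    by rewrite !rV_cons0 mxE/=.
  by apply: DeriveDef => //; apply: d; exact: df.
by move=> t; apply: continuous_comp; [exact: continuous_rV_cons_l|exact: cpf].
Qed.

Lemma derivable_everywhere_FTC (F f : R -> R) (a b : R) :
  (forall t : R, is_derive t 1 F (f t)) -> continuous f -> a < b ->
  (\int[lebesgue_measure]_(x in `[a, b]) (f x)%:E = (F b)%:E - (F a)%:E)%E.
Proof.
move=> dF cf ab.
have cF : continuous F.
  by move=> t; apply: differentiable_continuous; apply/derivable1_diffP; case: (dF t).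
apply: continuous_FTC2 => //.
- by apply: continuous_subspaceT.
- split.
  + by move=> t _; case: (dF t).
  + by apply: cvg_at_right_filter; exact: cF.
  + by apply: cvg_at_left_filter; exact: cF.
- by move=> t _; rewrite derive1E; case: (dF t).
Qed.

Lemma variation_le_integral (F f : R -> R) (a b s t : R) :
  (forall t : R, is_derive t 1 F (f t)) -> continuous f ->
  s \in `[a, b] -> t \in `[a, b] ->
  (`|(F t - F s)%:E| <= \int[lebesgue_measure]_(x in `[a, b]) `|f x|%:E)%E.
Proof.
move=> dF cf.
wlog st : s t / s <= t.
  move=> W sab tab; have [st|ts] := leP s t; first exact: W.
  by rewrite -abseN -EFinN opprB; apply: W => //; exact: ltW.
move: st; rewrite le_eqVlt => /predU1P[-> _ _|st sab tab].
  by rewrite subrr abse0 integral_ge0// => x _; rewrite lee_fin.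
have mf : measurable_fun setT f by exact: continuous_measurable_fun.
have mef D : measurable_fun D (EFin \o f) by apply: measurable_funTS; exact/measurable_EFinP.
rewrite EFinB -(derivable_everywhere_FTC dF cf st).
apply: (@le_trans _ _ (\int[lebesgue_measure]_(x in `[s, t]) `|(f x)%:E|)%E).
  by apply: le_abse_integral => //; exact: mef.
apply: ge0_subset_integral => //.
- by apply: measurableT_comp => //; exact: mef.
- move: sab tab; rewrite !in_itv/= => /andP[as_ _] /andP[_ tb].
  by apply: subset_itv; rewrite bnd_simp.
Qed.
End C1_functions.

(** * A Poincare inequality on boxes *)

Section poincare.
Context {R : realType}.
Local Notation leb k := (@lebesgue_rV R k).
Local Notation leb1 := (@lebesgue_measure R).
Local Open Scope ereal_scope.

Lemma measurable_restrict_setT d (T : measurableType d) (D : set T)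
  (f : T -> \bar R) : measurable D -> measurable_fun setT f ->
  measurable_fun setT (f \_ D).
Proof. by move=> mD mf; apply: (measurable_restrictT f mD).1; exact: measurable_funTS. Qed.

Lemma tonelli_cbox n (a b : 'rV[R]_n.+1) (g : 'rV[R]_n.+1 -> \bar R) :
  measurable_fun setT g -> (forall x, 0 <= g x) ->
  \int[leb n.+1]_(x in cbox a b) g x =
  \int[leb1]_(t in `[a 0%R ord0, b 0%R ord0])
    \int[leb n]_(x in cbox (rV_behead a) (rV_behead b)) g (rV_cons (t, x)).
Proof.
move=> mg g0; rewrite integral_mkcond tonelli_rV; last 2 first.
  by apply: measurable_restrict_setT => //; exact: measurable_cbox.
  by move=> x; rewrite patchE; case: ifPn.
rewrite [RHS]integral_mkcond; apply: eq_integral => t _.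
rewrite patchE; case: ifPn => [|] tI.
  rewrite [RHS]integral_mkcond; apply: eq_integral => x _; rewrite !patchE.
  case: ifPn => [/set_mem/cbox_rV_cons[_ /mem_set ->]//|].
  case: ifPn => // /set_mem xab /negP[]; apply/mem_set/cbox_rV_cons.
  by split => //; rewrite inE in tI.
apply: integral0_eq => x _; rewrite patchE ifN//.
by apply: contra tI => /set_mem/cbox_rV_cons[tI _]; apply/mem_set.
Qed.

Lemma tonelli_cbox_swap n (a b : 'rV[R]_n.+1) (g : 'rV[R]_n.+1 -> \bar R) :
  measurable_fun setT g -> (forall x, 0 <= g x) ->
  \int[leb n.+1]_(x in cbox a b) g x =
  \int[leb n]_(x in cbox (rV_behead a) (rV_behead b))
    \int[leb1]_(t in `[a 0%R ord0, b 0%R ord0]) g (rV_cons (t, x)).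
Proof.
move=> mg g0; rewrite integral_mkcond tonelli_rV_swap; last 2 first.
  by apply: measurable_restrict_setT => //; exact: measurable_cbox.
  by move=> x; rewrite patchE; case: ifPn.
rewrite [RHS]integral_mkcond; apply: eq_integral => x _.
rewrite patchE; case: ifPn => [|] xI.
  rewrite [RHS]integral_mkcond; apply: eq_integral => t _; rewrite !patchE.
  case: ifPn => [/set_mem/cbox_rV_cons[tab _]|].
    by rewrite ifT// inE.
  case: ifPn => // /set_mem tab /negP[]; apply/mem_set/cbox_rV_cons.
  by split => //; rewrite inE in xI.
apply: integral0_eq => t _; rewrite patchE ifN//.
by apply: contra xI => /set_mem/cbox_rV_cons[_ xI]; apply/mem_set.
Qed.

(** Otherwise the function exceeds its finite mean everywhere, while the excess
has integral zero. *)
Lemma exists_le_mean (a b : R) (F : R -> \bar R) : (a < b)%R ->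
  measurable_fun setT F -> (forall t, 0 <= F t) ->
  exists2 s, s \in `[a, b] &
    (b - a)%:E * F s <= \int[leb1]_(t in `[a, b]) F t.
Proof.
move=> ab mF F0; apply: contrapT => noS.
set S := \int[leb1]_(t in _) _ in noS *.
have ltS s : s \in `[a, b] -> S < (b - a)%:E * F s.
  by move=> sab; rewrite ltNge; apply/negP => Fs; apply: noS; exists s.
have S0 : 0 <= S by exact: integral_ge0.
have Sfin : S \is a fin_num.
  rewrite ge0_fin_numE//; have := ltS a; rewrite in_itv/= lexx ltW// => /(_ isT).
  by move=> /lt_le_trans; apply; exact: leey.
have iI : leb1 `[a, b]%classic = (b - a)%:E.
  by rewrite lebesgue_measure_itv/= lte_fin ab.
have ba0 : (0 < b - a)%R by rewrite subr_gt0.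
have mI : measurable (`[a, b]%classic : set R) by exact: measurable_itv.
pose c := ((b - a)^-1)%:E * S.
have cfin : c \is a fin_num by rewrite fin_numM.
have ltc s : s \in `[a, b] -> c < F s.
  by move=> /ltS; rewrite /c lte_pdivrMl.
have intF : leb1.-integrable `[a, b] F.
  apply/integrableP; split; first exact: measurable_funTS.
  under eq_integral do rewrite gee0_abs//.
  by rewrite -/S ltey_eq Sfin.
have Ic : \int[leb1]_(t in `[a, b]) cst c t = c * (b - a)%:E.
  by rewrite -iI; exact: integral_cst.
have intc : leb1.-integrable `[a, b] (cst c).
  rewrite -(fineK cfin); apply/integrableP; split=> //.
  by rewrite integral_cst//= iI ltry.
have : \int[leb1]_(t in `[a, b]) `|F t - c| = 0.
  transitivity (\int[leb1]_(t in `[a, b]) (F t - cst c t)).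
    apply: eq_integral => t /set_mem tab; rewrite gee0_abs// sube_ge0 ?cfin//.
    by apply: ltW; apply: ltc.
  rewrite integralB// -/S Ic /c muleAC -EFinM mulVf ?gt_eqF//.
  by rewrite mul1e subee.
have mFc : measurable_fun `[a, b] (fun t => F t - c).
  by apply: emeasurable_funB; [exact: measurable_funTS|exact: measurable_cst].
move=> /(ae_eq_integral_abs leb1 mI mFc)[N [mN N0 subN]].
have : leb1 `[a, b]%classic <= leb1 N.
  apply: le_measure; rewrite ?inE//; apply: subset_trans subN => t tab /= /(_ tab) Fc.
  by have := ltc t tab; rewrite -sube_gt0 Fc ltxx.
by rewrite iI N0 lee_fin leNgt ba0.
Qed.

Lemma measurable_slice_cbox n (a b : 'rV[R]_n) (g : 'rV[R]_n.+1 -> \bar R) :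
  measurable_fun setT g -> (forall x, 0 <= g x) ->
  measurable_fun setT (fun t => \int[leb n]_(x in cbox a b) g (rV_cons (t, x))).
Proof.
move=> mg g0.
have mD : measurable (@rV_behead R n @^-1` cbox a b).
  rewrite -[X in measurable X]setTI.
  apply: (measurableT_comp measurable_snd (@measurable_rV_uncons R n)) => //.
  exact: measurable_cbox.
have := @measurable_slice_integral R n (g \_ (@rV_behead R n @^-1` cbox a b)).
rewrite (_ : (fun t => _) = fun t => \int[leb n]_(x in cbox a b) g (rV_cons (t, x))).
  apply; last by move=> x; rewrite patchE; case: ifPn.
  exact: measurable_restrict_setT.
apply/funext => t; rewrite [RHS]integral_mkcond; apply: eq_integral => x _.
rewrite !patchE (_ : (_ \in _ @^-1` _) = (x \in cbox a b))//.
by apply/idP/idP; rewrite !inE/= /rV_behead rV_consK.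
Qed.

Lemma measurable_slice_itv n (a b : R) (g : 'rV[R]_n.+1 -> \bar R) :
  measurable_fun setT g -> (forall x, 0 <= g x) ->
  measurable_fun setT (fun x => \int[leb1]_(t in `[a, b]) g (rV_cons (t, x))).
Proof.
move=> mg g0.
have mD : measurable (@rV_coord R n.+1 ord0 @^-1` `[a, b]%classic).
  rewrite -[X in measurable X]setTI.
  exact: measurable_rV_coord.
have := @measurable_slice_integral_swap R n (g \_ (@rV_coord R n.+1 ord0 @^-1` `[a, b]%classic)).
rewrite (_ : (fun t => _) = fun x => \int[leb1]_(t in `[a, b]) g (rV_cons (t, x))).
  apply; last by move=> x; rewrite patchE; case: ifPn.
  exact: measurable_restrict_setT.
apply/funext => x; rewrite [RHS]integral_mkcond; apply: eq_integral => t _.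
rewrite !patchE (_ : (_ \in _ @^-1` _) = (t \in `[a, b]%classic))//.
by apply/idP/idP; rewrite !inE/= /rV_coord rV_cons0.
Qed.

Lemma measurable_normr_continuous n (g : 'rV[R]_n -> R) : continuous g ->
  measurable_fun setT (fun x => `|g x|%:E).
Proof.
move=> cg; apply/measurable_EFinP.
by apply: measurableT_comp => //; exact: continuous_measurable_rV.
Qed.

(** Induction on the dimension: the slice at a suitable height [s] has an
energy at most the mean energy of the slices, and the other slices are
compared to it by integrating the first partial derivative. *)
Lemma poincare_cbox n (a b : 'rV[R]_n) : (forall i, a 0 i < b 0 i)%R ->
  exists2 C : R, (0 <= C)%R & forall f, C1 f -> exists c : R,
    \int[leb n]_(x in cbox a b) `|f x - c|%:E <=
    C%:E * \sum_(i < n) \int[leb n]_(x in cbox a b) `|partial i f x|%:E.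
Proof.
elim: n a b => [a b _|n IH a b ab].
  exists 0%R => // f _; exists (f 0%R); rewrite mul0e.
  rewrite integral0_eq// => x _; rewrite (_ : x = 0%R) ?subrr ?normr0//.
  by apply/rowP => -[].
have {IH}[|C' C'0 IH] := IH (rV_behead a) (rV_behead b).
  by move=> i; rewrite !mxE.
pose a0 := a 0%R ord0; pose b0 := b 0%R ord0; pose L := (b0 - a0)%R.
have ab0 : (a0 < b0)%R by exact: ab.
have L0 : (0 < L)%R by rewrite subr_gt0.
exists (L + C')%R; first by rewrite addr_ge0// ltW.
move=> f C1f; have [cf df cpf] := C1f.
set Q' := cbox (rV_behead a) (rV_behead b) in IH *.
have mQ' : measurable Q' by exact: measurable_cbox.
pose g i x := `|partial i f x|%:E.
have mg i : measurable_fun setT (g i) by apply: measurable_normr_continuous; exact: cpf.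
have g0 i x : 0 <= g i x by rewrite lee_fin.
pose F j t := \int[leb n]_(x in Q') g (lift ord0 j) (rV_cons (t, x)).
have F0 j t : 0 <= F j t by exact: integral_ge0.
have mF j : measurable_fun setT (F j) by exact: measurable_slice_cbox.
have [||s sab Fs] := @exists_le_mean a0 b0 (fun t => \sum_(j < n) F j t) ab0.
- exact: emeasurable_sum.
- by move=> t; exact: sume_ge0.
have {}Fs : L%:E * \sum_(j < n) F j s <=
    \sum_(j < n) \int[leb n.+1]_(x in cbox a b) g (lift ord0 j) x.
  apply: le_trans Fs _; rewrite ge0_integral_sum//; last first.
    by move=> j; apply: measurable_funTS; exact: mF.
  by apply: lee_sum => j _; rewrite tonelli_cbox.
have [C1s ps] := C1_slice_r s C1f.
have [c fc] := IH _ C1s; exists c.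
have mfc : measurable_fun setT (fun x => `|f x - c|%:E).
  apply: measurable_normr_continuous => x; apply: continuousB; first exact: cf.
  exact: cst_continuous.
rewrite tonelli_cbox//.
pose V x := \int[leb1]_(r in `[a0, b0]) g ord0 (rV_cons (r, x)).
have V0 x : 0 <= V x by exact: integral_ge0.
have IV : \int[leb n]_(x in Q') V x = \int[leb n.+1]_(x in cbox a b) g ord0 x.
  by rewrite tonelli_cbox_swap.
have mV : measurable_fun Q' V.
  by apply: measurable_funTS; exact: measurable_slice_itv.
pose h x := `|f (rV_cons (s, x)) - c|%:E.
have mh : measurable_fun Q' h.
  apply: measurable_funTS.
  apply: (measurableT_comp mfc (measurableT_comp (@measurable_rV_cons R n) _)).
  exact: measurable_pair1.
apply: (@le_trans _ _ (\int[leb1]_(t in `[a0, b0])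
    \int[leb n]_(x in Q') (V x + h x))).
  apply: ge0_le_integral => //.
  - by move=> t _; exact: integral_ge0.
  - have fc0 x : 0 <= `|f x - c|%:E by rewrite lee_fin.
    exact: measurable_funS (measurable_slice_cbox (rV_behead a) (rV_behead b) mfc fc0).
  - move=> t tab; apply: ge0_le_integral => //.
    + apply: measurable_funTS.
      apply: (measurableT_comp mfc (measurableT_comp (@measurable_rV_cons R n) _)).
      exact: measurable_pair1.
    + exact: emeasurable_funD.
    + move=> x _.
      have [d0 cd0] := C1_slice_l x C1f.
      have := variation_le_integral d0 cd0 sab tab.
      rewrite -/(V x) => Vx; apply: le_trans (leeD Vx (lexx (h x))).
      rewrite /h -EFinD lee_fin; apply: le_trans (ler_normD _ _).
      by rewrite addrA subrK.
have IK (K : \bar R) : \int[leb1]_(t in `[a0, b0]) K = K * L%:E.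
  transitivity (K * leb1 `[a0, b0]%classic); first exact: integral_cst.
  by rewrite lebesgue_measure_itv/= lte_fin ab0 -EFinB.
rewrite IK.
rewrite ge0_integralD//; last by move=> x _; rewrite lee_fin.
have h0 : 0 <= \int[leb n]_(x in Q') h x by apply: integral_ge0 => x _; rewrite lee_fin.
have A0 i : 0 <= \int[leb n.+1]_(x in cbox a b) g i x by exact: integral_ge0.
rewrite IV big_ord_recl muleC ge0_muleDr//.
have hC : \int[leb n]_(x in Q') h x <= C'%:E * \sum_(j < n) F j s.
  apply: le_trans fc _; apply: lee_wpmul2l; first by rewrite lee_fin.
  by apply: lee_sum => j _; under eq_integral do rewrite ps.
have S0 : 0 <= \sum_(j < n) \int[leb n.+1]_(x in cbox a b) g (lift ord0 j) x.
  by apply: sume_ge0 => j _; exact: A0.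
rewrite [leRHS]ge0_muleDr//; last exact: A0.
apply: leeD.
  by rewrite lee_wpmul2r// lee_fin lerDl.
apply: (@le_trans _ _ (C'%:E * (L%:E * \sum_(j < n) F j s))).
  by rewrite muleCA lee_wpmul2l// lee_fin ltW.
apply: (@le_trans _ _ (C'%:E * \sum_(j < n)
   \int[leb n.+1]_(x in cbox a b) g (lift ord0 j) x)).
  by rewrite lee_wpmul2l// lee_fin.
by rewrite lee_wpmul2r// lee_fin lerDr ltW.
Qed.

End poincare.

(** * Partial derivatives of compactly supported functions integrate to zero *)

Section zero_integral.
Context {R : realType}.
Local Notation leb k := (@lebesgue_rV R k).
Local Notation leb1 := (@lebesgue_measure R).

Lemma partial_eq0_outside n (f : 'rV[R]_n -> R) (K : set 'rV[R]_n) i : closed K ->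
  (forall x, ~ K x -> f x = 0) -> forall x, ~ K x -> partial i f x = 0.
Proof.
move=> cK f0 x Kx; rewrite /partial (near_eq_derive (g := cst 0)) ?derive_cst//.
by near do apply: f0; exact: (open_nbhs_nbhs (conj (closed_openC cK) Kx)).
Unshelve. all: by end_near. Qed.

Lemma integrable_continuous_support n (g : 'rV[R]_n -> R) (a b : 'rV[R]_n) :
  continuous g -> (forall x, ~ cbox a b x -> g x = 0) ->
  (leb n).-integrable setT (EFin \o g).
Proof.
move=> cg g0; have mQ := measurable_cbox a b.
have -> : EFin \o g = (EFin \o g) \_ (cbox a b).
  apply/funext => x; rewrite patchE; case: ifPn => // /negP xQ /=.
  by rewrite g0// => ?; apply: xQ; rewrite inE.
apply/(integrable_mkcond _ mQ); apply: measurable_bounded_integrable => //.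
- exact: lebesgue_cbox_lty.
- by apply: measurable_funTS; exact: continuous_measurable_rV.
- have /compact_bounded[M [Mr HM]] := continuous_compact (continuous_subspaceT cg) (@compact_cbox R n a b).
  by exists M; split => // r Mr' x Qx; apply: HM => //; exists x.
Qed.

Lemma integral_derivative_eq0 (F f : R -> R) (M : R) :
  (forall t : R, is_derive t 1 F (f t)) -> continuous f ->
  (forall t, M < `|t| -> F t = 0) ->
  (\int[leb1]_t (f t)%:E = 0)%E.
Proof.
move=> dF cf F0.
have f0 t : M < `|t| -> f t = 0.
  move=> Mt; have [_ <-] := dF t; rewrite (near_eq_derive (g := cst 0)) ?derive_cst//.
  have : \forall s \near t, M < `|s|.
    have nt : (fun s : R => `|s|) s @[s --> t] --> `|t| by exact: norm_continuous.
    exact: cvgr_gt nt _ Mt.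
  by apply: filterS => s; exact: F0.
pose a := `|M| + 1.
have Ma : M < a by rewrite (le_lt_trans (ler_norm _))// ltrDl.
have a0 : 0 < a by rewrite ltr_wpDl.
transitivity (\int[leb1]_(t in `[(- a)%R, a]) (f t)%:E)%E.
  rewrite [RHS]integral_mkcond; apply: eq_integral => t _; rewrite patchE.
  case: ifPn => // /negP taN; rewrite f0// (lt_le_trans Ma)// leNgt.
  apply/negP => ta; apply: taN; rewrite inE/= in_itv/= -ler_norml; exact: ltW.
rewrite (derivable_everywhere_FTC dF cf)//; last by rewrite gtrN.
by rewrite !F0 ?subee// ?normrN gtr0_norm.
Qed.

(** Integrate first along the direction of differentiation, if it is the first
coordinate, and otherwise argue slice by slice. *)
Lemma integral_partial_eq0 n (f : 'rV[R]_n -> R) (M : R) i : C1 f ->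
  (forall x, ~ cbox (const_mx (- M)) (const_mx M) x -> f x = 0) ->
  (\int[leb n]_x (partial i f x)%:E = 0)%E.
Proof.
elim: n f i => [f [] //|n IH f i C1f f0].
have [_ _ cpf] := C1f.
have cK : closed (cbox (const_mx (- M)) (const_mx M) : set 'rV[R]_n.+1).
  by apply: compact_closed; [exact: norm_hausdorff|exact: compact_cbox].
have intf : (leb n.+1).-integrable setT (EFin \o partial i f).
  apply: integrable_continuous_support; first exact: cpf.
  exact: partial_eq0_outside cK f0.
have coordM (y : 'rV[R]_n.+1) j : M < `|y 0 j| -> f y = 0.
  move=> My; apply: f0 => /(_ j); rewrite !mxE -ler_norml.
  by rewrite leNgt My.
case: (unliftP ord0 i) => [j ij|i0].
  rewrite (fubini_rV intf); rewrite ij.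
  apply: integral0_eq => t _ /=.
  have [C1t pt] := C1_slice_r t C1f.
  under eq_integral do rewrite -pt.
  apply: IH => // x xM; apply: f0 => fM; apply: xM => k.
  by have := fM (lift ord0 k); rewrite rV_consS !mxE.
rewrite (fubini_rV_swap intf) i0; apply: integral0_eq => x _ /=.
have [dx cx] := C1_slice_l x C1f.
apply: (integral_derivative_eq0 dx cx (M := M)) => t Mt.
by apply: (coordM _ ord0); rewrite rV_cons0.
Qed.

End zero_integral.

(** * Smooth functions: chain rule, square roots, bump functions *)

(** Functions obtained from a set [B] by sums and products. If the derivatives
of the members of [B] stay in this algebra, all its members are smooth; this
avoids formulas for higher derivatives. *)
Inductive alg_closure {R : realType} {T : Type} (B : set (T -> R)) : set (T -> R) :=
| alg_base f : B f -> alg_closure B f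
| alg_cst (c : R) : alg_closure B (fun=> c)
| alg_add f g : alg_closure B f -> alg_closure B g -> alg_closure B (fun x => f x + g x)
| alg_mul f g : alg_closure B f -> alg_closure B g -> alg_closure B (fun x => f x * g x).

Section smooth_closure.
Context {R : realType} {n : nat}.
Implicit Types (f g phi : 'rV[R]_n -> R) (B : set ('rV[R]_n -> R)).

Lemma alg_closure_smooth B :
  (forall f, B f -> continuous f /\
    forall i, exists f', (forall x, is_derive x (delta_mx 0 i) f (f' x)) /\
      alg_closure B f') ->
  forall f, alg_closure B f -> smooth f.
Proof.
move=> HB.
have step f : alg_closure B f -> continuous f /\
    forall i, (forall x, derivable f x (delta_mx 0 i)) /\ alg_closure B (partial i f).
  suff : alg_closure B f -> continuous f /\
      forall i, exists f', (forall x, is_derive x (delta_mx 0 i) f (f' x)) /\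
        alg_closure B f'.
    move=> H /H[cf Hf]; split => // i; have [f' [df' Bf']] := Hf i.
    split; first by move=> x; case: (df' x).
    rewrite (_ : partial i f = f')//.
    by apply/funext => x; case: (df' x).
  elim => {f} [f /HB//|c|f g _ [cf Hf] _ [cg Hg]|f g aBf [cf Hf] aBg [cg Hg]].
  - split; first exact: cst_continuous.
    by move=> i; exists (fun=> 0); split; [move=> x; exact: is_derive_cst|exact: alg_cst].
  - split; first by move=> x; apply: continuousD; [exact: cf|exact: cg].
    move=> i; have [f' [df Bf]] := Hf i; have [g' [dg Bg]] := Hg i.
    exists (fun x => f' x + g' x); split; last exact: alg_add.
    by move=> x; exact: is_deriveD.
  - split; first by move=> x; apply: continuousM; [exact: cf|exact: cg].
    move=> i; have [f' [df Bf]] := Hf i; have [g' [dg Bg]] := Hg i.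
    exists (fun x => f x * g' x + g x * f' x); split; last first.
      by apply: alg_add; exact: alg_mul.
    by move=> x; exact: is_deriveM.
move=> f Bf s; have {}Bf : alg_closure B (foldr partial f s).
  by elim: s => //= i s IH; have [_ /(_ i)[]] := step _ IH.
by have [cf Hf] := step _ Bf; split => // i x; exact: (Hf i).1.
Qed.

Lemma smooth_derive f i : smooth f ->
  continuous f /\ (forall x, is_derive x (delta_mx 0 i) f (partial i f x)) /\
  smooth (partial i f).
Proof.
move=> sf; split; first exact: (sf [::]).1.
split; first by move=> x; apply: DeriveDef => //; exact: (sf [::]).2.
by move=> s; have := sf (rcons s i); rewrite foldr_rcons.
Qed.

Lemma smooth_alg f : alg_closure smooth f -> smooth f.
Proof.
apply: alg_closure_smooth => {}f sf; split; first exact: (sf [::]).1.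
move=> i; have [_ [df sp]] := smooth_derive i sf.
by exists (partial i f); split => //; exact: alg_base.
Qed.

Lemma smooth_cst (c : R) : smooth (fun _ : 'rV[R]_n => c).
Proof. by apply: smooth_alg; exact: alg_cst. Qed.

Lemma smoothD f g : smooth f -> smooth g -> smooth (fun x => f x + g x).
Proof. by move=> sf sg; apply/smooth_alg/alg_add; exact: alg_base. Qed.

Lemma smoothM f g : smooth f -> smooth g -> smooth (fun x => f x * g x).
Proof. by move=> sf sg; apply/smooth_alg/alg_mul; exact: alg_base. Qed.

Lemma smooth_prod (I : Type) (s : seq I) (F : I -> 'rV[R]_n -> R) :
  (forall i, smooth (F i)) -> smooth (fun x => \prod_(i <- s) F i x).
Proof.
move=> sF; elim: s => [|i s IH].
  by under eq_fun do rewrite big_nil; exact: smooth_cst.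
by under eq_fun do rewrite big_cons; exact: smoothM.
Qed.

Lemma smooth_coord i : smooth (fun x : 'rV[R]_n => x 0 i).
Proof.
pose B : set ('rV[R]_n -> R) := [set f | exists i, f = fun x : 'rV[R]_n => x 0 i].
suff HB : forall f, B f -> continuous f /\ forall i, exists f',
    (forall x, is_derive x (delta_mx 0 i) f (f' x)) /\ alg_closure B f'.
  by apply: (alg_closure_smooth HB); apply: alg_base; exists i.
move=> _ [j ->]; split; first exact: coord_continuous_rV.
move=> k; exists (fun=> (delta_mx 0 k : 'rV[R]_n) 0 j); split; last exact: alg_cst.
move=> x; have [|e d] := @derivable_congr _ R^o _ id (fun x : 'rV[R]_n => x 0 j)
    (x 0 j) ((delta_mx 0 k : 'rV[R]_n) 0 j) x (delta_mx 0 k).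
  by move=> t; rewrite !mxE.
apply: DeriveDef; first by apply: d; exact: derivable_id.
by rewrite e derive_id.
Qed.

Lemma is_derive_chain (h : R -> R) phi (x v : 'rV[R]_n) (a b : R) :
  is_derive (phi x) 1 h a -> is_derive x v phi b ->
  is_derive x v (h \o phi) (a * b).
Proof.
move=> dh dphi.
have E : 'D_v (h \o phi) x = 'D_1 (h \o (fun t : R => phi (t *: v + x))) 0 /\
  (derivable (h \o (fun t : R => phi (t *: v + x))) 0 1 -> derivable (h \o phi) x v).
  split; last exact: (derivable1P (h \o phi) x v).2.
  by have [-> _] := @derivable_congr _ _ _ (h \o phi) (h \o (fun t : R => phi (t *: v + x))) x v 0 1 (fun t => congr1 (fun t => h (phi (t *: v + x))) (etrans (addr0 _) (mulr1 _))).
have E' : 'D_v phi x = 'D_1 (fun t : R => phi (t *: v + x)) 0.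
  by have [-> _] := @derivable_congr _ _ _ phi (fun t : R => phi (t *: v + x)) x v 0 1 (fun t => congr1 (fun t => phi (t *: v + x)) (etrans (addr0 _) (mulr1 _))).
have d1 : is_derive (0 : R) 1 (fun t : R => phi (t *: v + x)) b.
  by case: dphi => dphi e; apply: DeriveDef; [exact: (derivable1P phi x v).1|rewrite -E'].
have d2 : is_derive ((fun t : R => phi (t *: v + x)) 0) 1 h a.
  by rewrite scale0r add0r.
have [d3 e3] := @is_derive1_comp _ h (fun t : R => phi (t *: v + x)) 0 a b d2 d1.
by case: E => E1 E2; apply: DeriveDef; [exact: E2|rewrite E1].
Qed.

(** By the chain rule, the derivatives of the composites are polynomials in the
composites and in smooth functions. *)
Lemma smooth_comp (H : set (R -> R)) phi : smooth phi ->
  (forall h, H h -> exists h', (forall t : R, is_derive t 1 h (h' t)) /\ alg_closure H h') ->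
  forall h, H h -> smooth (h \o phi).
Proof.
move=> sphi HH h Hh.
pose B : set ('rV[R]_n -> R) := [set f | smooth f \/ exists2 h, H h & f = h \o phi].
apply: (@alg_closure_smooth B); last by apply: alg_base; right; exists h.
move=> f [sf|[k Hk ->]].
  split; first exact: (sf [::]).1.
  move=> i; have [_ [df sp]] := smooth_derive i sf.
  by exists (partial i f); split => //; apply: alg_base; left.
have [k' [dk Hk']] := HH _ Hk.
split.
  move=> x; apply: continuous_comp; first exact: (sphi [::]).1.
  by apply: differentiable_continuous; apply/derivable1_diffP; case: (dk (phi x)).
move=> i; have [_ [dphi sp]] := smooth_derive i sphi.
exists (fun x => (k' \o phi) x * partial i phi x); split.
  by move=> x; exact: is_derive_chain.
apply: alg_mul; last by apply: alg_base; left.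
elim: Hk' => [g Hg|c|g1 g2 _ I1 _ I2|g1 g2 _ I1 _ I2].
- by apply: alg_base; right; exists g.
- exact: alg_cst.
- exact: alg_add.
- exact: alg_mul.
Qed.

End smooth_closure.

Section special_functions.
Context {R : realType}.

Lemma sqrt_quad_gt0 (e t : R) : 0 < e -> 0 < Num.sqrt (t ^+ 2 + e ^+ 2).
Proof. by move=> e0; rewrite sqrtr_gt0 ltr_wpDl ?sqr_ge0// exprn_gt0. Qed.

Lemma is_derive_sqrt_quad (e t : R) : 0 < e ->
  is_derive t 1 (fun t => Num.sqrt (t ^+ 2 + e ^+ 2)) (t / Num.sqrt (t ^+ 2 + e ^+ 2)).
Proof.
move=> e0; have t0 : 0 < t ^+ 2 + e ^+ 2 by rewrite ltr_wpDl ?sqr_ge0// exprn_gt0.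
have s0 := sqrt_quad_gt0 t e0.
have d1 : is_derive t 1 (fun t : R => t ^+ 2 + e ^+ 2) (2 * t).
  have d2 : is_derive t 1 (fun t : R => t ^+ 2) (2 * t).
    apply: DeriveDef; first exact: exprn_derivable.
    by rewrite exp_derive expr1 /GRing.scale/= mulr1.
  have d3 := is_deriveD d2 (is_derive_cst (e ^+ 2) t 1).
  by apply: is_derive_eq d3 _; rewrite addr0.
have d2 := is_derive1_sqrt t0.
have d3 := @is_derive1_comp R Num.sqrt (fun t => t ^+ 2 + e ^+ 2) t _ _ d2 d1.
apply: is_derive_eq d3 _; field.
by rewrite gt_eqF.
Qed.

(** A smooth approximation of |t| that vanishes at 0, so that composing with it
preserves compact supports. *)
Definition soft_abs (e t : R) : R := Num.sqrt (t ^+ 2 + e ^+ 2) - e.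

Lemma soft_abs0 (e : R) : 0 < e -> soft_abs e 0 = 0.
Proof. by move=> e0; rewrite /soft_abs expr0n/= add0r sqrtr_sqr gtr0_norm// subrr. Qed.

Lemma ler_norm_sqrt_quad (e t : R) : `|t| <= Num.sqrt (t ^+ 2 + e ^+ 2).
Proof. by rewrite -sqrtr_sqr ler_wsqrtr// lerDl sqr_ge0. Qed.

Lemma soft_abs_ge (e t : R) : `|t| - e <= soft_abs e t.
Proof. by rewrite lerB// ler_norm_sqrt_quad. Qed.

Lemma soft_abs_ge0 (e t : R) : 0 < e -> 0 <= soft_abs e t.
Proof.
move=> e0; rewrite subr_ge0 -[leLHS]gtr0_norm// -sqrtr_sqr ler_wsqrtr//.
by rewrite lerDr sqr_ge0.
Qed.

Lemma smooth_soft_abs n (e : R) (phi : 'rV[R]_n -> R) : 0 < e -> smooth phi ->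
  smooth (soft_abs e \o phi).
Proof.
move=> e0 sphi.
pose S (t : R) := Num.sqrt (t ^+ 2 + e ^+ 2).
pose H : set (R -> R) := [set h | [\/ h = S, h = (fun t => (S t)^-1) | h = (fun t => t)]].
have S0 t : S t != 0 by rewrite gt_eqF// sqrt_quad_gt0.
have HS : H S by exact: Or31.
suff : smooth (S \o phi) by move=> sS; apply: smoothD => //; exact: smooth_cst.
apply: (smooth_comp sphi _ HS) => h [->|->|->].
- exists (fun t => t * (S t)^-1); split; first by move=> t; exact: is_derive_sqrt_quad.
  by apply: alg_mul; apply: alg_base; [exact: Or33|exact: Or32].
- exists (fun t => -1 * ((S t)^-1 * (S t)^-1) * (t * (S t)^-1)); split.
    move=> t; apply: is_derive_eq; first exact: is_deriveV (S0 t) (is_derive_sqrt_quad t e0).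
    by rewrite /GRing.scale/= mulN1r -invfM expr2.
  apply: alg_mul; first apply: alg_mul; first exact: alg_cst.
    by apply: alg_mul; apply: alg_base; exact: Or32.
  by apply: alg_mul; apply: alg_base; [exact: Or33|exact: Or32].
- exists (fun=> 1); split; last exact: alg_cst.
  by move=> t; exact: is_derive_id.
Qed.

Lemma partial_soft_abs n (e : R) (phi : 'rV[R]_n -> R) i x : 0 < e -> smooth phi ->
  partial i (soft_abs e \o phi) x =
  phi x / Num.sqrt (phi x ^+ 2 + e ^+ 2) * partial i phi x.
Proof.
move=> e0 sphi; have [_ [dphi _]] := smooth_derive i sphi.
have d1 : is_derive (phi x) 1 (soft_abs e) (phi x / Num.sqrt (phi x ^+ 2 + e ^+ 2)).
  apply: is_derive_eq; first exact: (is_deriveB (g := cst e) (is_derive_sqrt_quad (phi x) e0)).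
  by rewrite subr0.
by have [_ <-] := is_derive_chain d1 (dphi x).
Qed.

(** The functions t^-m exp(-1/t), extended by zero. *)
Definition flat (m : nat) (t : R) : R := if 0 < t then t ^- m * expR (- t^-1) else 0.

Lemma flat_ge0 m t : 0 <= flat m t.
Proof. by rewrite /flat; case: ifPn => // t0; rewrite mulr_ge0 ?expR_ge0// invr_ge0 exprn_ge0// ltW. Qed.

Lemma flat_le1 t : flat 0 t <= 1.
Proof.
rewrite /flat; case: ifPn => // t0; rewrite expr0 invr1 mul1r.
by rewrite -[leRHS]expR0 ler_expR oppr_le0 invr_ge0 ltW.
Qed.

Lemma flat_le m (t : R) : flat m t <= m.+1`!%:R * `|t|.
Proof.
rewrite /flat; case: ifPn => [t0|_]; last by rewrite mulr_ge0.
have F0 : 0 < m.+1`!%:R :> R by rewrite ltr0n fact_gt0.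
have H (y : R) : 0 < y -> y ^+ m * expR (- y) <= m.+1`!%:R / y.
  move=> y0; rewrite expRN ler_pdivrMr ?expR_gt0// mulrAC ler_pdivlMr// -exprSr.
  rewrite mulrC -ler_pdivrMr//; apply: le_trans (expR_ge1Dxn m (ltW y0)).
  by rewrite lerDr.
by have := H t^-1; rewrite invrK invr_gt0 gtr0_norm// exprVn; apply.
Qed.

(** The derivatives of flat functions are combinations of flat functions; at 0 the
difference quotient of [flat m] is [flat m.+1], which tends to 0. *)
Lemma is_derive_flat m (t : R) :
  is_derive t 1 (flat m) (- m%:R * flat m.+1 t + flat m.+2 t).
Proof.
have [t0|t0|->] := ltgtP t 0.
- rewrite /flat !ltNge ltW//= mulr0 addr0; apply: (near_eq_is_derive (f := cst 0)).
    by near=> s; rewrite /= ltNge ltW//; near: s; exact: lt_nbhsl.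
- have e0 : t != 0 by rewrite gt_eqF.
  have d1 : is_derive t 1 (fun t : R => t ^+ m) (m%:R * t ^+ m.-1).
    apply: DeriveDef; first exact: exprn_derivable.
    by rewrite exp_derive /GRing.scale/= mulr1.
  have d2 : is_derive t 1 (fun t : R => t ^- m) (- (t ^+ m) ^- 2 * (m%:R * t ^+ m.-1)).
    by apply: is_deriveV; rewrite expf_neq0.
  have d3 : is_derive t 1 (fun t : R => - t^-1) (t ^- 2).
    have := is_deriveN (is_deriveV (f := id) e0 (is_derive_id t 1)).
    by move=> d; apply: is_derive_eq d _; rewrite /GRing.scale/= mulr1 opprK.
  have d4 := @is_derive1_comp R expR (fun t => - t^-1) t _ _ (is_derive_expR (- t^-1)) d3.
  have d5 := is_deriveM d2 d4.
  have d6 : is_derive t 1 (flat m) (t ^- m *: (expR (- t^-1) * t ^- 2) +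
      expR (- t^-1) *: (- (t ^+ m) ^- 2 * (m%:R * t ^+ m.-1))).
    apply: near_eq_is_derive d5.
    by near=> s; rewrite /flat ifT//; near: s; exact: lt_nbhsr.
  apply: is_derive_eq d6 _; rewrite /flat t0 /GRing.scale/=.
  clear d1 d2 d5; case: m => [|m].
    by rewrite !mul0r oppr0 !expr0; field.
  by rewrite !exprS/=; field; rewrite e0 expf_neq0.
- have fl0 k : flat k 0 = 0 by rewrite /flat ltxx.
  rewrite !fl0 mulr0 addr0.
  have H : (fun h : R => h^-1 *: ((flat m \o shift 0) (h *: 1) - flat m 0)) @ 0^' --> (0 : R).
    apply/cvgrPdist_lt => /= e e0; near=> h.
    have h0 : h != 0 by near: h; exact: nbhs_dnbhs_neq.
    rewrite fl0 subr0 sub0r normrN /GRing.scale/= mulr1 addr0.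
    have -> : h^-1 * flat m h = flat m.+1 h.
      by rewrite /flat; case: ifPn => hp; rewrite ?mulr0// exprS invfM mulrA.
    rewrite ger0_norm ?flat_ge0//; apply: le_lt_trans (flat_le _ _) _.
    have F0 : 0 < m.+2`!%:R :> R by rewrite ltr0n fact_gt0.
    rewrite -ltr_pdivlMl//; near: h; apply: dnbhs0_lt.
    by rewrite mulr_gt0// invr_gt0.
  by apply: DeriveDef; [apply: cvgP H|apply/cvg_lim].
Unshelve. all: by end_near. Qed.

Lemma smooth_flat n (phi : 'rV[R]_n -> R) : smooth phi -> smooth (flat 0 \o phi).
Proof.
move=> sphi.
apply: (smooth_comp sphi (H := [set h | exists m, h = flat m])); last by exists 0.
move=> _ [m ->]; exists (fun t => - m%:R * flat m.+1 t + flat m.+2 t).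
split; first exact: is_derive_flat.
apply: alg_add; last by apply: alg_base; exists m.+2.
by apply: alg_mul; [exact: alg_cst|apply: alg_base; exists m.+1].
Qed.

Lemma cvg_flat (t : R) : 0 < t -> flat 0 (k.+1%:R * t) @[k --> \oo] --> (1 : R).
Proof.
move=> t0.
have H : expR (- (t^-1 * harmonic k)) @[k --> \oo] --> (1 : R).
  rewrite -[X in _ --> X]expR0; apply: continuous_cvg; first exact: continuous_expR.
  rewrite -[X in _ --> X]oppr0 -(mulr0 t^-1); apply: cvgN; apply: cvgMr.
  exact: cvg_harmonic.
apply: cvg_trans H; apply: near_eq_cvg; near=> k.
by rewrite /flat mulr_gt0 ?ltr0n// expr0 invr1 mul1r invfM /harmonic mulrC.
Unshelve. all: by end_near. Qed.

(** Bump functions approximating the indicator of a box from below. *)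
Definition bump n (a b : 'rV[R]_n) (k : nat) (x : 'rV[R]_n) : R :=
  \prod_i (flat 0 (k.+1%:R * (x 0 i - a 0 i)) * flat 0 (k.+1%:R * (b 0 i - x 0 i))).

Lemma smooth_bump n (a b : 'rV[R]_n) k : smooth (bump a b k).
Proof.
apply: smooth_prod => i; apply: smoothM.
- apply: (smooth_flat (phi := fun x => k.+1%:R * (x 0 i - a 0 i))).
  by apply: smoothM; [exact: smooth_cst|apply: smoothD; [exact: smooth_coord|exact: smooth_cst]].
- apply: (smooth_flat (phi := fun x => k.+1%:R * (b 0 i - x 0 i))).
  apply: smoothM; first exact: smooth_cst.
  have -> : (fun x : 'rV[R]_n => b 0 i - x 0 i) = (fun x : 'rV[R]_n => b 0 i + (-1) * x 0 i).
    by apply/funext => x; rewrite mulN1r.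
  by apply: smoothD; [exact: smooth_cst|apply: smoothM; [exact: smooth_cst|exact: smooth_coord]].
Qed.

Lemma bump_ge0 n (a b : 'rV[R]_n) k x : 0 <= bump a b k x.
Proof. by apply: prodr_ge0 => i _; rewrite mulr_ge0// flat_ge0. Qed.

Lemma bump_le1 n (a b : 'rV[R]_n) k x : bump a b k x <= 1.
Proof.
apply: prodr_ile1 => i _; rewrite mulr_ge0 ?flat_ge0//=.
by rewrite mulr_ile1 ?flat_ge0 ?flat_le1.
Qed.

Lemma bump_eq0 n (a b : 'rV[R]_n) k x : ~ obox a b x -> bump a b k x = 0.
Proof.
move=> xab; have [i iab] : exists i, ~~ (a 0 i < x 0 i < b 0 i).
  by apply/not_existsP => H; apply: xab => i; have /negP := H i; rewrite negbK.
rewrite /bump (bigD1 i)//= /flat !pmulr_rgt0 ?ltr0n// !subr_gt0.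
by move: iab; rewrite negb_and => /orP[|] /negbTE ->; rewrite ?mul0r ?mulr0 ?mul0r.
Qed.

Lemma cvg_bump n (a b : 'rV[R]_n) x : obox a b x ->
  bump a b k x @[k --> \oo] --> (1 : R).
Proof.
move=> xab; rewrite /bump.
rewrite [X in _ --> X](_ : 1 = \prod_(i < n) (1 : R)); last by rewrite big1.
apply: cvg_big => [|i _]; first exact: mul_continuous.
have /andP[ax xb] := xab i.
by rewrite -[X in _ --> X]mulr1; apply: cvgM; apply: cvg_flat; rewrite subr_gt0.
Qed.

End special_functions.

(** * The fundamental lemma of the calculus of variations *)

Section fundamental_lemma.
Context {R : realType} {n : nat}.
Local Notation leb := (@lebesgue_rV R n).
Implicit Types (Omega : set 'rV[R]_n) (g phi : 'rV[R]_n -> R).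

(** Countably many rational boxes cover an open set. *)
Lemma ae_local Omega (P : 'rV[R]_n -> Prop) : open Omega ->
  (forall a b, cbox a b `<=` Omega -> {ae leb, forall x, obox a b x -> P x}) ->
  {ae leb, forall x, Omega x -> P x}.
Proof.
move=> oO H; have : forall k, {ae leb, forall x, rat_cbox k `<=` Omega -> rat_obox k x -> P x}.
  move=> k; have [kO|kO] := pselect (@rat_cbox R n k `<=` Omega); last by apply: aeW.
  by have := H _ _ kO; apply: filterS => x Px _; exact: Px.
move/ae_foralln; apply: filterS => x Px Ox.
by have [k [kx kO]] := open_rat_box oO Ox; exact: Px kO kx.
Qed.

Lemma test_function_bump Omega (a b : 'rV[R]_n) k : cbox a b `<=` Omega ->
  test_function Omega (bump a b k).
Proof.
move=> abO; split; first exact: smooth_bump.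
exists (cbox a b); split => //; first exact: compact_cbox.
by move=> x xab; apply: bump_eq0 => /obox_sub_cbox.
Qed.

Lemma measurable_smooth phi : smooth phi -> measurable_fun setT phi.
Proof. by move=> sphi; apply: continuous_measurable_rV; exact: (sphi [::]).1. Qed.

Lemma integral_obox_eq0 Omega g (a b : 'rV[R]_n) : open Omega ->
  leb.-integrable Omega (EFin \o g) ->
  (forall phi, test_function Omega phi -> \int[leb]_(x in Omega) (g x * phi x) = 0) ->
  cbox a b `<=` Omega -> (\int[leb]_(x in obox a b) (g x)%:E = 0)%E.
Proof.
move=> oO ig H abO; have mO := measurable_open_rV oO.
have mg : measurable_fun Omega g by have /integrableP[/measurable_EFinP] := ig.
have oabO : obox a b `<=` Omega by apply: subset_trans abO; exact: obox_sub_cbox.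
have mB k : measurable_fun Omega (bump a b k).
  by apply: measurable_funTS; apply: measurable_smooth; exact: smooth_bump.
have Bn k x : `|bump a b k x| <= 1 by rewrite ger0_norm ?bump_ge0 ?bump_le1.
have int0 k : (\int[leb]_(x in Omega) (g x * bump a b k x)%:E = 0)%E.
  rewrite -[LHS]fineK.
    by congr EFin; apply: H; exact: test_function_bump.
  apply: integrable_fin_num => //; apply: le_integrable ig => //.
    by apply/measurable_EFinP; exact: measurable_funM.
  by move=> x _; rewrite lee_fin normrM ler_piMr.
have [|||||_ _ lim0] := @dominated_convergence _ _ _ leb Omega mO
   (fun k x => (g x * bump a b k x)%:E) ((EFin \o g) \_ (obox a b)) (abse \o (EFin \o g)).
- by move=> k; apply/measurable_EFinP; exact: measurable_funM.
- apply/measurable_restrict => //; first exact: measurable_obox.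
  by apply/measurable_EFinP; apply: measurable_funS mg => //; apply: subIsetl.
- apply: aeW => x Ox; rewrite patchE; case: ifPn => xab.
    rewrite /=; apply: cvg_EFin; first exact: nearW.
    rewrite -[X in _ --> X]mulr1; apply: cvgMr; apply: cvg_bump.
    by rewrite inE in xab.
  have b0 k : bump a b k x = 0 by apply: bump_eq0 => xab'; rewrite mem_set in xab.
  rewrite [X in X @ _ --> _](_ : _ = cst 0%E); first exact: cvg_cst.
  by apply/funext => k; rewrite b0 mulr0.
- exact: integrable_abse.
- by apply: aeW => x k _; rewrite lee_fin normrM ler_piMr.
rewrite -integral_mkcondr (setIidr oabO) in lim0.
have : (0 : \bar R)%E @[k --> \oo] --> (\int[leb]_(x in obox a b) (EFin \o g) x)%E.
  by apply: cvg_trans lim0; apply: near_eq_cvg; apply: nearW => k; rewrite /= int0.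
by move/cvg_lim => <-//; rewrite lim_cst.
Qed.

(** The bump functions give zero integral over small boxes, hence, the boxes being stable under
intersection and generating the Borel sets, over all Borel subsets of a box. *)
Lemma fundamental_lemma Omega g : open Omega ->
  leb.-integrable Omega (EFin \o g) ->
  (forall phi, test_function Omega phi -> \int[leb]_(x in Omega) (g x * phi x) = 0) ->
  {ae leb, forall x, Omega x -> g x = 0}.
Proof.
move=> oO ig H; apply: ae_local => // a b abO.
have mQ := measurable_obox a b; set Q := obox a b in mQ *.
have QO : Q `<=` Omega by apply: subset_trans abO; exact: obox_sub_cbox.
have igQ : leb.-integrable Q (EFin \o g).
  by apply: integrableS ig => //; exact: measurable_open_rV.
have igA A : measurable A -> leb.-integrable (A `&` Q) (EFin \o g).
  by move=> mA; apply: integrableS igQ => //; exact: measurableI.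
have Q0 : (\int[leb]_(x in Q) (g x)%:E = 0)%E by exact: integral_obox_eq0 abO.
have int0 A : measurable A -> (\int[leb]_(x in A `&` Q) (g x)%:E = 0)%E.
  move=> mA; have : <<s [set A | exists a b : 'rV[R]_n, A = obox a b] >> A.
    by rewrite -measurable_generated_obox.
  move: A {mA}; apply: dynkin_induction.
  - exact: measurable_generated_obox.
  - by move=> _ _ [c [d ->]] [c' [d' ->]]; rewrite oboxI; do 2 eexists.
  - by rewrite setTI.
  - move=> _ [c [d ->]]; rewrite oboxI; apply: integral_obox_eq0 ig H _ => //.
    apply: subset_trans abO => x xcd i; have := xcd i; rewrite !mxE ge_max le_min.
    by move=> /andP[/andP[_ ->] /andP[_ ->]].
  - move=> A mA A0; have mAQ : measurable (A `&` Q) by exact: measurableI.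
    have mCQ : measurable (~` A `&` Q) by apply: measurableI => //; exact: measurableC.
    have E : Q = (A `&` Q) `|` (~` A `&` Q) by rewrite -setIUl setUv setTI.
    have := Q0; rewrite {1}E integral_setU//; last first.
    + apply/disj_setPS => x [[Ax _] [nAx _]]; exact: nAx.
    + by rewrite -E; have /integrableP[] := igQ.
    by rewrite A0 add0e.
  - move=> F mF tF F0; rewrite setI_bigcupl integral_bigcup//.
    + by rewrite eseries0.
    + by apply: trivIset_setIr.
    + by move=> k; exact: measurableI.
    + by rewrite -setI_bigcupl; apply: igA; exact: bigcupT_measurable.
have /integral_ae_eq : leb.-integrable Q (EFin \o g) by [].
move=> /(_ mQ (cst 0%E) (measurable_cst _)) h.
have {h} : ae_eq leb Q (EFin \o g) (cst 0%E).
  apply: h => E EQ mE; rewrite integral0 -[E](setIidl EQ); exact: int0.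
by apply: filterS => x gx Qx; have [] := gx Qx.
Qed.

End fundamental_lemma.

(** * The Euclidean norm and L^p estimates *)

Section euclidean_norm.
Context {R : realType} {n : nat}.
Implicit Types x y z : 'rV[R]_n.

Lemma dotrC x y : dotr x y = dotr y x.
Proof. by apply: eq_bigr => i _; rewrite mulrC. Qed.

Lemma dotrDl x y z : dotr (x + y) z = dotr x z + dotr y z.
Proof. by rewrite -big_split; apply: eq_bigr => i _; rewrite mxE mulrDl. Qed.

Lemma dotrZl (t : R) x z : dotr (t *: x) z = t * dotr x z.
Proof. by rewrite /dotr big_distrr; apply: eq_bigr => i _; rewrite mxE /= mulrA. Qed.

Lemma dotrDr x y z : dotr z (x + y) = dotr z x + dotr z y.
Proof. by rewrite dotrC dotrDl !(dotrC z). Qed.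

Lemma dotrZr (t : R) x z : dotr z (t *: x) = t * dotr z x.
Proof. by rewrite dotrC dotrZl (dotrC z). Qed.

Lemma dotrr_ge0 x : 0 <= dotr x x.
Proof. by apply: sumr_ge0 => i _; rewrite -expr2 sqr_ge0. Qed.

Lemma enorm_ge0 x : 0 <= enorm x.
Proof. exact: sqrtr_ge0. Qed.

Lemma enorm_sqr x : enorm x ^+ 2 = dotr x x.
Proof. by rewrite sqr_sqrtr// dotrr_ge0. Qed.

Lemma enormZ (t : R) x : enorm (t *: x) = `|t| * enorm x.
Proof.
rewrite /enorm dotrZl dotrZr mulrA -expr2 sqrtrM ?sqr_ge0//.
by rewrite sqrtr_sqr.
Qed.

Lemma enorm0 : enorm (0 : 'rV[R]_n) = 0.
Proof. by rewrite -(scale0r 0) enormZ normr0 mul0r. Qed.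

Lemma enormN x : enorm (- x) = enorm x.
Proof. by rewrite -scaleN1r enormZ normrN1 mul1r. Qed.

Lemma coord_le_enorm x i : `|x 0 i| <= enorm x.
Proof.
rewrite -[leLHS]sqrtr_sqr ler_wsqrtr// /dotr (bigD1 i)//= expr2 lerDl.
by apply: sumr_ge0 => j _; rewrite -expr2 sqr_ge0.
Qed.

Lemma enorm_eq0 x : enorm x = 0 -> x = 0.
Proof.
move=> x0; apply/rowP => i; rewrite mxE; apply/eqP.
by rewrite -normr_le0 -x0 coord_le_enorm.
Qed.

Lemma cauchy_schwarz x y : `|dotr x y| <= enorm x * enorm y.
Proof.
have H z : dotr z y <= enorm z * enorm y.
  have [z0|z0] := eqVneq (enorm z) 0.
    rewrite z0 mul0r (enorm_eq0 z0) /dotr big1// => i _.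
    by rewrite mxE mul0r.
  have [y0|y0] := eqVneq (enorm y) 0.
    rewrite y0 mulr0 (enorm_eq0 y0) /dotr big1// => i _.
    by rewrite mxE mulr0.
  have ab : 0 < enorm z * enorm y by rewrite mulr_gt0// lt0r ?z0 ?y0 enorm_ge0.
  have := dotrr_ge0 (enorm y *: z + (- enorm z) *: y).
  rewrite dotrDl !dotrDr !dotrZl !dotrZr (dotrC y z) -!enorm_sqr => h.
  rewrite -(ler_pM2l ab); nra.
rewrite ler_norml; apply/andP; split; last exact: H.
by rewrite lerNl -mulN1r -dotrZl scaleN1r -(enormN x) H.
Qed.

Lemma enormD x y : enorm (x + y) <= enorm x + enorm y.
Proof.
rewrite -(ler_pXn2r (n := 2))// ?nnegrE ?addr_ge0 ?enorm_ge0//.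
rewrite enorm_sqr dotrDl !dotrDr (dotrC y x) -!enorm_sqr.
have := le_trans (ler_norm _) (cauchy_schwarz x y); nra.
Qed.

Lemma enorm_le_sum x : enorm x <= \sum_i `|x 0 i|.
Proof.
rewrite -(ler_pXn2r (n := 2))// ?nnegrE ?enorm_ge0//; last exact: sumr_ge0.
rewrite enorm_sqr /dotr expr2 mulr_suml; apply: ler_sum => i _.
rewrite -expr2 -real_normK ?num_real// expr2 ler_wpM2l// (bigD1 i)//= lerDl.
exact: sumr_ge0.
Qed.

Lemma measurable_enorm d (T : measurableType d) (D : set T) (g : T -> 'rV[R]_n) :
  (forall i, measurable_fun D (fun t => g t 0 i)) ->
  measurable_fun D (fun t => enorm (g t)).
Proof.
move=> mg; apply: (@measurableT_comp _ _ _ _ _ _ (@Num.sqrt R)).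
  by apply: continuous_measurable_fun; exact: sqrt_continuous.
by apply: measurable_sum => i; apply: measurable_funM.
Qed.

End euclidean_norm.

Lemma measurable_fun_powR {R : realType} d (T : measurableType d) (D : set T)
    (f : T -> R) (r : R) :
  measurable_fun D f -> measurable_fun D (fun x => f x `^ r).
Proof. exact: (@measurableT_comp _ _ _ _ _ _ (@powR R ^~ r)). Qed.

Section Lp_estimates.
Context {R : realType} {n : nat}.
Local Notation leb := (@lebesgue_rV R n).
Variables (Omega : set 'rV[R]_n) (p : R).
Hypotheses (mO : measurable Omega) (p1 : 1 < p).
Implicit Types f g v w : 'rV[R]_n -> R.
Local Open Scope ereal_scope.

Let p0 : (0 < p)%R. Proof. exact: lt_trans p1. Qed.
Let pn0 : p != 0%R. Proof. by rewrite gt_eqF. Qed.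

Lemma Lnorm_restrict (r : R) v : r != 0%R ->
  'N[leb]_r%:E[(EFin \o v) \_ Omega] =
  (\int[leb]_(x in Omega) (`|v x| `^ r)%:E) `^ r^-1.
Proof.
move=> r0; rewrite unlock /Lnorm; congr (_ `^ _).
rewrite [RHS]integral_mkcond; apply: eq_integral => x _.
rewrite !patchE; case: ifPn => xO //=.
by rewrite normr0 powR0.
Qed.

Lemma normLpE v : normLp Omega p v =
  (\int[leb]_(x in Omega) (`|v x| `^ p)%:E) `^ p^-1.
Proof. exact: Lnorm_restrict. Qed.

Lemma normLp_ge0 v : 0 <= normLp Omega p v.
Proof. exact: Lnorm_ge0. Qed.

Lemma normLp_poweR v : normLp Omega p v `^ p = \int[leb]_(x in Omega) (`|v x| `^ p)%:E.
Proof.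
rewrite normLpE -poweRrM mulVf// poweRe1//.
by apply: integral_ge0 => x _; rewrite lee_fin powR_ge0.
Qed.

Lemma restrict_EFin_comp f : (EFin \o f) \_ Omega = EFin \o (f \_ Omega).
Proof. by rewrite restrict_EFin. Qed.

Lemma hoelder_on f g (r s : R) : measurable_fun Omega f -> measurable_fun Omega g ->
  (0 < r)%R -> (0 < s)%R -> (r^-1 + s^-1 = 1)%R ->
  \int[leb]_(x in Omega) `|f x * g x|%:E <=
  (\int[leb]_(x in Omega) (`|f x| `^ r)%:E) `^ r^-1 *
  (\int[leb]_(x in Omega) (`|g x| `^ s)%:E) `^ s^-1.
Proof.
move=> mf mg r0 s0 rs.
have mf' := (measurable_restrictT f mO).1 mf.
have mg' := (measurable_restrictT g mO).1 mg.
have := @hoelder _ _ _ leb _ _ _ _ mf' mg' r0 s0 rs.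
rewrite Lnorm1 -!Lnorm_restrict ?gt_eqF// !restrict_EFin_comp.
apply: le_trans; rewrite [leLHS]integral_mkcond le_eqVlt; apply/orP; left; apply/eqP.
apply: eq_integral => x _; rewrite !patchE/= !patchE.
by case: ifPn => //= _; rewrite mulr0 normr0.
Qed.

Lemma measurable_normr_powR v (r : R) : measurable_fun Omega v ->
  measurable_fun Omega (fun x => (`|v x| `^ r)%:E).
Proof.
move=> mv; apply/measurable_EFinP; apply: measurable_fun_powR.
exact: measurableT_comp.
Qed.

Lemma normLp_eq v w : {ae leb, forall x, Omega x -> v x = w x} ->
  measurable_fun Omega v -> measurable_fun Omega w ->
  normLp Omega p v = normLp Omega p w.
Proof.
move=> vw mv mw; rewrite !normLpE; congr (_ `^ _).
apply: ge0_ae_eq_integral; first exact: mO.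
- exact: measurable_normr_powR.
- exact: measurable_normr_powR.
- by move=> x _; rewrite lee_fin powR_ge0.
- by move=> x _; rewrite lee_fin powR_ge0.
- by apply: filterS vw => x vw Ox; rewrite vw.
Qed.

Lemma normLp_triangle v w : measurable_fun Omega v -> measurable_fun Omega w ->
  normLp Omega p (fun x => v x + w x)%R <= normLp Omega p v + normLp Omega p w.
Proof.
move=> mv mw.
have mv' := (measurable_restrictT v mO).1 mv.
have mw' := (measurable_restrictT w mO).1 mw.
have := @minkowski_EFin _ _ _ leb _ _ p mv' mw' (ltW p1).
rewrite /normLp !restrict_EFin_comp; apply: le_trans.
rewrite le_eqVlt; apply/orP; left; apply/eqP; congr Lnorm; apply/funext => x /=.
by rewrite !patchE; case: ifPn => //=; rewrite addr0.
Qed.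

Lemma normLp_le v w : measurable_fun Omega v -> measurable_fun Omega w ->
  (forall x, Omega x -> `|v x| <= `|w x|)%R -> normLp Omega p v <= normLp Omega p w.
Proof.
move=> mv mw vw; rewrite !normLpE; apply: gt0_ler_poweR.
- by rewrite invr_ge0 ltW.
- by rewrite in_itv/= leey integral_ge0// => x _; rewrite lee_fin powR_ge0.
- by rewrite in_itv/= leey integral_ge0// => x _; rewrite lee_fin powR_ge0.
apply: ge0_le_integral; first exact: mO.
- by move=> x _; rewrite lee_fin powR_ge0.
- exact: measurable_normr_powR.
- exact: measurable_normr_powR.
- by move=> x Ox; rewrite lee_fin ge0_ler_powR// ?nnegrE// ?vw// ltW.
Qed.

Lemma normLpZ (t : R) v : measurable_fun Omega v ->
  normLp Omega p (fun x => t * v x)%R = `|t|%:E * normLp Omega p v.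
Proof.
move=> mv; rewrite !normLpE.
transitivity ((((`|t| `^ p)%:E * \int[leb]_(x in Omega) (`|v x| `^ p)%:E)) `^ p^-1).
  rewrite -ge0_integralZl//; last exact: measurable_normr_powR.
  congr (_ `^ _); apply: eq_integral => x _.
  by rewrite normrM powRM// EFinM.
rewrite poweRM ?lee_fin ?powR_ge0//; last first.
  by apply: integral_ge0 => x _; rewrite lee_fin powR_ge0.
by rewrite -poweR_EFin -poweRrM mulfV// poweRe1// lee_fin.
Qed.

Hypothesis fO : leb Omega < +oo.

(** Hoelder's inequality against the constant 1. *)
Lemma integral_le_normLp v : measurable_fun Omega v ->
  \int[leb]_(x in Omega) `|v x|%:E <=
  normLp Omega p v * (fine (leb Omega) `^ (1 - p^-1))%:E.
Proof.
move=> mv; pose q := (1 - p^-1)^-1%R.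
have q0 : (0 < q)%R by rewrite invr_gt0 subr_gt0 invf_lt1.
have pq : (p^-1 + q^-1 = 1)%R by rewrite /q invrK addrC subrK.
have := hoelder_on mv (measurable_cst (1 : R)%R) p0 q0 pq.
rewrite -normLpE /q invrK -/q => H; apply: le_trans (le_trans H _).
  by under eq_integral do rewrite -[v _]mulr1.
rewrite le_eqVlt; apply/orP; left; apply/eqP; congr (_ * _).
transitivity ((leb Omega) `^ (1 - p^-1)).
  congr (_ `^ _); rewrite -[RHS]mul1e -integral_cst//.
  by apply: eq_integral => x _; rewrite normr1 powR1.
have ff : leb Omega \is a fin_num by rewrite ge0_fin_numE// measure_ge0.
by rewrite -{1}(fineK ff) poweR_EFin.
Qed.

Lemma Lp_integrable v : Lp Omega p v -> leb.-integrable Omega (EFin \o v).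
Proof.
move=> [mv voo]; apply/integrableP; split; first exact/measurable_EFinP.
apply: le_lt_trans (integral_le_normLp mv) _.
by apply: lte_mul_pinfty; rewrite ?ltry// ?ge0_fin_numE//; exact: normLp_ge0.
Qed.

End Lp_estimates.

(** * Weak gradients and test functions *)

Section weak_gradients.
Context {R : realType} {n : nat}.
Local Notation leb := (@lebesgue_rV R n).
Variables (Omega : set 'rV[R]_n) (p : R).
Hypotheses (oO : open Omega) (fO : (leb Omega < +oo)%E) (p1 : 1 < p).
Implicit Types (v w phi psi : 'rV[R]_n -> R) (g : 'rV[R]_n -> 'rV[R]_n).

Let mO : measurable Omega. Proof. exact: measurable_open_rV. Qed.
Let p0 : 0 < p. Proof. exact: lt_trans p1. Qed.

Lemma test_function_bounded phi : test_function Omega phi ->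
  exists2 M : R, 0 <= M & forall x, `|phi x| <= M.
Proof.
move=> [sphi [K [cK KO phi0]]].
have cphi : continuous phi by exact: (sphi [::]).1.
have /compact_bounded[M [Mr HM]] := continuous_compact (continuous_subspaceT cphi) cK.
exists (`|M| + 1); first by rewrite addr_ge0.
move=> x; have [Kx|Kx] := pselect (K x); last by rewrite phi0// normr0 addr_ge0.
by apply: HM; [rewrite (le_lt_trans (ler_norm _))// ltrDl|exists x].
Qed.

Lemma measurable_test phi D : test_function Omega phi -> measurable_fun D phi.
Proof. by move=> [sphi _]; apply: measurable_funTS; exact: measurable_smooth. Qed.

Lemma test_function_partial phi i : test_function Omega phi ->
  test_function Omega (partial i phi).
Proof.
move=> [sphi [K [cK KO phi0]]]; split; first by have [_ []] := smooth_derive i sphi.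
exists K; split => //; apply: partial_eq0_outside => //.
by apply: compact_closed => //; exact: norm_hausdorff.
Qed.

Lemma integrableM_test (f phi : 'rV[R]_n -> R) : leb.-integrable Omega (EFin \o f) ->
  test_function Omega phi -> leb.-integrable Omega (fun x => (f x * phi x)%:E).
Proof.
move=> intf tphi; have [M M0 phiM] := test_function_bounded tphi.
apply: (@integrableMl _ _ _ leb _ mO (EFin \o f) phi) => //; first exact: measurable_test.
exists M; split; first exact: num_real.
by move=> r Mr x _ /=; rewrite (le_trans (phiM x))// ltW.
Qed.

Lemma Lp_test phi : test_function Omega phi -> Lp Omega p phi.
Proof.
move=> tphi; split; first exact: measurable_test.
have [M M0 phiM] := test_function_bounded tphi.
rewrite normLpE//; apply: poweR_lty.
apply: (@le_lt_trans _ _ (\int[leb]_(x in Omega) (M `^ p)%:E)%E).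
  apply: ge0_le_integral => //.
  - by apply: measurable_normr_powR => //; exact: measurable_test.
  - by move=> x _; rewrite lee_fin ge0_ler_powR// ?nnegrE// ltW.
rewrite integral_cst//; apply: lte_mul_pinfty => //.
by rewrite lee_fin powR_ge0.
Qed.

Lemma integrable_test phi : test_function Omega phi ->
  leb.-integrable Omega (EFin \o phi).
Proof. by move=> tphi; apply: (Lp_integrable mO p1 fO); exact: Lp_test. Qed.

Lemma integral_partial_test phi i : test_function Omega phi ->
  (\int[leb]_(x in Omega) (partial i phi x)%:E = 0)%E.
Proof.
move=> [sphi [K [cK KO phi0]]].
have [M [M0 KM]] := bounded_sub_cbox (compact_bounded cK).
rewrite -(@integral_partial_eq0 _ _ phi M i (smooth_C1 sphi)); last first.
  by move=> x xM; apply: phi0 => /KM.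
rewrite integral_mkcond; apply: eq_integral => x _; rewrite patchE.
case: ifPn => // /negP xO; rewrite (partial_eq0_outside (K := K))//.
  by apply: compact_closed => //; exact: norm_hausdorff.
by move=> /KO Ox; apply: xO; rewrite inE.
Qed.

Lemma test_functionM phi psi : smooth phi -> test_function Omega psi ->
  test_function Omega (fun x => phi x * psi x).
Proof.
move=> sphi [spsi [K [cK KO psi0]]]; split; first exact: smoothM.
by exists K; split => // x /psi0 ->; rewrite mulr0.
Qed.

Lemma weak_gradient_test phi : test_function Omega phi ->
  weak_gradient Omega p phi (grad phi).
Proof.
move=> tphi; split.
  move=> i; have -> : (fun x => grad phi x 0 i) = partial i phi.
    by apply/funext => x; rewrite mxE.
  by apply: Lp_test; exact: test_function_partial.
move=> psi tpsi i; apply/eqP; rewrite -addr_eq0 -RintegralD//; last 2 first.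
- by apply: integrableM_test; [exact: integrable_test|exact: test_function_partial].
- have -> : (fun x => grad phi x 0 i * psi x) = (fun x => partial i phi x * psi x).
    by apply/funext => x; rewrite mxE.
  by apply: integrableM_test => //; apply: integrable_test; exact: test_function_partial.
have [sphi _] := tphi; have [spsi _] := tpsi.
apply/eqP; rewrite /Rintegral.
rewrite [X in fine X](_ : _ = \int[leb]_(x in Omega) (partial i (fun x => (phi x * psi x)%R) x)%:E)%E.
  by rewrite integral_partial_test//; exact: test_functionM.
apply: eq_integral => x _; congr EFin; rewrite mxE.
have [_ [dphi _]] := smooth_derive i sphi; have [_ [dpsi _]] := smooth_derive i spsi.
have [_ E] := is_deriveM (dphi x) (dpsi x).
by rewrite [RHS]E /GRing.scale/= [X in _ = _ + X]mulrC.
Qed.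

Lemma weak_gradient_unique v g g' : weak_gradient Omega p v g -> weak_gradient Omega p v g' ->
  {ae leb, forall x, Omega x -> g x = g' x}.
Proof.
move=> [Lg Hg] [Lg' Hg'].
have : forall i : 'I_n, {ae leb, forall x, Omega x -> g x 0 i - g' x 0 i = 0}.
  move=> i; have ig := Lp_integrable mO p1 fO (Lg i).
  have ig' := Lp_integrable mO p1 fO (Lg' i).
  apply: (fundamental_lemma oO); first exact: (integrableB mO ig ig').
  move=> phi tphi; under eq_Rintegral do rewrite mulrBl.
  rewrite RintegralB//; [|exact: integrableM_test|exact: integrableM_test].
  by apply/eqP; rewrite subr_eq0 -eqr_opp -Hg// -Hg'.
move=> H; have : forall k : nat, {ae leb, forall x, forall i : 'I_n, i = k :> nat ->
    Omega x -> g x 0 i - g' x 0 i = 0}.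
  move=> k; have [kn|kn] := ltnP k n; last first.
    by apply: aeW => x i ik; move: (ltn_ord i); rewrite ik ltnNge kn.
  have := H (Ordinal kn); apply: filterS => x gx i ik.
  by have -> : i = Ordinal kn by apply/val_inj.
move/ae_foralln; apply: filterS => x gx Ox.
apply/rowP => i; apply/eqP; rewrite -subr_eq0; apply/eqP; exact: gx.
Qed.

Lemma weak_gradient_wgrad v : W1p Omega p v -> weak_gradient Omega p v (wgrad Omega p v).
Proof. by move=> [_ [g Hg]]; apply: (@xgetPex _ (cst 0) [set g | weak_gradient Omega p v g]); exists g. Qed.

Lemma wgrad_ae v g : weak_gradient Omega p v g -> Lp Omega p v ->
  {ae leb, forall x, Omega x -> wgrad Omega p v x = g x}.
Proof.
move=> vg Lv; apply: (weak_gradient_unique _ vg); apply: weak_gradient_wgrad.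
by split => //; exists g.
Qed.

Lemma measurable_wgrad v i : W1p Omega p v ->
  measurable_fun Omega (fun x => wgrad Omega p v x 0 i).
Proof. by move=> /weak_gradient_wgrad[/(_ i)[]]. Qed.

Lemma measurable_enorm_wgrad v : W1p Omega p v ->
  measurable_fun Omega (enorm \o wgrad Omega p v).
Proof. by move=> vW; apply: measurable_enorm => i; exact: measurable_wgrad. Qed.

Lemma normLp_enorm_lty g : (forall i, Lp Omega p (fun x => g x 0 i)) ->
  (normLp Omega p (enorm \o g) < +oo)%E.
Proof.
move=> Lg; have mg i : measurable_fun Omega (fun x => g x 0 i) by have [] := Lg i.
apply: (@le_lt_trans _ _ (\sum_(i < n) normLp Omega p (fun x => g x 0%R i))%E).
  apply: (@le_trans _ _ (normLp Omega p (fun x => \sum_(i < n) `|g x 0 i|))).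
    apply: normLp_le => //.
    - exact: measurable_enorm.
    - by apply: measurable_sum => i; exact: measurableT_comp.
    - by move=> x _ /=; rewrite !ger0_norm ?enorm_ge0 ?sumr_ge0// enorm_le_sum.
  have : forall s : seq 'I_n, (normLp Omega p (fun x => (\sum_(i <- s) `|g x 0 i|)%R) <=
      \sum_(i <- s) normLp Omega p (fun x => g x 0%R i))%E.
    elim => [|i s IH].
      rewrite big_nil; under [X in normLp _ _ X]eq_fun do rewrite big_nil.
      rewrite normLpE// integral0_eq ?poweR0r ?invr_neq0 ?gt_eqF//.
      by move=> x _; rewrite normr0 powR0// gt_eqF.
    rewrite big_cons; under [X in normLp _ _ X]eq_fun do rewrite big_cons.
    apply: le_trans (normLp_triangle mO p1 _ _) _.
    - exact: measurableT_comp.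
    - by apply: measurable_sum => j; exact: measurableT_comp.
    apply: leeD => //; apply: normLp_le => //; first exact: measurableT_comp.
    by move=> x _; rewrite normr_id.
  exact.
by apply: lte_sum_pinfty => i _; have [] := Lg i.
Qed.

End weak_gradients.

(** * The Sobolev space with zero boundary values *)

(** Locked, since unification would otherwise compare energies by unfolding the
choice of weak gradients. *)
HB.lock Definition energy {R : realType} {n : nat} (Omega : set 'rV[R]_n) (p : R)
    (v : 'rV[R]_n -> R) : R :=
  fine (\int[lebesgue_rV n]_(x in Omega) (enorm (wgrad Omega p v x) `^ p)%:E)%E.
Canonical energy_unlockable := Unlockable energy.unlock.

Section sobolev_zero.
Context {R : realType} {n : nat}.
Local Notation leb := (@lebesgue_rV R n).
Variables (Omega : set 'rV[R]_n) (p : R).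
Hypotheses (oO : open Omega) (fO : (leb Omega < +oo)%E) (p1 : 1 < p).
Implicit Types (v w phi psi : 'rV[R]_n -> R) (g : 'rV[R]_n -> 'rV[R]_n).

Let mO : measurable Omega. Proof. exact: measurable_open_rV. Qed.
Let p0 : 0 < p. Proof. exact: lt_trans p1. Qed.
Let pn0 : p != 0. Proof. by rewrite gt_eqF. Qed.

Local Notation wgrad := (wgrad Omega p).
Local Notation W01p := (W01p Omega p).
Local Notation energy := (energy Omega p).

Lemma normLp0 v : {ae leb, forall x, Omega x -> v x = 0} -> measurable_fun Omega v ->
  normLp Omega p v = 0%E.
Proof.
move=> v0 mv; rewrite (@normLp_eq _ _ _ _ mO p1 v (cst 0))//.
rewrite normLpE//; under eq_integral do rewrite normr0 powR0//.
by rewrite integral0 poweR0r// invr_neq0.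
Qed.

Lemma measurable_grad phi i : test_function Omega phi ->
  measurable_fun Omega (fun x => grad phi x 0 i).
Proof. by move=> /(weak_gradient_test oO fO p1)[/(_ i)[]]. Qed.

Lemma wgrad_test phi : test_function Omega phi ->
  {ae leb, forall x, Omega x -> wgrad phi x = grad phi x}.
Proof.
move=> tphi; apply: (wgrad_ae oO fO p1); first exact: weak_gradient_test.
exact: Lp_test.
Qed.

Lemma W1p_test phi : test_function Omega phi -> W1p Omega p phi.
Proof.
by move=> tphi; split; [exact: Lp_test|exists (grad phi); exact: weak_gradient_test].
Qed.

Lemma measurable_enorm_diff phi v : test_function Omega phi -> W1p Omega p v ->
  measurable_fun Omega (fun x => enorm (grad phi x - wgrad v x)).
Proof.
move=> tphi vW; apply: measurable_enorm => i.
rewrite (_ : (fun x => _) = fun x => grad phi x 0 i - wgrad v x 0 i).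
  by apply: measurable_funB; [exact: measurable_grad|exact: measurable_wgrad].
by apply/funext => x; rewrite !mxE.
Qed.

Lemma W01p_test phi : test_function Omega phi -> W01p phi.
Proof.
move=> tphi; have phiW := W1p_test tphi; split => //; exists (fun=> phi); split => //.
- rewrite (_ : (fun=> _) = cst 0%E); first exact: cvg_cst.
  apply/funext => k; apply: normLp0; first by apply: aeW => x _ /=; rewrite subrr.
  by apply: measurable_funB; exact: measurable_test tphi.
- rewrite (_ : (fun=> _) = cst 0%E); first exact: cvg_cst.
  apply/funext => k; apply: normLp0; last exact: measurable_enorm_diff.
  by have := wgrad_test tphi; apply: filterS => x H /H ->; rewrite subrr enorm0.
Qed.

Lemma gradZ (t : R) phi : smooth phi -> grad (fun x => t * phi x) = fun x => t *: grad phi x.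
Proof.
move=> sphi; apply/funext => x; apply/rowP => i; rewrite !mxE.
have [_ [dphi _]] := smooth_derive i sphi.
by have [_ E] := is_deriveZ t (dphi x); rewrite [LHS]E.
Qed.

Lemma weak_gradientZ (t : R) v g : Lp Omega p v -> weak_gradient Omega p v g ->
  weak_gradient Omega p (fun x => t * v x) (fun x => t *: g x).
Proof.
move=> Lv [Lg H]; split.
  move=> i; have [mg goo] := Lg i.
  rewrite (_ : (fun x => _) = fun x => t * g x 0 i); last by apply/funext => x; rewrite mxE.
  split; first by apply: measurable_funM.
  by rewrite normLpZ//; apply: lte_mul_pinfty.
move=> phi tphi i; have ig := Lp_integrable mO p1 fO (Lg i).
have iv := Lp_integrable mO p1 fO Lv.
under eq_Rintegral do rewrite -mulrA.
under [in RHS]eq_Rintegral do rewrite mxE -mulrA.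
rewrite !RintegralZl//; first by rewrite H// mulrN.
- exact: integrableM_test.
- by apply: integrableM_test => //; exact: test_function_partial.
Qed.

Lemma LpZ (t : R) v : Lp Omega p v -> Lp Omega p (fun x => t * v x).
Proof.
move=> [mv voo]; split; first exact: measurable_funM.
by rewrite normLpZ//; apply: lte_mul_pinfty.
Qed.

Lemma wgradZ (t : R) v : W1p Omega p v ->
  {ae leb, forall x, Omega x -> wgrad (fun x => t * v x) x = t *: wgrad v x}.
Proof.
move=> vW; have [Lv _] := vW; apply: (wgrad_ae oO fO p1); last exact: LpZ.
by apply: weak_gradientZ => //; exact: weak_gradient_wgrad.
Qed.

Lemma W1pZ (t : R) v : W1p Omega p v -> W1p Omega p (fun x => t * v x).
Proof.
move=> vW; have [Lv _] := vW; split; first exact: LpZ.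
exists (fun x => t *: wgrad v x); apply: weak_gradientZ => //.
exact: weak_gradient_wgrad.
Qed.

Lemma W01pZ (t : R) v : W01p v -> W01p (fun x => t * v x).
Proof.
move=> [vW [phi [tphi cphi cgrad]]]; have tvW := W1pZ t vW.
have [[mv _] _] := vW.
split => //; exists (fun k x => t * phi k x); split.
- by move=> k; apply: test_functionM => //; exact: smooth_cst.
- rewrite (_ : (fun k => _) = fun k => `|t|%:E * normLp Omega p (phi k \- v)%R)%E; last first.
    apply/funext => k; rewrite -normLpZ//; last first.
      by apply: measurable_funB => //; exact: measurable_test (tphi k).
    by congr normLp; apply/funext => x /=; rewrite mulrBr.
  by rewrite -[X in _ --> X](mule0 `|t|%:E); apply: cvgeZl.
- rewrite (_ : (fun k => _) = fun k => `|t|%:E *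
      normLp Omega p (fun x => enorm (grad (phi k) x - wgrad v x)%R))%E.
    by rewrite -[X in _ --> X](mule0 `|t|%:E); apply: cvgeZl.
  apply/funext => k; rewrite -normLpZ//; last exact: measurable_enorm_diff.
  transitivity (normLp Omega p (fun x => `|t| * enorm (grad (phi k) x - wgrad v x))).
    apply: normLp_eq => //.
    + have := wgradZ t vW; apply: filterS => x H /H ->.
      rewrite gradZ; last by have [] := tphi k.
      by rewrite -scalerBr enormZ.
    + apply: measurable_enorm_diff => //.
      by apply: test_functionM => //; exact: smooth_cst.
    + by apply: measurable_funM => //; exact: measurable_enorm_diff.
  by rewrite !normLpZ ?normr_id//; exact: measurable_enorm_diff.
Qed.

Lemma energy_fin v : W1p Omega p v ->
  (\int[leb]_(x in Omega) (enorm (wgrad v x) `^ p)%:E = (energy v)%:E)%E.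
Proof.
move=> vW; rewrite unlock fineK//.
have H := normLp_poweR Omega p1 (enorm \o wgrad v).
have -> : (\int[leb]_(x in Omega) (enorm (wgrad v x) `^ p)%:E =
  normLp Omega p (enorm \o wgrad v) `^ p)%E.
  by rewrite H; apply: eq_integral => x _; rewrite /= ger0_norm ?enorm_ge0.
apply: fin_num_poweR; rewrite ge0_fin_numE ?normLp_ge0//.
by apply: normLp_enorm_lty => //; have [] := weak_gradient_wgrad vW.
Qed.

Lemma energy_ge0 v : 0 <= energy v.
Proof. by rewrite unlock fine_ge0// integral_ge0// => x _; rewrite lee_fin powR_ge0. Qed.

Lemma normLp_energy v : W1p Omega p v ->
  normLp Omega p (enorm \o wgrad v) = (energy v `^ p^-1)%:E.
Proof.
move=> vW; rewrite normLpE// -poweR_EFin; congr (_ `^ _)%E; rewrite -(energy_fin vW).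
by apply: eq_integral => x _; rewrite /= ger0_norm ?enorm_ge0.
Qed.

Lemma energy_le v w : W1p Omega p v -> W1p Omega p w ->
  {ae leb, forall x, Omega x -> enorm (wgrad v x) <= enorm (wgrad w x)} ->
  energy v <= energy w.
Proof.
move=> vW wW vw.
rewrite -lee_fin -(energy_fin vW) -(energy_fin wW).
apply: ae_ge0_le_integral; first exact: mO.
- by move=> x _; rewrite lee_fin powR_ge0.
- by apply/measurable_EFinP; apply: measurable_fun_powR; exact: measurable_enorm_wgrad.
- by move=> x _; rewrite lee_fin powR_ge0.
- by apply/measurable_EFinP; apply: measurable_fun_powR; exact: measurable_enorm_wgrad.
- apply: filterS vw => x vw Ox; rewrite lee_fin ge0_ler_powR ?nnegrE ?enorm_ge0 ?vw//.
  exact: ltW.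
Qed.

Lemma energyZ (t : R) v : W1p Omega p v -> energy (fun x => t * v x) = `|t| `^ p * energy v.
Proof.
move=> vW; apply: EFin_inj; rewrite EFinM -(energy_fin (W1pZ t vW)).
rewrite -(energy_fin vW) -ge0_integralZl//; last 2 first.
- by apply/measurable_EFinP; apply: measurable_fun_powR; exact: measurable_enorm_wgrad.
- by move=> x _; rewrite lee_fin powR_ge0.
apply: ge0_ae_eq_integral; first exact: mO.
- by apply/measurable_EFinP; apply: measurable_fun_powR; apply: measurable_enorm_wgrad; exact: W1pZ.
- apply/measurable_EFinP; apply: measurable_funM => //.
  by apply: measurable_fun_powR; exact: measurable_enorm_wgrad.
- by move=> x _; rewrite lee_fin powR_ge0.
- by move=> x _; rewrite mule_ge0 ?lee_fin ?powR_ge0.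
- have := wgradZ t vW; apply: filterS => x H /H ->.
  by rewrite enormZ powRM ?enorm_ge0// EFinM.
Qed.

Lemma cvg_L1 (f : nat -> 'rV[R]_n -> R) : (forall k, measurable_fun Omega (f k)) ->
  normLp Omega p (f k) @[k --> \oo] --> 0%E ->
  (\int[leb]_(x in Omega) `|f k x|%:E)%E @[k --> \oo] --> 0%E.
Proof.
move=> mf f0; set c := (fine (leb Omega) `^ (1 - p^-1))%:E.
have fc : (normLp Omega p (f k) * c)%E @[k --> \oo] --> 0%E.
  by rewrite -[X in _ --> X](mul0e c); apply: cvgeZr.
apply: (squeeze_cvge _ (cvg_cst 0%E) fc); apply: nearW => k.
by rewrite integral_ge0 /= ?integral_le_normLp.
Qed.

End sobolev_zero.

(** * The inequality satisfied by a positive weak solution *)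

Section weak_solutions.
Context {R : realType} {n : nat}.
Local Notation leb := (@lebesgue_rV R n).
Variables (Omega : set 'rV[R]_n) (p kappa : R) (u : 'rV[R]_n -> R).
Hypotheses (oO : open Omega) (fO : (leb Omega < +oo)%E) (p1 : 1 < p).
Hypotheses (Opos : (0 < leb Omega)%E) (usol : weak_solution Omega p kappa u).
Implicit Types (v w phi psi : 'rV[R]_n -> R).

Let mO : measurable Omega. Proof. exact: measurable_open_rV. Qed.
Let p0 : 0 < p. Proof. exact: lt_trans p1. Qed.
Let pn0 : p != 0. Proof. by rewrite gt_eqF. Qed.
Let uW : W01p Omega p u. Proof. by have [] := usol. Qed.
Let uW1 : W1p Omega p u. Proof. by have [] := uW. Qed.
Let mu_ : measurable_fun Omega u. Proof. by have [[]] := uW1. Qed.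

Local Notation wgrad := (wgrad Omega p).
Local Notation energy := (energy Omega p).

Lemma solution_ge_cbox a b : cbox a b `<=` Omega ->
  exists2 d : R, 0 < d & {ae leb, forall x, cbox a b x -> d <= u x}.
Proof.
move=> abO; have [_ /(_ _ (@compact_cbox R n a b) abO) + _] := usol.
have := ess_inf_le leb (patch (cst +oo%E) (cbox a b) (EFin \o u)).
rewrite /ess_inf_on; case: (ess_inf _ _) => [d||]//.
  move=> H; rewrite lte_fin => d0; exists d => //.
  by apply: filterS H => x + xab; rewrite /patch mem_set.
move=> H _; exists 1 => //.
by apply: filterS H => x + xab; rewrite /patch mem_set.
Qed.

Lemma solution_gt0 : {ae leb, forall x, Omega x -> 0 < u x}.
Proof.
apply: ae_local => // a b abO; have [d d0 H] := solution_ge_cbox abO.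
by apply: filterS H => x H /obox_sub_cbox/H; exact: lt_le_trans.
Qed.

(** Negative powers and logarithms are taken pointwise, hence a representative
that is positive at every point. *)
Definition pos_rep (x : 'rV[R]_n) : R := if 0 < u x then u x else 1.

Lemma pos_rep_gt0 x : 0 < pos_rep x.
Proof. by rewrite /pos_rep; case: ifPn. Qed.

Lemma pos_repE : {ae leb, forall x, Omega x -> u x = pos_rep x}.
Proof. by apply: filterS solution_gt0 => x H Ox; rewrite /pos_rep H. Qed.

Lemma measurable_pos_rep : measurable_fun Omega pos_rep.
Proof.
apply: (@measurable_fun_if _ _ _ _ u (cst 1) _ mO (fun x => 0 < u x)) => //.
- by apply: measurable_fun_ltr.
- by apply: measurable_funS mu_ => //; exact: subIsetl.
Qed.

Lemma measurable_inv_pos_rep : measurable_fun Omega (fun x => (pos_rep x)^-1).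
Proof.
rewrite (_ : (fun x => _) = fun x => pos_rep x `^ (-1)).
  by apply: measurable_fun_powR; exact: measurable_pos_rep.
by apply/funext => x; rewrite powR_inv1// ltW// pos_rep_gt0.
Qed.

Lemma solution_test phi : W01p Omega p phi ->
  (\int[leb]_(x in Omega)
     (enorm (wgrad u x) `^ (p - 2) * dotr (wgrad u x) (wgrad phi x))%:E =
   kappa%:E * \int[leb]_(x in Omega) (phi x / pos_rep x)%:E)%E.
Proof.
move=> phiW; have [_ _ ->//] := usol; congr (_ * _)%E.
have mphi : measurable_fun Omega phi by have [[[]]] := phiW.
apply: ae_eq_integral => //.
- apply/measurable_EFinP; apply: measurable_funM => //.
  rewrite (_ : (fun x => _) = fun x => u x * `|u x| `^ (-2)).
    by apply: measurable_funM => //; apply: measurable_fun_powR; exact: measurableT_comp.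
  apply/funext => x; have [->|ux0] := eqVneq (u x) 0; first by rewrite invr0 mul0r.
  by rewrite powRN -[2]/(2%:R) powR_mulrn// real_normK ?num_real//; field.
- apply/measurable_EFinP; apply: measurable_funM => //; exact: measurable_inv_pos_rep.
- by apply: filterS pos_repE => x H Ox; rewrite -H// mulrC.
Qed.

(** Test the equation with the solution itself. *)
Lemma energy_solution : energy u = kappa * vol Omega.
Proof.
have volE : leb Omega = (vol Omega)%:E by rewrite fineK// ge0_fin_numE// measure_ge0.
apply: EFin_inj; rewrite -(energy_fin oO p1)//.
transitivity (kappa%:E * \int[leb]_(x in Omega) (u x / pos_rep x)%:E)%E.
  rewrite -solution_test//; apply: eq_integral => x _; congr EFin.
  rewrite -enorm_sqr; have := enorm_ge0 (wgrad u x).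
  rewrite le_eqVlt => /predU1P[<-|e0]; first by rewrite expr0n/= mulr0 powR0.
  by rewrite -powR_mulrn ?ltW// -powRD ?subrK// gt_eqF// implybT.
rewrite EFinM -volE; congr (_ * _)%E.
transitivity (\int[leb]_(x in Omega) (cst 1%E x))%E; last by rewrite integral_cst// mul1e.
apply: ae_eq_integral => //.
- apply/measurable_EFinP; apply: measurable_funM => //; exact: measurable_inv_pos_rep.
- apply: filterS pos_repE => x H Ox; rewrite -H// divff//.
  by rewrite H// gt_eqF// pos_rep_gt0.
Qed.

Lemma kappa_ge0 : 0 <= kappa.
Proof.
have v0 : 0 < vol Omega by rewrite fine_gt0// Opos fO.
by rewrite -(pmulr_lge0 _ v0) -energy_solution energy_ge0.
Qed.

Lemma solution_test_le psi : test_function Omega psi ->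
  (kappa%:E * \int[leb]_(x in Omega) (psi x / pos_rep x)%:E <=
   (energy u `^ (1 - p^-1) * energy psi `^ p^-1)%:E)%E.
Proof.
move=> tpsi; have psiW := W01p_test oO fO p1 tpsi; have [psiW1 _] := psiW.
rewrite -solution_test//.
have meu := measurable_enorm_wgrad uW1; have mep := measurable_enorm_wgrad psiW1.
have mI : measurable_fun Omega (fun x =>
    (enorm (wgrad u x) `^ (p - 2) * dotr (wgrad u x) (wgrad psi x))%:E).
  apply/measurable_EFinP; apply: measurable_funM; first exact: measurable_fun_powR.
  by apply: measurable_sum => i; apply: measurable_funM; exact: measurable_wgrad.
apply: le_trans (lee_abs _) _; apply: le_trans (le_abse_integral _ mO mI) _.
apply: (@le_trans _ _ (\int[leb]_(x in Omega)
   `|enorm (wgrad u x) `^ (p - 1) * enorm (wgrad psi x)|%:E)%E).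
  apply: ge0_le_integral => //.
  - exact: measurableT_comp.
  - apply/measurable_EFinP; apply: measurableT_comp => //.
    by apply: measurable_funM => //; exact: measurable_fun_powR.
  - move=> x _; rewrite lee_fin !normrM [X in _ <= _ * X]ger0_norm ?enorm_ge0//.
    have := enorm_ge0 (wgrad u x).
    rewrite le_eqVlt => /predU1P[e0|e0].
      have := cauchy_schwarz (wgrad u x) (wgrad psi x); rewrite -e0 mul0r normr_le0.
      by move=> /eqP ->; rewrite normr0 mulr0 mulr_ge0 ?enorm_ge0.
    have -> : enorm (wgrad u x) `^ (p - 1) = enorm (wgrad u x) `^ (p - 2) * enorm (wgrad u x).
      rewrite -[X in _ = _ * X]powRr1 ?ltW// -powRD ?(gt_eqF e0) ?implybT//.
      by congr (_ `^ _); ring.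
    rewrite normrM -mulrA ler_wpM2l//.
    by rewrite [X in X * _]gtr0_norm// cauchy_schwarz.
have pp : p - 1 != 0 by rewrite subr_eq0 gt_eqF.
have r0 : 0 < (1 - p^-1)^-1 by rewrite invr_gt0 subr_gt0 invf_lt1.
have := @hoelder_on _ _ _ mO _ _ _ _ (measurable_fun_powR (p - 1) meu) mep r0 p0.
rewrite invrK subrK => /(_ erefl); apply: (fun h1 h2 => le_trans h2 h1).
rewrite le_eqVlt EFinM; apply/orP; left; apply/eqP; congr (_ * _)%E.
  rewrite -poweR_EFin -(energy_fin oO p1 uW1); congr (_ `^ _)%E.
  apply: eq_integral => x _; congr EFin.
  rewrite ger0_norm ?powR_ge0//= -powRrM; congr (_ `^ _).
  by rewrite -[X in X - 1](mulr1); field; rewrite pp pn0.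
rewrite -poweR_EFin -(energy_fin oO p1 psiW1); congr (_ `^ _)%E.
by apply: eq_integral => x _; rewrite /= ger0_norm ?enorm_ge0.
Qed.

End weak_solutions.

Section key_inequality.
Context {R : realType} {n : nat}.
Local Notation leb := (@lebesgue_rV R n).
Variables (Omega : set 'rV[R]_n) (p kappa : R) (u : 'rV[R]_n -> R).
Hypotheses (oO : open Omega) (fO : (leb Omega < +oo)%E) (p1 : 1 < p).
Hypotheses (Opos : (0 < leb Omega)%E) (usol : weak_solution Omega p kappa u).
Implicit Types (v w phi psi : 'rV[R]_n -> R).

Let mO : measurable Omega. Proof. exact: measurable_open_rV. Qed.
Let p0 : 0 < p. Proof. exact: lt_trans p1. Qed.
Let volE : leb Omega = (vol Omega)%:E.
Proof. by rewrite fineK// ge0_fin_numE// measure_ge0. Qed.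
Let kappa0 : 0 <= kappa. Proof. exact: kappa_ge0 oO fO p1 Opos usol. Qed.

Local Notation wgrad := (wgrad Omega p).
Local Notation energy := (energy Omega p).
Local Notation pos_rep := (pos_rep u).
Local Notation C := (energy u `^ (1 - p^-1)).

(** Bounded truncations of 1/u, for which convergence in L^1 passes to the limit. *)
Let weight (k : nat) x := Num.min (pos_rep x)^-1 k%:R.

Let weight_ge0 k x : 0 <= weight k x.
Proof. by rewrite le_min invr_ge0 ltW ?pos_rep_gt0//=. Qed.

Let weight_le k x : weight k x <= k%:R.
Proof. by rewrite ge_min lexx orbT. Qed.

Let weight_le_inv k x : weight k x <= (pos_rep x)^-1.
Proof. by rewrite ge_min lexx. Qed.

Let measurable_weight k : measurable_fun Omega (weight k).
Proof.
apply: measurable_minr => //; exact: (measurable_inv_pos_rep oO usol).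
Qed.

Let measurable_weighted v k : measurable_fun Omega v ->
  measurable_fun Omega (fun x => (`|v x| * weight k x)%:E).
Proof.
move=> mv; apply/measurable_EFinP; apply: measurable_funM => //.
exact: measurableT_comp.
Qed.

Lemma test_function_soft_abs (e : R) phi : 0 < e -> test_function Omega phi ->
  test_function Omega (soft_abs e \o phi).
Proof.
move=> e0 [sphi [K [cK KO phi0]]]; split; first exact: smooth_soft_abs.
by exists K; split => // x /phi0 /= ->; rewrite soft_abs0.
Qed.

(** The derivative t / sqrt (t^2 + e^2) of [soft_abs e] is at most 1 in absolute
value. *)
Lemma energy_soft_abs (e : R) phi : 0 < e -> test_function Omega phi ->
  energy (soft_abs e \o phi) <= energy phi.
Proof.
move=> e0 tphi; have tpsi := test_function_soft_abs e0 tphi.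
apply: (energy_le oO p1); [exact: W1p_test|exact: W1p_test|].
have := wgrad_test oO fO p1 tphi; apply: filterS2 (wgrad_test oO fO p1 tpsi).
move=> x + + Ox => /(_ Ox) -> /(_ Ox) ->; have [sphi _] := tphi.
have S0 := sqrt_quad_gt0 (phi x) e0.
rewrite (_ : grad _ x = (phi x / Num.sqrt (phi x ^+ 2 + e ^+ 2)) *: grad phi x).
  rewrite enormZ ler_piMl ?enorm_ge0// normrM normfV [X in _ / X]gtr0_norm//.
  by rewrite ler_pdivrMr// mul1r ler_norm_sqrt_quad.
by apply/rowP => i; rewrite !mxE partial_soft_abs.
Qed.

Lemma weighted_test phi k : test_function Omega phi ->
  (kappa%:E * \int[leb]_(x in Omega) (`|phi x| * weight k x)%:E <=
   (C * energy phi `^ p^-1)%:E)%E.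
Proof.
move=> tphi; have mphi : measurable_fun Omega phi by exact: measurable_test tphi.
have mu0 := measurable_inv_pos_rep oO usol.
pose c := kappa * (k%:R * vol Omega).
have vol0 : 0 <= vol Omega by rewrite fine_ge0// measure_ge0.
have c0 : 0 <= c by rewrite !mulr_ge0.
suff H (e : R) : 0 < e ->
    (kappa%:E * \int[leb]_(x in Omega) (`|phi x| * weight k x)%:E <=
     (C * energy phi `^ p^-1)%:E + (e * c)%:E)%E.
  apply/lee_addgt0Pr => e e0; have c1 : 0 < c + 1 by rewrite ltr_wpDl.
  apply: le_trans (H (e / (c + 1)) _) _; first exact: divr_gt0.
  have cc : c / (c + 1) <= 1 by rewrite ler_pdivrMr// mul1r lerDl.
  by rewrite leeD2l// lee_fin mulrAC -mulrA ler_piMr// ltW.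
move=> e0; pose psi := soft_abs e \o phi.
have tpsi : test_function Omega psi by exact: test_function_soft_abs.
have mpsi : measurable_fun Omega psi by exact: measurable_test tpsi.
have psi0 x : 0 <= psi x by exact: soft_abs_ge0.
have mq : measurable_fun Omega (fun x => (psi x / pos_rep x)%:E).
  by apply/measurable_EFinP; exact: measurable_funM.
have q0 x : 0 <= psi x / pos_rep x by rewrite mulr_ge0// invr_ge0 ltW// pos_rep_gt0.
apply: (@le_trans _ _ (kappa%:E * (\int[leb]_(x in Omega) (psi x / pos_rep x)%:E
   + \int[leb]_(x in Omega) (e * k%:R)%:E))%E).
  rewrite lee_wpmul2l ?lee_fin// -ge0_integralD//.
  - apply: ge0_le_integral; first exact: mO.
    + by move=> x _; rewrite lee_fin mulr_ge0.
    + exact: measurable_weighted.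
    + exact: emeasurable_funD.
    + move=> x _; rewrite -EFinD lee_fin.
      apply: (@le_trans _ _ ((psi x + e) * weight k x)).
        by rewrite ler_wpM2r// -lerBlDr soft_abs_ge.
      by rewrite mulrDl lerD ?ler_wpM2l ?weight_le_inv ?weight_le// ltW.
  - by move=> x _; rewrite lee_fin q0.
  - by move=> x _; rewrite lee_fin; apply: mulr_ge0 => //; exact: ltW.
have -> : (\int[leb]_(x in Omega) (e * k%:R)%:E = (e * k%:R * vol Omega)%:E)%E.
  by transitivity ((e * k%:R)%:E * leb Omega)%E; [exact: integral_cst|rewrite volE].
rewrite ge0_muleDr; last 2 first.
- by apply: integral_ge0 => x _; rewrite lee_fin.
- by rewrite lee_fin !mulr_ge0// ltW.
apply: leeD; last by rewrite -EFinM lee_fin /c -!mulrA mulrCA.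
apply: le_trans (solution_test_le oO fO p1 usol tpsi) _.
rewrite lee_fin ler_wpM2l ?powR_ge0// ge0_ler_powR ?nnegrE ?energy_ge0//.
- by rewrite invr_ge0 ltW.
- exact: energy_soft_abs.
Qed.

(** Both sides pass to the limit along test functions approximating [v]. *)
Lemma weighted_W01p v k : W01p Omega p v ->
  (kappa%:E * \int[leb]_(x in Omega) (`|v x| * weight k x)%:E <=
   (C * energy v `^ p^-1)%:E)%E.
Proof.
move=> [vW [phi [tphi cphi cgrad]]]; have [[mv _] _] := vW.
have mphi j : measurable_fun Omega (phi j) by exact: measurable_test (tphi j).
have C0 : 0 <= C by exact: powR_ge0.
pose a j := (\int[leb]_(x in Omega) `|phi j x - v x|%:E)%E.
pose b j := normLp Omega p (fun x => enorm (grad (phi j) x - wgrad v x)).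
have a0 : a j @[j --> \oo] --> 0%E.
  by apply: (cvg_L1 oO fO p1) cphi => j; exact: measurable_funB.
have H j : (kappa%:E * \int[leb]_(x in Omega) (`|v x| * weight k x)%:E <=
   (kappa * k%:R)%:E * a j + C%:E * (b j + (energy v `^ p^-1)%:E))%E.
  have ma : measurable_fun Omega (fun x => `|phi j x - v x|%:E).
    by apply/measurable_EFinP; apply: measurableT_comp => //; exact: measurable_funB.
  apply: (@le_trans _ _ (kappa%:E * (k%:R%:E * a j +
      \int[leb]_(x in Omega) (`|phi j x| * weight k x)%:E))%E).
    rewrite lee_wpmul2l ?lee_fin// /a -ge0_integralZl//.
    rewrite -ge0_integralD//; last 3 first.
    - exact: measurable_funeM.
    - by move=> x _; rewrite lee_fin mulr_ge0.
    - exact: measurable_weighted.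
    apply: ge0_le_integral; first exact: mO.
    - by move=> x _; rewrite lee_fin mulr_ge0.
    - exact: measurable_weighted.
    - by apply: emeasurable_funD; [exact: measurable_funeM|exact: measurable_weighted].
    - move=> x _; rewrite -EFinM -EFinD lee_fin.
      apply: (@le_trans _ _ ((`|phi j x - v x| + `|phi j x|) * weight k x)).
        rewrite ler_wpM2r//; have := ler_normB (phi j x) (phi j x - v x).
        by rewrite subKr addrC.
      by rewrite mulrDl lerD// mulrC ler_wpM2r.
  rewrite ge0_muleDr ?integral_ge0//; last 2 first.
  - by rewrite mule_ge0 ?lee_fin// integral_ge0// => x _; rewrite lee_fin.
  - by move=> x _; rewrite lee_fin mulr_ge0.
  rewrite muleA -EFinM; apply: leeD => //.
  apply: le_trans (weighted_test k (tphi j)) _.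
  have [phiW _] := W01p_test oO fO p1 (tphi j).
  rewrite EFinM lee_wpmul2l ?lee_fin// -(normLp_energy oO p1 phiW) -(normLp_energy oO p1 vW).
  have mb := measurable_enorm_diff oO fO p1 (tphi j) vW.
  have mv' := measurable_enorm_wgrad vW.
  apply: le_trans (normLp_triangle mO p1 mb mv').
  rewrite (@normLp_eq _ _ _ _ mO p1 _ (enorm \o grad (phi j))); last 3 first.
  - by have := wgrad_test oO fO p1 (tphi j); apply: filterS => x h /h /= ->.
  - exact: measurable_enorm_wgrad.
  - by apply: measurable_enorm => i; exact: (measurable_grad oO fO p1 i (tphi j)).
  apply: normLp_le => //.
  - by apply: measurable_enorm => i; exact: (measurable_grad oO fO p1 i (tphi j)).
  - exact: measurable_funD.
  - move=> x _ /=; rewrite !ger0_norm ?addr_ge0 ?enorm_ge0//.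
    by apply: le_trans (enormD _ _); rewrite subrK.
have lim : ((kappa * k%:R)%:E * a j + C%:E * (b j + (energy v `^ p^-1)%:E))%E @[j --> \oo]
    --> (C * energy v `^ p^-1)%:E.
  rewrite -[X in _ --> X]add0e; apply: cvgeD => //.
  - by rewrite -[X in _ --> X](mule0 (kappa * k%:R)%:E); apply: cvgeZl.
  - rewrite EFinM; apply: cvgeZl => //; rewrite -[X in _ --> X]add0e.
    by apply: cvgeD => //; exact: cvg_cst.
by apply: (cvge_ge _ lim); exact: nearW.
Qed.

(** Testing the equation with smooth approximations of |v| gives
kappa int |v|/u <= int |Du|^(p-1) |Dv|, and Hoelder's inequality concludes. *)
Lemma key_inequality v : W01p Omega p v ->
  (kappa%:E * \int[leb]_(x in Omega) (`|v x| / pos_rep x)%:E <=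
   (C * energy v `^ p^-1)%:E)%E.
Proof.
move=> vW; have [[[mv _] _] _] := vW.
have H : (\int[leb]_(x in Omega) (`|v x| * weight k x)%:E)%E @[k --> \oo] -->
    (\int[leb]_(x in Omega) (`|v x| / pos_rep x)%:E)%E.
  rewrite (_ : (\int[leb]_(x in Omega) (`|v x| / pos_rep x)%:E)%E =
    (\int[leb]_(x in Omega) limn (fun k => (`|v x| * weight k x)%:E))%E).
    apply: cvg_monotone_convergence => //.
    - by move=> k; exact: measurable_weighted.
    - by move=> k x _; rewrite lee_fin mulr_ge0.
    - move=> x _ i j ij; rewrite lee_fin ler_wpM2l// /weight le_min !ge_min lexx/=.
      by rewrite ler_nat ij orbT.
  apply: eq_integral => x _; apply/esym/cvg_lim => //.
  apply: cvg_near_cst; near=> k; congr (_ * _)%:E.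
  by rewrite /weight min_l//; near: k; exact: nbhs_infty_ger.
have lim : (kappa%:E * \int[leb]_(x in Omega) (`|v x| * weight k x)%:E)%E @[k --> \oo] -->
    (kappa%:E * \int[leb]_(x in Omega) (`|v x| / pos_rep x)%:E)%E by apply: cvgeZl.
by apply: (cvge_le _ lim); apply: nearW => k; exact: weighted_W01p.
Unshelve. all: by end_near. Qed.

End key_inequality.

(** * Consequences of the Poincare inequality *)

Section poincare_consequences.
Context {R : realType} {n : nat}.
Local Notation leb := (@lebesgue_rV R n).

(** The approximations are close to constants by the Poincare inequality. *)
Lemma poincare_approx (a b : 'rV[R]_n) (sigma : 'rV[R]_n -> R) :
  (forall i, a 0 i < b 0 i) -> measurable_fun (cbox a b) sigma ->
  (forall e : R, 0 < e -> exists f, [/\ C1 f,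
     (\int[leb]_(x in cbox a b) `|f x - sigma x|%:E <= e%:E)%E &
     forall i, (\int[leb]_(x in cbox a b) `|partial i f x|%:E <= e%:E)%E]) ->
  forall e : R, 0 < e -> exists c : R,
    (\int[leb]_(x in cbox a b) `|sigma x - c|%:E <= e%:E)%E.
Proof.
move=> ab ms H e e0; have [C C0 HC] := poincare_cbox ab.
have mQ := measurable_cbox a b.
pose D := 1 + C * n%:R.
have D0 : 0 < D by rewrite ltr_pwDl// mulr_ge0.
have [|f [C1f fs pf]] := H (e / D); first exact: divr_gt0.
have [c fc] := HC f C1f; exists c; have [cf _ _] := C1f.
have mf : measurable_fun (cbox a b) f by apply: measurable_funTS; exact: continuous_measurable_rV.
apply: (@le_trans _ _ (\int[leb]_(x in cbox a b) (`|f x - sigma x|%:E + `|f x - c|%:E))%E).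
  apply: ge0_le_integral; first exact: mQ.
  - by move=> x _; rewrite lee_fin.
  - by apply/measurable_EFinP; apply: measurableT_comp => //; exact: measurable_funB.
  - apply: emeasurable_funD; apply/measurable_EFinP; apply: measurableT_comp => //;
    exact: measurable_funB.
  - move=> x _; rewrite -EFinD lee_fin (distrC (f x) (sigma x)).
    by have := ler_normD (sigma x - f x) (f x - c); rewrite addrA subrK.
rewrite ge0_integralD//; last 2 first.
- by apply/measurable_EFinP; apply: measurableT_comp => //; exact: measurable_funB.
- by apply/measurable_EFinP; apply: measurableT_comp => //; exact: measurable_funB.
apply: (@le_trans _ _ ((e / D)%:E + C%:E * (n%:R * (e / D))%:E)%E).
  apply: leeD => //; apply: le_trans fc _; rewrite lee_wpmul2l ?lee_fin//.
  apply: (@le_trans _ _ (\sum_(i < n) (e / D)%:E)%E); first exact: lee_sum.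
  by rewrite sumEFin sumr_const card_ord mulr_natl.
rewrite -EFinM -EFinD lee_fin le_eqVlt; apply/orP; left; apply/eqP.
by rewrite -[RHS](divfK (lt0r_neq0 D0)) /D; ring.
Qed.

Definition sqr_pos (t : R) : R := Num.max t 0 ^+ 2.

Lemma is_derive_sqr_pos (t : R) : is_derive t 1 sqr_pos (2 * Num.max t 0).
Proof.
have [t0|t0|->] := ltgtP t 0.
- rewrite mulr0; apply: (near_eq_is_derive (f := cst 0)).
  near=> s; rewrite /sqr_pos max_r ?expr0n//; apply: ltW; near: s; exact: lt_nbhsl.
- have d : is_derive t 1 (fun t : R => t ^+ 2) (2 * t).
    apply: DeriveDef; first exact: exprn_derivable.
    by rewrite exp_derive expr1 /GRing.scale/= mulr1.
  apply: near_eq_is_derive d.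
  near=> s; rewrite /sqr_pos max_l//; apply: ltW; near: s; exact: lt_nbhsr.
- rewrite mulr0.
  have H : (fun h : R => h^-1 *: ((sqr_pos \o shift 0) (h *: 1) - sqr_pos 0)) @ 0^' --> (0 : R).
    apply/cvgrPdist_lt => /= e e0; near=> h.
    have h0 : h != 0 by near: h; exact: nbhs_dnbhs_neq.
    rewrite /sqr_pos maxxx expr0n/= subr0 sub0r normrN /GRing.scale/= mulr1 addr0.
    apply: (@le_lt_trans _ _ `|h|); last by near: h; exact: dnbhs0_lt.
    rewrite normrM normfV ler_pdivrMl ?normr_gt0// normrX -expr2 ler_pXn2r ?nnegrE//.
    by case: (leP h 0) => h0'; rewrite ?normr0.
  by apply: DeriveDef; [apply: cvgP H|apply/cvg_lim].
Unshelve. all: by end_near. Qed.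

(** A step of class C^1 from 0 to 1, constant outside the interval (-d, d). *)
Definition step (d t : R) : R := sqr_pos (1 - sqr_pos (1 - t / d) / 4).

Definition step_deriv (d t : R) : R :=
  2 * Num.max (1 - sqr_pos (1 - t / d) / 4) 0 * (Num.max (1 - t / d) 0 / (2 * d)).

Lemma is_derive_step (d t : R) : 0 < d -> is_derive t 1 (step d) (step_deriv d t).
Proof.
move=> d0; have dn0 : d != 0 by rewrite gt_eqF.
have d1 : is_derive t 1 (fun t : R => 1 - t / d) (- d^-1).
  have h1 := is_deriveM (is_derive_id t 1) (is_derive_cst d^-1 t 1).
  have h2 := is_deriveB (is_derive_cst (1 : R) t 1) h1.
  by apply: is_derive_eq h2 _; rewrite /GRing.scale/=; ring.
have d2 := @is_derive1_comp R sqr_pos (fun t => 1 - t / d) t _ _ (is_derive_sqr_pos _) d1.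
have d3 : is_derive t 1 (fun t => 1 - sqr_pos (1 - t / d) / 4) (Num.max (1 - t / d) 0 / (2 * d)).
  have h1 := is_deriveM d2 (is_derive_cst (4^-1 : R) t 1).
  have h2 := is_deriveB (is_derive_cst (1 : R) t 1) h1.
  by apply: is_derive_eq h2 _; rewrite /GRing.scale/=; field.
exact: (@is_derive1_comp R sqr_pos (fun t => 1 - sqr_pos (1 - t / d) / 4) t _ _
  (is_derive_sqr_pos _) d3).
Qed.

Lemma max0_continuous : continuous (fun t : R => Num.max t 0).
Proof.
rewrite (_ : (fun t => _) = fun t : R => (t + `|t|) / 2).
  move=> t; have nt : (fun s : R => `|s|) s @[s --> t] --> `|t| by exact: norm_continuous.
  by apply: cvgM; [apply: cvgD => //; exact: cvg_id|exact: cvg_cst].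
by apply/funext => t; rewrite maxr_absE addr0 subr0.
Qed.

Lemma step_deriv_continuous (d : R) : continuous (step_deriv d).
Proof.
have c1 : continuous (fun t : R => 1 - t / d).
  move=> t; apply: cvgB; first exact: cvg_cst.
  by apply: cvgM; [exact: cvg_id|exact: cvg_cst].
have cm (f : R -> R) : continuous f -> continuous (fun t => Num.max (f t) 0).
  by move=> cf t; apply: (@continuous_comp _ _ _ f (fun t => Num.max t 0)); [exact: cf|exact: max0_continuous].
have c2 : continuous (fun t : R => 1 - sqr_pos (1 - t / d) / 4).
  move=> t; apply: cvgB; first exact: cvg_cst.
  apply: cvgM; last exact: cvg_cst.
  by rewrite /sqr_pos; apply: cvgM; exact: (cm _ c1).
move=> t; apply: cvgM.
  by apply: cvgM; [exact: cvg_cst|exact: (cm _ c2)].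
by apply: cvgM; [exact: (cm _ c1)|exact: cvg_cst].
Qed.

Lemma step_ge (d t : R) : 0 < d -> d <= t -> step d t = 1.
Proof.
move=> d0 dt; have h : 1 - t / d <= 0 by rewrite subr_le0 ler_pdivlMr// mul1r.
by rewrite /step /sqr_pos (max_r h) expr0n/= mul0r subr0 max_l// expr1n.
Qed.

Lemma sqr_pos_ge4 (d t : R) : 0 < d -> t <= - d -> 4 <= sqr_pos (1 - t / d).
Proof.
move=> d0 dt; have h : 2 <= 1 - t / d.
  have : t / d <= -1 by rewrite ler_pdivrMr// mulN1r.
  lra.
have h0 : 0 <= 1 - t / d by rewrite (le_trans _ h).
rewrite /sqr_pos (max_l h0); nra.
Qed.

Lemma step_le (d t : R) : 0 < d -> t <= - d -> step d t = 0.
Proof.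
move=> d0 dt; have := sqr_pos_ge4 d0 dt => h.
by rewrite {1}/step /sqr_pos -/(sqr_pos (1 - t / d)) max_r ?expr0n//; lra.
Qed.

Lemma step_deriv_eq0 (d t : R) : 0 < d -> d <= `|t| -> step_deriv d t = 0.
Proof.
move=> d0; rewrite ler_normr => /orP[dt|dt].
  have h : 1 - t / d <= 0 by rewrite subr_le0 ler_pdivlMr// mul1r.
  by rewrite /step_deriv (max_r h) mul0r mulr0.
have := @sqr_pos_ge4 d t d0; rewrite lerNr => /(_ dt) h.
by rewrite /step_deriv (@max_r _ _ (1 - _ / 4)) ?mulr0 ?mul0r//; lra.
Qed.

Lemma step_deriv_le (d t : R) : 0 < d -> `|step_deriv d t| <= 2 / d.
Proof.
move=> d0; have dn0 : d != 0 by rewrite gt_eqF.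
set s := 1 - t / d.
have [s0|s0] := leP s 0.
  by rewrite /step_deriv -/s (max_r s0) mul0r mulr0 normr0 divr_ge0// ltW.
have sE : sqr_pos s = s ^+ 2 by rewrite /sqr_pos max_l// ltW.
have [h|h] := leP (1 - s ^+ 2 / 4) 0.
  by rewrite /step_deriv -/s sE (max_r h) mulr0 mul0r normr0 divr_ge0// ltW.
have s2 : s <= 2 by rewrite leNgt; apply/negP => s2; nra.
rewrite /step_deriv -/s sE (max_l (ltW h)) (max_l (ltW s0)).
have -> : 2 * (1 - s ^+ 2 / 4) * (s / (2 * d)) = (1 - s ^+ 2 / 4) * s / d by field.
rewrite ger0_norm; last by rewrite divr_ge0 ?mulr_ge0// ltW.
by rewrite ler_pM2r ?invr_gt0//; nra.
Qed.

Lemma step_lipschitz (d s t : R) : 0 < d -> `|step d s - step d t| <= 2 / d * `|s - t|.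
Proof.
move=> d0; wlog st : s t / s <= t.
  move=> W; have [st|/ltW ts] := leP s t; first exact: W.
  by rewrite distrC (distrC s); exact: W.
have [||c _] := @MVT_segment R (step d) (step_deriv d) s t st.
- by move=> x _; exact: is_derive_step.
- apply: continuous_subspaceT => x; apply: differentiable_continuous.
  by apply/derivable1_diffP; case: (is_derive_step x d0).
rewrite distrC (distrC s) => ->; rewrite normrM.
by rewrite ler_wpM2r// step_deriv_le.
Qed.

Lemma C1_step_comp (d : R) (phi : 'rV[R]_n -> R) : 0 < d -> smooth phi ->
  C1 (step d \o phi) /\
  forall i x, partial i (step d \o phi) x = step_deriv d (phi x) * partial i phi x.
Proof.
move=> d0 sphi; have D i x : is_derive x (delta_mx 0 i) (step d \o phi)
    (step_deriv d (phi x) * partial i phi x).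
  have [_ [dphi _]] := smooth_derive i sphi.
  exact: (is_derive_chain (is_derive_step _ d0) (dphi x)).
have E i x : partial i (step d \o phi) x = step_deriv d (phi x) * partial i phi x.
  by case: (D i x).
have cphi : continuous phi by exact: (sphi [::]).1.
split => //; split.
- move=> x; apply: continuous_comp; first exact: cphi.
  apply: differentiable_continuous.
  by apply/derivable1_diffP; case: (is_derive_step (phi x) d0).
- by move=> i x; case: (D i x).
- have cs : continuous (step_deriv d \o phi).
    by move=> x; apply: continuous_comp; [exact: cphi|exact: step_deriv_continuous].
  move=> i; have -> : partial i (step d \o phi) = (step_deriv d \o phi) * partial i phi.
    by apply/funext => x; exact: E.
  by move=> x; apply: continuousM; [exact: cs|exact: (sphi [:: i]).1].
Qed.

End poincare_consequences.

(** * Constancy of the sign and functions of zero energy *)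

Section zero_energy.
Context {R : realType} {n : nat}.
Local Notation leb := (@lebesgue_rV R n).
Variables (Omega : set 'rV[R]_n) (p : R).
Hypotheses (oO : open Omega) (fO : (leb Omega < +oo)%E) (p1 : 1 < p).
Implicit Types (v w phi psi : 'rV[R]_n -> R).

Let mO : measurable Omega. Proof. exact: measurable_open_rV. Qed.

Local Notation wgrad := (wgrad Omega p).
Local Notation energy := (energy Omega p).

Lemma W01p_approx v (e : R) : W01p Omega p v -> 0 < e -> exists phi,
  [/\ test_function Omega phi,
      (\int[leb]_(x in Omega) `|phi x - v x|%:E <= e%:E)%E &
      (\int[leb]_(x in Omega) (enorm (grad phi x - wgrad v x))%:E <= e%:E)%E].
Proof.
move=> [vW [phi [tphi cphi cgrad]]] e0; have [[mv _] _] := vW.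
pose a k := (\int[leb]_(x in Omega) `|phi k x - v x|%:E)%E.
pose b k := (\int[leb]_(x in Omega) `|enorm (grad (phi k) x - wgrad v x)|%:E)%E.
have a0 k : (0 <= a k)%E by apply: integral_ge0 => x _; rewrite lee_fin.
have b0 k : (0 <= b k)%E by apply: integral_ge0 => x _; rewrite lee_fin.
have ca : a k @[k --> \oo] --> 0%E.
  apply: (cvg_L1 oO fO p1) cphi => k; apply: measurable_funB => //.
  exact: measurable_test (tphi k).
have cb : b k @[k --> \oo] --> 0%E.
  by apply: (cvg_L1 oO fO p1) cgrad => k; exact: measurable_enorm_diff.
have cab : (a k + b k)%E @[k --> \oo] --> 0%E.
  by rewrite -[X in _ --> X]add0e; apply: cvgeD.
have [k abk] : exists k, (a k + b k <= e%:E)%E.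
  apply/not_existsP => H; have : (e%:E <= 0)%E.
    apply: (cvge_ge _ cab); apply: nearW => k; apply: ltW; rewrite ltNge.
    exact/negP/H.
  by rewrite lee_fin leNgt e0.
exists (phi k); split => //.
  by apply: le_trans abk; rewrite leeDl.
apply: le_trans abk; apply: (@le_trans _ _ (b k)); last by rewrite leeDr.
by rewrite /b; under [leRHS]eq_integral do rewrite ger0_norm ?enorm_ge0//.
Qed.

Lemma integral_partial_le phi v i D : test_function Omega phi -> W01p Omega p v ->
  measurable D -> D `<=` Omega ->
  (\int[leb]_(x in D) `|partial i phi x - wgrad v x 0%R i|%:E <=
   \int[leb]_(x in Omega) (enorm (grad phi x - wgrad v x))%:E)%E.
Proof.
move=> tphi [vW _] mD DO; have me := measurable_enorm_diff oO fO p1 tphi vW.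
have mp : measurable_fun Omega (fun x => `|partial i phi x - wgrad v x 0 i|%:E).
  apply/measurable_EFinP; apply: measurableT_comp => //.
  apply: measurable_funB; last exact: measurable_wgrad.
  by apply: measurable_test; exact: test_function_partial tphi.
apply: (@le_trans _ _ (\int[leb]_(x in Omega) `|partial i phi x - wgrad v x 0%R i|%:E)%E).
  by apply: ge0_subset_integral => // x _; rewrite lee_fin.
apply: ge0_le_integral; first exact: mO.
- by move=> x _; rewrite lee_fin.
- exact: mp.
- exact/measurable_EFinP.
- by move=> x _; rewrite lee_fin; apply: le_trans (coord_le_enorm _ i); rewrite !mxE.
Qed.

Lemma integral_enorm_wgrad_eq0 v : W1p Omega p v -> energy v = 0 ->
  (\int[leb]_(x in Omega) (enorm (wgrad v x))%:E = 0)%E.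
Proof.
move=> vW v0; have p0 : 0 < p by exact: lt_trans p1.
have := integral_le_normLp mO p1 fO (measurable_enorm_wgrad vW).
rewrite (normLp_energy oO p1 vW) v0 powR0 ?invr_neq0 ?gt_eqF// mul0e => H.
apply/eqP; rewrite eq_le integral_ge0 ?andbT; last first.
  by move=> x _; rewrite lee_fin enorm_ge0.
apply: le_trans H; rewrite le_eqVlt; apply/orP; left; apply/eqP.
by apply: eq_integral => x _; rewrite /= ger0_norm ?enorm_ge0.
Qed.

(** Extended by zero to a large box, a function of zero energy is constant on
the box, and vanishes on the part of the box that does not meet the domain. *)
Lemma energy_eq0 v : (0 < n)%N -> bounded_set Omega -> W01p Omega p v ->
  energy v = 0 -> {ae leb, forall x, Omega x -> v x = 0}.
Proof.
move=> n0 bO vW0 v0; have [vW _] := vW0; have [[mv _] _] := vW.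
have [M [M0 OM]] := bounded_sub_cbox bO.
pose a : 'rV[R]_n := const_mx (- (M + 1)); pose b : 'rV[R]_n := const_mx (M + 1).
pose Q := cbox a b; have mQ : measurable Q by exact: measurable_cbox.
have OQ : Omega `<=` Q.
  apply: subset_trans OM _ => x xM i; have := xM i; rewrite !mxE => /andP[h1 h2].
  by apply/andP; split; lra.
pose D : set 'rV[R]_n := obox (const_mx M) b; have mD : measurable D by exact: measurable_obox.
have DQ : D `<=` Q.
  move=> x xD i; have := xD i; rewrite !mxE => /andP[h1 h2].
  by apply/andP; split; lra.
have DO x : D x -> ~ Omega x.
  move=> xD /OM xM; have := xD (Ordinal n0); have := xM (Ordinal n0); rewrite !mxE.
  by move=> /andP[_ h1] /andP[h2 _]; move: (lt_le_trans h2 h1); rewrite ltxx.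
have D0 : (0 < leb D)%E by apply: lebesgue_obox_gt0 => i; rewrite !mxE ltrDl.
have Dfin : leb D \is a fin_num.
  rewrite ge0_fin_numE// (le_lt_trans (le_measure _ _ _ DQ)) ?inE//.
  exact: lebesgue_cbox_lty.
pose d := fine (leb D); have dE : leb D = d%:E by rewrite fineK.
have d0 : 0 < d by rewrite -lte_fin -dE.
have volE : leb Omega = (vol Omega)%:E by rewrite fineK// ge0_fin_numE// measure_ge0.
have vol0 : 0 <= vol Omega by rewrite fine_ge0// measure_ge0.
pose sigma := v \_ Omega.
have msigma : measurable_fun setT sigma by exact: (measurable_restrictT v mO).1.
have restr (g h : 'rV[R]_n -> \bar R) : (forall x, Omega x -> g x = h x) ->
    (forall x, ~ Omega x -> g x = 0%E) ->
    (\int[leb]_(x in Q) g x = \int[leb]_(x in Omega) h x)%E.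
  move=> gh g0; rewrite -[in RHS](setIidr OQ) integral_mkcondr.
  apply: eq_integral => x _; rewrite patchE; case: ifPn => xO.
    by rewrite gh//; rewrite inE in xO.
  by rewrite g0// => xO'; rewrite mem_set in xO.
(* The approximating test functions vanish outside the domain, so they
   approximate the extension of v on the whole box. *)
have approx (e : R) : 0 < e -> exists c : R,
    (\int[leb]_(x in Q) `|sigma x - c|%:E <= e%:E)%E.
  apply: poincare_approx.
  - by move=> i; rewrite !mxE; lra.
  - exact: measurable_funTS.
  move=> {}e e0; have [phi [tphi h1 h2]] := W01p_approx vW0 e0; exists phi; split.
  - by have [/smooth_C1] := tphi.
  - rewrite (restr _ (fun x => `|phi x - v x|%:E))// => x xO.
      by rewrite /sigma patchE mem_set.
    rewrite /sigma patchE memNset//; have [_ [K [_ KO ->]]] := tphi.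
      by rewrite subrr normr0.
    by move=> /KO.
  - move=> i; rewrite (restr _ (fun x => `|partial i phi x|%:E))//; last first.
      move=> x xO; have [_ [K [_ KO ->]]] := test_function_partial i tphi.
        by rewrite normr0.
      by move=> /KO.
    apply: le_trans h2.
    have mp : measurable_fun Omega (partial i phi).
      by apply: measurable_test; exact: test_function_partial tphi.
    have mw : measurable_fun Omega (fun x => wgrad v x 0 i) by exact: measurable_wgrad.
    apply: (@le_trans _ _ (\int[leb]_(x in Omega)
        ((enorm (grad phi x - wgrad v x))%:E + (enorm (wgrad v x))%:E))%E).
      apply: ge0_le_integral; first exact: mO.
      + by move=> x _; rewrite lee_fin.
      + by apply/measurable_EFinP; apply: measurableT_comp.
      + apply: emeasurable_funD; apply/measurable_EFinP.
          exact: measurable_enorm_diff.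
        exact: measurable_enorm_wgrad.
      + move=> x _; rewrite -EFinD lee_fin.
        apply: le_trans (enormD _ _); rewrite subrK.
        by apply: le_trans (coord_le_enorm _ i); rewrite mxE.
    rewrite ge0_integralD ?integral_enorm_wgrad_eq0 ?adde0//.
    - by move=> x _; rewrite lee_fin enorm_ge0.
    - by apply/measurable_EFinP; exact: measurable_enorm_diff.
    - by move=> x _; rewrite lee_fin enorm_ge0.
    - by apply/measurable_EFinP; exact: measurable_enorm_wgrad.
have small (e : R) : 0 < e ->
    (\int[leb]_(x in Omega) `|(v x)%:E| <= (e * (1 + vol Omega / d))%:E)%E.
  move=> e0; have [c cQ] := approx e e0.
  have msc E : measurable_fun E (fun x => `|sigma x - c|%:E).
    apply/measurable_EFinP; apply: measurableT_comp => //; apply: measurable_funB => //.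
    exact: measurable_funTS.
  (* The box contains D, of positive measure, on which the extension is 0; so the
     nearby constant is small. *)
  have cd : `|c| <= e / d.
    rewrite ler_pdivlMr// -lee_fin EFinM -dE; apply: le_trans cQ.
    apply: (@le_trans _ _ (\int[leb]_(x in D) `|sigma x - c|%:E)%E); last first.
      by apply: ge0_subset_integral => // x _; rewrite lee_fin.
    rewrite -integral_cst// le_eqVlt; apply/orP; left; apply/eqP.
    apply: eq_integral => x; rewrite inE => xD; rewrite /sigma patchE memNset ?sub0r ?normrN//.
    exact: DO.
  apply: (@le_trans _ _ (\int[leb]_(x in Omega) (`|sigma x - c|%:E + `|c|%:E))%E).
    apply: ge0_le_integral; first exact: mO.
    + by move=> x _; exact: abse_ge0.
    + by apply: measurableT_comp => //; exact/measurable_EFinP.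
    + by apply: emeasurable_funD => //; exact: msc.
    + move=> x xO; rewrite -EFinD lee_fin /sigma patchE mem_set//.
      by apply: le_trans (ler_normD _ _); rewrite subrK.
  rewrite ge0_integralD//.
  have -> : (\int[leb]_(x in Omega) `|c|%:E = `|c|%:E * (vol Omega)%:E)%E.
    by rewrite -volE; exact: integral_cst.
  rewrite mulrDr mulr1 EFinD; apply: leeD.
    by apply: le_trans cQ; apply: ge0_subset_integral => //; exact: msc.
  rewrite -EFinM lee_fin (_ : e * _ = e / d * vol Omega); last by ring.
  exact: ler_wpM2r.
have int0 : (\int[leb]_(x in Omega) `|(v x)%:E| = 0)%E.
  apply/eqP; rewrite eq_le integral_ge0// andbT; apply/lee_addgt0Pr => e e0.
  have k0 : 0 < 1 + vol Omega / d by rewrite ltr_pwDl// divr_ge0// ltW.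
  rewrite add0e; apply: le_trans (small (e / (1 + vol Omega / d)) _) _; first exact: divr_gt0.
  by rewrite divfK// gt_eqF.
have mEv : measurable_fun Omega (EFin \o v) by exact/measurable_EFinP.
have := (ae_eq_integral_abs leb mO mEv).1 int0.
by apply: filterS => x h Ox; have [] := h Ox.
Qed.

End zero_energy.

Section sign.
Context {R : realType} {n : nat}.
Local Notation leb := (@lebesgue_rV R n).
Variables (Omega : set 'rV[R]_n) (p : R).
Hypotheses (oO : open Omega) (fO : (leb Omega < +oo)%E) (p1 : 1 < p).
Implicit Types (v w phi psi : 'rV[R]_n -> R).

Let mO : measurable Omega. Proof. exact: measurable_open_rV. Qed.

Local Notation wgrad := (wgrad Omega p).

Lemma integrable_tail (G : 'rV[R]_n -> R) (e : R) : leb.-integrable Omega (EFin \o G) ->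
  (forall x, 0 <= G x) -> 0 < e ->
  exists2 K : R, 0 <= K &
    (\int[leb]_(x in Omega) (Num.max (G x - K) 0)%:E <= e%:E)%E.
Proof.
move=> iG G0 e0; have mG : measurable_fun Omega G by have /integrableP[/measurable_EFinP] := iG.
pose f (k : nat) x := (Num.max (G x - k%:R) 0)%:E.
have f0 k x : (0 <= f k x)%E by rewrite lee_fin le_max lexx orbT.
have [|||||_ _ lim0] := @dominated_convergence _ _ _ leb Omega mO f (cst 0%E) (EFin \o G).
- move=> k; apply/measurable_EFinP; apply: measurable_maxr => //.
  exact: measurable_funB.
- exact: measurable_cst.
- apply: aeW => x _; apply: cvg_near_cst; near=> k.
  rewrite /f max_r// subr_le0; near: k; exact: nbhs_infty_ger.
- exact: iG.
- apply: aeW => x k _; rewrite gee0_abs// lee_fin ge_max G0 andbT.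
  by rewrite lerBlDr lerDl.
rewrite integral0 in lim0.
have [k fk] : exists k, (\int[leb]_(x in Omega) f k x <= e%:E)%E.
  apply/not_existsP => H; have : (e%:E <= 0)%E.
    apply: (cvge_ge _ lim0); apply: nearW => k; apply: ltW; rewrite ltNge.
    exact/negP/H.
  by rewrite lee_fin leNgt e0.
by exists k%:R.
Unshelve. all: by end_near. Qed.

(** Composing with a step between the values of [v] gives the indicator of its
positivity set with zero gradient; by the Poincare inequality this indicator is
constant. *)
Lemma sign_on_box v (d : R) (a b : 'rV[R]_n) : 0 < d -> (forall i, a 0 i < b 0 i) ->
  cbox a b `<=` Omega -> W01p Omega p v ->
  {ae leb, forall x, cbox a b x -> 2 * d <= `|v x|} ->
  {ae leb, forall x, cbox a b x -> 0 < v x} \/ {ae leb, forall x, cbox a b x -> v x < 0}.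
Proof.
move=> d0 ab QO vW0 vd; have [vW _] := vW0; have [[mv _] _] := vW.
set Q := cbox a b in QO vd *; have mQ : measurable Q by exact: measurable_cbox.
have mvQ : measurable_fun Q v by exact: measurable_funS mv.
pose sigma := step d \o v.
have cstep : continuous (step d).
  move=> t; apply: differentiable_continuous; apply/derivable1_diffP.
  by case: (is_derive_step t d0).
have ms : measurable_fun Q sigma.
  by apply: measurableT_comp => //; exact: continuous_measurable_fun.
pose G x := enorm (wgrad v x).
have G0 x : 0 <= G x by exact: enorm_ge0.
have iG : leb.-integrable Omega (EFin \o G).
  apply: (Lp_integrable mO p1 fO); split; first exact: measurable_enorm_wgrad.
  by apply: (normLp_enorm_lty oO p1); have [] := weak_gradient_wgrad vW.
have approx (e : R) : 0 < e -> exists c : R,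
    (\int[leb]_(x in Q) `|sigma x - c|%:E <= e%:E)%E.
  apply: poincare_approx => // {}e e0.
  have [|K K0 tail] := @integrable_tail G (e * d / 8) iG G0.
    by rewrite divr_gt0 ?mulr_gt0.
  (* Where the step is not flat, |phi| < d <= |v| - d, so 1 <= |phi - v| / d and
     the part of the gradient of v below the level K is at most K |phi - v| / d;
     the part above it is the tail of G. *)
  pose eta := e * d / (8 * (1 + K / d)).
  have Kd0 : 0 < 1 + K / d by rewrite ltr_pwDl// divr_ge0// ltW.
  have eta0 : 0 < eta by rewrite divr_gt0 ?mulr_gt0.
  have etaE : eta * (1 + K / d) = e * d / 8 by rewrite /eta; move: Kd0; set X := 1 + K / d => X0; field; rewrite gt_eqF.
  have [phi [tphi h1 h2]] := W01p_approx oO fO p1 vW0 eta0.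
  have [sphi _] := tphi.
  have [C1f pf] := C1_step_comp d0 sphi.
  have mphi D : measurable_fun D phi by exact: measurable_test tphi.
  have mw : measurable_fun Q (fun x => `|phi x - v x|%:E).
    by apply/measurable_EFinP; apply: measurableT_comp => //; exact: measurable_funB.
  have h1Q : (\int[leb]_(x in Q) `|phi x - v x|%:E <= eta%:E)%E.
    apply: le_trans h1; apply: ge0_subset_integral => //.
    by apply/measurable_EFinP; apply: measurableT_comp => //; exact: measurable_funB.
  exists (step d \o phi); split => //.
  - apply: (@le_trans _ _ (\int[leb]_(x in Q) ((2 / d)%:E * `|phi x - v x|%:E))%E).
      apply: ge0_le_integral; first exact: mQ.
      + by move=> x _; rewrite lee_fin.
      + apply/measurable_EFinP; apply: measurableT_comp => //; apply: measurable_funB => //.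
        apply: measurable_funTS; apply: continuous_measurable_rV.
        by have [] := C1f.
      + exact: measurable_funeM.
      + by move=> x _; rewrite -EFinM lee_fin step_lipschitz.
    rewrite ge0_integralZl ?lee_fin ?divr_ge0 ?(ltW d0)//.
    apply: (@le_trans _ _ ((2 / d)%:E * eta%:E)%E).
      by rewrite lee_wpmul2l// lee_fin divr_ge0 ?(ltW d0).
    rewrite -EFinM lee_fin.
    apply: (@le_trans _ _ (2 / d * (eta * (1 + K / d)))).
      rewrite ler_wpM2l ?divr_ge0 ?(ltW d0)// ler_peMr ?(ltW eta0)// lerDl.
      by rewrite divr_ge0// ltW.
    rewrite etaE (_ : 2 / d * _ = e / 4); last by field; rewrite gt_eqF.
    lra.
  - move=> i.
    have mp D : measurable_fun D (partial i phi).
      by apply: measurable_test; exact: test_function_partial tphi.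
    have mg : measurable_fun Q (fun x => wgrad v x 0 i).
      by apply: measurable_funS (measurable_wgrad i vW).
    have mdiff : measurable_fun Q (fun x => `|partial i phi x - wgrad v x 0%R i|%:E).
      by apply/measurable_EFinP; apply: measurableT_comp => //; exact: measurable_funB.
    have mt : measurable_fun Omega (fun x => (Num.max (G x - K) 0)%:E).
      apply/measurable_EFinP; apply: measurable_maxr => //.
      by apply: measurable_funB => //; exact: measurable_enorm_wgrad.
    have mtQ : measurable_fun Q (fun x => (Num.max (G x - K) 0)%:E).
      exact: measurable_funS mt.
    have t0 x : (0 <= (Num.max (G x - K) 0)%:E)%E by rewrite lee_fin le_max lexx orbT.
    have tailQ : (\int[leb]_(x in Q) (Num.max (G x - K) 0)%:E <= (e * d / 8)%:E)%E.
      by apply: le_trans tail; exact: ge0_subset_integral.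
    have gradQ := integral_partial_le oO fO p1 i tphi vW0 mQ QO.
    have Kd : 0 <= K / d by rewrite divr_ge0// ltW.
    pose F x := (`|partial i phi x - wgrad v x 0%R i|%:E +
      ((K / d)%:E * `|phi x - v x|%:E + (Num.max (G x - K) 0)%:E))%E.
    have mF : measurable_fun Q F.
      by apply: emeasurable_funD => //; apply: emeasurable_funD => //; exact: measurable_funeM.
    have F1 x : (0 <= (K / d)%:E * `|phi x - v x|%:E + (Num.max (G x - K) 0)%:E)%E.
      by apply: adde_ge0; [rewrite mule_ge0 ?lee_fin|exact: t0].
    have F0 x : (0 <= F x)%E by apply: adde_ge0; [rewrite lee_fin|exact: F1].
    apply: (@le_trans _ _ (\int[leb]_(x in Q) ((2 / d)%:E * F x))%E).
      apply: ae_ge0_le_integral; first exact: mQ.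
      + by move=> x _; rewrite lee_fin.
      + apply/measurable_EFinP; apply: measurableT_comp => //.
        apply: measurable_funTS; apply: continuous_measurable_rV.
        by have [_ _] := C1f.
      + by move=> x _; rewrite mule_ge0// lee_fin divr_ge0// ltW.
      + exact: measurable_funeM.
      + apply: filterS vd => x vd Qx; have {}vd := vd Qx.
        have -> : ((2 / d)%:E * F x = (2 / d * (`|partial i phi x - wgrad v x 0 i| +
            (K / d * `|phi x - v x| + Num.max (G x - K) 0)))%:E)%E by [].
        rewrite pf normrM lee_fin.
        have [phid|phid] := leP d `|phi x|.
          rewrite step_deriv_eq0// normr0 mul0r mulr_ge0 ?divr_ge0 ?(ltW d0)//.
          apply: addr_ge0 => //; apply: addr_ge0; first exact: mulr_ge0.
          by rewrite le_max lexx orbT.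
        apply: ler_pM => //; first exact: step_deriv_le.
        have w1 : 1 <= `|phi x - v x| / d.
          rewrite ler_pdivlMr// mul1r.
          have := lerB_dist (v x) (phi x); rewrite distrC => h; lra.
        have g1 : `|wgrad v x 0 i| <= G x by exact: coord_le_enorm.
        have := ler_normD (partial i phi x - wgrad v x 0 i) (wgrad v x 0 i).
        rewrite subrK => /le_trans; apply; rewrite lerD2l; apply: le_trans g1 _.
        apply: (@le_trans _ _ (K + Num.max (G x - K) 0)).
          by rewrite -lerBlDl le_max lexx.
        by rewrite lerD2r mulrAC -mulrA ler_peMr.
    rewrite ge0_integralZl ?lee_fin ?divr_ge0 ?(ltW d0)//.
    rewrite /F ge0_integralD//; last first.
      by apply: emeasurable_funD => //; exact: measurable_funeM.
    rewrite ge0_integralD//; last 2 first.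
    + by move=> x _; rewrite mule_ge0 ?lee_fin.
    + exact: measurable_funeM.
    rewrite ge0_integralZl ?lee_fin//.
    apply: (@le_trans _ _ ((2 / d)%:E * (eta%:E + ((K / d)%:E * eta%:E + (e * d / 8)%:E)))%E).
      rewrite lee_wpmul2l ?lee_fin ?divr_ge0 ?(ltW d0)//.
      apply: leeD; first exact: le_trans gradQ h2.
      by apply: leeD => //; rewrite lee_wpmul2l ?lee_fin.
    have small : 2 / d * (eta + (K / d * eta + e * d / 8)) <= e.
      rewrite addrA (_ : eta + K / d * eta = e * d / 8); last by rewrite -etaE; ring.
      by rewrite (_ : 2 / d * _ = e / 2); [lra|field; rewrite gt_eqF].
    by rewrite -lee_fin in small.
pose A := Q `&` [set x | d <= v x]; pose B := Q `&` [set x | v x <= - d].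
have mA : measurable A.
  have := mvQ mQ `[d, +oo[%classic; rewrite (_ : Q `&` v @^-1` _ = A); first exact.
  by apply/seteqP; split => x [Qx /= h]; split => //; move: h; rewrite in_itv/= andbT.
have mB : measurable B.
  have := mvQ mQ `]-oo, (- d)%R]%classic; rewrite (_ : Q `&` v @^-1` _ = B); first exact.
  by apply/seteqP; split => x [Qx /= h]; split => //; move: h; rewrite in_itv/=.
have AB : {ae leb, forall x, Q x -> A x \/ B x}.
  apply: filterS vd => x vd Qx; have := vd Qx; rewrite ler_normr => /orP[h|h].
    by left; split => //=; lra.
  by right; split => //=; lra.
have [A0|A0] := eqVneq (leb A) 0%E.
  right; have nA : {ae leb, forall x, ~ A x} by exists A; split => // x /= /contrapT.
  apply: filterS2 AB nA => x AB nA Qx; have [//|[_ /= h]] := AB Qx; lra.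
have [B0|B0] := eqVneq (leb B) 0%E.
  left; have nB : {ae leb, forall x, ~ B x} by exists B; split => // x /= /contrapT.
  apply: filterS2 AB nB => x AB nB Qx; have [[_ /= h]|//] := AB Qx; lra.
(* If both signs occur, the values 0 and 1 of sigma are both close to c. *)
exfalso.
have finQ E : measurable E -> E `<=` Q -> leb E \is a fin_num.
  move=> mE EQ; rewrite ge0_fin_numE// (le_lt_trans (le_measure _ _ _ EQ)) ?inE//.
  exact: lebesgue_cbox_lty.
have AQ : A `<=` Q by exact: subIsetl.
have BQ : B `<=` Q by exact: subIsetl.
pose ma := fine (leb A); pose mb := fine (leb B).
have maE : leb A = ma%:E by rewrite fineK// finQ.
have mbE : leb B = mb%:E by rewrite fineK// finQ.
have ma0 : 0 < ma by rewrite -lte_fin -maE lt0e A0/=.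
have mb0 : 0 < mb by rewrite -lte_fin -mbE lt0e B0/=.
have msc c E : E `<=` Q -> measurable_fun E (fun x => `|sigma x - c|%:E).
  move=> EQ; apply/measurable_EFinP; apply: measurableT_comp => //.
  by apply: measurable_funB => //; exact: measurable_funS ms.
have [|c cQ] := approx (Num.min ma mb / 4).
  by rewrite divr_gt0// lt_min ma0 mb0.
have sub E (r : R) : measurable E -> E `<=` Q -> (forall x, E x -> sigma x = r) ->
    `|r - c| * fine (leb E) <= Num.min ma mb / 4.
  move=> mE EQ sE; rewrite -lee_fin EFinM fineK ?finQ//; apply: le_trans cQ.
  apply: (@le_trans _ _ (\int[leb]_(x in E) `|sigma x - c|%:E)%E); last first.
    by apply: ge0_subset_integral => //; exact: msc.
  rewrite -integral_cst// le_eqVlt; apply/orP; left; apply/eqP.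
  by apply: eq_integral => x; rewrite inE => /sE ->.
have hA : `|1 - c| * ma <= Num.min ma mb / 4.
  by apply: (sub A) => // x [_ /= h]; exact: step_ge.
have hB : `|0 - c| * mb <= Num.min ma mb / 4.
  by apply: (sub B) => // x [_ /= h]; exact: step_le.
have mina : Num.min ma mb <= ma by rewrite ge_min lexx.
have minb : Num.min ma mb <= mb by rewrite ge_min lexx orbT.
have c1 : `|1 - c| <= 4^-1.
  rewrite -(ler_pM2r ma0); apply: le_trans hA _; lra.
have c2 : `|0 - c| <= 4^-1.
  rewrite -(ler_pM2r mb0); apply: le_trans hB _; lra.
move: c1 c2; rewrite !ler_norml => /andP[a1 a2] /andP[a3 a4]; lra.
Qed.

End sign.

Section global_sign.
Context {R : realType} {n : nat}.
Local Notation leb := (@lebesgue_rV R n).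
Variables (Omega : set 'rV[R]_n) (p : R).
Hypotheses (oO : open Omega) (fO : (leb Omega < +oo)%E) (p1 : 1 < p).
Hypothesis cO : connected Omega.
Implicit Types (v w phi psi : 'rV[R]_n -> R).

Lemma open_obox (a b : 'rV[R]_n) : open (obox a b).
Proof.
rewrite openE => x xab; rewrite /interior.
apply: (@filter_forall _ _ (fun i (y : 'rV[R]_n) => a 0 i < y 0 i < b 0 i) (nbhs x)) => i.
have /andP[ax xb] := xab i.
have ci := @coord_continuous_rV R n i x.
have h1 : \forall y \near x, a 0 i < (y : 'rV[R]_n) 0 i by exact: cvgr_gt ci _ ax.
have h2 : \forall y \near x, (y : 'rV[R]_n) 0 i < b 0 i by exact: cvgr_lt ci _ xb.
by apply: filterS2 h1 h2 => y -> ->.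
Qed.

Lemma ae_local_nbhs (P : 'rV[R]_n -> Prop) :
  (forall x, Omega x -> exists U, [/\ open U, U x & {ae leb, forall y, U y -> P y}]) ->
  {ae leb, forall x, Omega x -> P x}.
Proof.
move=> H.
pose good k := exists U, rat_cbox k `<=` U /\ {ae leb, forall y, U y -> P y}.
have : forall k, {ae leb, forall x, good k -> rat_obox k x -> P x}.
  move=> k; have [[U [kU UP]]|nk] := pselect (good k); last by apply: aeW.
  by apply: filterS UP => x Px _ /obox_sub_cbox/kU; exact: Px.
move/ae_foralln; apply: filterS => x Px Ox.
have [U [oU Ux UP]] := H x Ox; have [k [kx kU]] := open_rat_box oU Ux.
by apply: (Px k) kx; exists U.
Qed.

(** The points around which [v] is positive, respectively negative, form two
disjoint open sets covering the domain. *)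
Lemma constant_sign v : W01p Omega p v ->
  (forall a b, cbox a b `<=` Omega ->
     exists2 d : R, 0 < d & {ae leb, forall x, cbox a b x -> 2 * d <= `|v x|}) ->
  {ae leb, forall x, Omega x -> 0 < v x} \/ {ae leb, forall x, Omega x -> v x < 0}.
Proof.
move=> vW Hd.
pose S (P : R -> Prop) : set 'rV[R]_n := [set x | exists a b,
  [/\ obox a b x, cbox a b `<=` Omega & {ae leb, forall y, obox a b y -> P (v y)}]].
pose pos := S (fun t => 0 < t); pose neg := S (fun t => t < 0).
have openS P : open (S P).
  rewrite openE => x [a [b [xab abO abP]]].
  have := open_nbhs_nbhs (conj (@open_obox a b) xab); apply: filterS => y yab.
  by exists a, b.
have SO P : S P `<=` Omega.
  by move=> x [a [b [/obox_sub_cbox xab abO _]]]; exact: abO.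
have cover x : Omega x -> pos x \/ neg x.
  move=> Ox; have [k [kx kO]] := open_rat_box oO Ox.
  have [d d0 vd] := Hd _ _ kO.
  have ab i : (@rat_box R n k).1 0 i < (@rat_box R n k).2 0 i.
    by have /andP[h1 h2] := kx i; exact: lt_trans h1 h2.
  have [h|h] := sign_on_box oO fO p1 d0 ab kO vW vd; [left|right];
    exists (@rat_box R n k).1, (@rat_box R n k).2; split => //;
    by apply: filterS h => y h /obox_sub_cbox; exact: h.
have disj x : pos x -> neg x -> False.
  move=> [a [b [xab _ abP]]] [a' [b' [xab' _ abP']]].
  have : {ae leb, forall y, ~ (obox a b `&` obox a' b') y}.
    by apply: filterS2 abP abP' => y h h' [/h + /h'] => /lt_trans/[apply]; rewrite ltxx.
  move=> [N [mN N0 NP]].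
  have : (0 < leb (obox a b `&` obox a' b'))%E.
    apply: lebesgue_open_gt0; last by exists x.
    by apply: openI; exact: open_obox.
  rewrite ltNge => /negP; apply; rewrite -N0; apply: le_measure; rewrite ?inE//.
  - by apply: measurableI; exact: measurable_obox.
  - by move=> y yab; apply: NP => /= /(_ yab).
have concl P : S P = Omega -> {ae leb, forall x, Omega x -> P (v x)}.
  move=> SE; apply: ae_local_nbhs => x; rewrite -{1}SE => -[a [b [xab _ abP]]].
  by exists (obox a b); split => //; exact: open_obox.
have [[x px]|np] := pselect (pos !=set0); last first.
  right; apply: (concl (fun t => t < 0)); apply/seteqP; split; first exact: SO.
  move=> x /cover[px|//]; exfalso; apply: np; by exists x.
left; apply: (concl (fun t => 0 < t)); apply: cO; first by exists x.
  by exists pos; [exact: openS|apply/esym/setIidr; exact: SO].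
exists (~` neg); first by apply: open_closedC; exact: openS.
apply/seteqP; split => y.
  by move=> py; split; [exact: SO py|move=> /(disj _ py)].
by move=> [/cover[]].
Qed.

End global_sign.

(** * Power means and geometric means *)

Section power_means.
Context {R : realType} {n : nat}.
Local Notation leb := (@lebesgue_rV R n).
Variables (Omega : set 'rV[R]_n) (y : 'rV[R]_n -> R).
Hypotheses (mO : measurable Omega) (fO : (leb Omega < +oo)%E).
Hypothesis my : measurable_fun Omega y.
Hypothesis iy : leb.-integrable Omega (EFin \o (fun x => expR (y x))).

Let volE : leb Omega = (vol Omega)%:E.
Proof. by rewrite fineK// ge0_fin_numE// measure_ge0. Qed.

(** Both 1 and exp z lie above the tangent line of exp at t z. *)
Lemma expR_convex (t z : R) : 0 <= t -> t <= 1 -> expR (t * z) <= 1 + t * (expR z - 1).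
Proof.
move=> t0 t1; have E0 := expR_ge0 (t * z).
have h1 : expR (t * z) * (1 + (1 - t) * z) <= expR z.
  have -> : expR z = expR (t * z) * expR ((1 - t) * z) by rewrite -expRD; congr expR; ring.
  by rewrite ler_wpM2l// expR_ge1Dx.
have h2 : expR (t * z) * (1 - t * z) <= 1.
  have {2}-> : 1 = expR (t * z) * expR (- (t * z)) by rewrite -expRD subrr expR0.
  by rewrite ler_wpM2l// expR_ge1Dx.
have h3 : t * (expR (t * z) * (1 + (1 - t) * z)) <= t * expR z by rewrite ler_wpM2l.
have h4 : (1 - t) * (expR (t * z) * (1 - t * z)) <= (1 - t) * 1.
  by rewrite ler_wpM2l// subr_ge0.
nra.
Qed.

(** Difference quotient at 0 of q |-> exp (q z); it increases with q and has the
infimum z. *)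
Definition dquot (q z : R) : R := (expR (q * z) - 1) / q.

Lemma dquot_ge (q z : R) : 0 < q -> z <= dquot q z.
Proof.
move=> q0; rewrite /dquot ler_pdivlMr// lerBrDl mulrC; exact: expR_ge1Dx.
Qed.

Lemma dquot_le (q z : R) : 0 < q -> dquot q z <= z * expR (q * z).
Proof.
move=> q0; rewrite /dquot ler_pdivrMr// lerBlDr.
have h : expR (q * z) * (1 - q * z) <= 1.
  have {2}-> : 1 = expR (q * z) * expR (- (q * z)) by rewrite -expRD subrr expR0.
  by rewrite ler_wpM2l ?expR_ge0// expR_ge1Dx.
nra.
Qed.

Lemma dquot_mono (r s z : R) : 0 < r -> r <= s -> dquot r z <= dquot s z.
Proof.
move=> r0 rs; have s0 : 0 < s by exact: lt_le_trans rs.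
have := @expR_convex (r / s) (s * z); rewrite divr_ge0 ?(ltW r0) ?(ltW s0)//.
rewrite ler_pdivrMr// mul1r => /(_ isT rs); rewrite mulrA divfK ?gt_eqF// => h.
rewrite /dquot ler_pdivrMr// -lerBlDl in h *.
by apply: le_trans h _; rewrite le_eqVlt; apply/orP; left; apply/eqP; ring.
Qed.

Lemma cvg_dquot (z : R) : dquot k.+1%:R^-1 z @[k --> \oo] --> z.
Proof.
have h : z * expR (harmonic k * z) @[k --> \oo] --> z.
  rewrite -[X in _ --> X]mulr1; apply: cvgMr; rewrite -expR0.
  apply: continuous_cvg; first exact: continuous_expR.
  by rewrite -[X in _ --> X](mul0r z); apply: cvgMl; exact: cvg_harmonic.
apply: (squeeze_cvgr _ (cvg_cst z) h); apply: nearW => k.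
by rewrite dquot_ge ?dquot_le// invr_gt0.
Qed.

Lemma measurable_expR_scaled (q : R) : measurable_fun Omega (fun x => expR (q * y x)).
Proof.
apply: (@measurableT_comp _ _ _ _ _ _ (@expR R)).
  by apply: continuous_measurable_fun; exact: continuous_expR.
exact: measurable_funM.
Qed.

Let integral_cstE (c : R) : (\int[leb]_(x in Omega) c%:E = (c * vol Omega)%:E)%E.
Proof. by transitivity (c%:E * leb Omega)%E; [exact: integral_cst|rewrite volE]. Qed.

Lemma integrable_cst (c : R) : leb.-integrable Omega (cst c%:E).
Proof.
apply/integrableP; split; first exact: measurable_cst.
have -> : (\int[leb]_(x in Omega) `|cst c%:E x| = (`|c| * vol Omega)%:E)%E.
  exact: integral_cstE.
exact: ltry.
Qed.

Lemma integrable_expR (q : R) : 0 <= q -> q <= 1 ->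
  leb.-integrable Omega (EFin \o (fun x => expR (q * y x))).
Proof.
move=> q0 q1; apply: (@le_integrable _ _ _ _ _ mO _ (fun x => (1 + expR (y x))%:E)).
- by apply/measurable_EFinP; exact: measurable_expR_scaled.
- move=> x _; rewrite lee_fin !ger0_norm ?addr_ge0 ?expR_ge0//.
  apply: le_trans (expR_convex (y x) q0 q1) _; rewrite lerD2l.
  have := expR_ge0 (y x); nra.
- rewrite (_ : (fun x => _) = (cst 1%E \+ (EFin \o (fun x => expR (y x))))%E)//.
  by apply: integrableD => //; exact: (integrable_cst 1).
Qed.

Lemma measurable_dquot (q : R) : measurable_fun Omega (fun x => dquot q (y x)).
Proof.
apply: measurable_funM => //; apply: measurable_funB => //.
exact: measurable_expR_scaled.
Qed.

Lemma integrable_dquot (q : R) : 0 < q -> q <= 1 ->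
  leb.-integrable Omega (EFin \o (fun x => dquot q (y x))).
Proof.
move=> q0 q1.
rewrite (_ : _ \o _ = (fun x => q^-1%:E * ((expR (q * y x))%:E - 1%:E))%E).
  apply: integrableZl => //; apply: integrableB => //; last exact: (integrable_cst 1).
  exact: integrable_expR (ltW q0) q1.
by apply/funext => x; rewrite /= /dquot -EFinB -EFinM mulrC.
Qed.

(** For the logarithm y of a positive function, V + q int_dquot q is the integral
of its q-th power, so that int_dquot governs the power means of small order. *)
Definition int_dquot (q : R) : R := (\int[leb]_(x in Omega) dquot q (y x))%R.

Let int_dquotE (q : R) : 0 < q -> q <= 1 ->
  (\int[leb]_(x in Omega) (dquot q (y x))%:E = (int_dquot q)%:E)%E.
Proof.
move=> q0 q1; rewrite /int_dquot /Rintegral fineK//.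
exact: (integrable_fin_num mO (integrable_dquot q0 q1)).
Qed.

Lemma int_dquot_mono (r s : R) : 0 < r -> r <= s -> s <= 1 -> int_dquot r <= int_dquot s.
Proof.
move=> r0 rs s1; apply: le_Rintegral => //.
- by apply: integrable_dquot => //; exact: le_trans s1.
- by apply: integrable_dquot => //; exact: lt_le_trans rs.
- by move=> x _; exact: dquot_mono.
Qed.

Lemma integral_expR (q : R) : 0 < q -> q <= 1 ->
  (\int[leb]_(x in Omega) (expR (q * y x))%:E = (vol Omega + q * int_dquot q)%:E)%E.
Proof.
move=> q0 q1; have iq := integrable_dquot q0 q1.
transitivity (\int[leb]_(x in Omega) (cst 1%E x + (q%:E * (dquot q (y x))%:E)))%E.
  apply: eq_integral => x _; rewrite -EFinM -EFinD /dquot; congr EFin.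
  by field; rewrite gt_eqF.
rewrite integralD//; [|exact: (integrable_cst 1)|exact: integrableZl].
rewrite (_ : \int[leb]_(x in Omega) _ = (1 * vol Omega)%:E)%E; last exact: integral_cstE.
rewrite mul1r integralZl// int_dquotE// -EFinM -EFinD.

Qed.

(** By monotone convergence the integrals of the difference quotients decrease to
the integral of [y]. In the second alternative this integral is -oo. *)
Lemma int_dquot_limit :
  (leb.-integrable Omega (EFin \o y) /\
   forall A : R, \int[leb]_(x in Omega) y x < A ->
     exists2 r0 : R, 0 < r0 <= 1 & forall r, 0 < r -> r <= r0 -> int_dquot r < A) \/
  (forall A : R, exists2 r0 : R, 0 < r0 <= 1 & forall r, 0 < r -> r <= r0 -> int_dquot r < A).
Proof.
pose h (k : nat) : R := k.+1%:R^-1.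
have h0 k : 0 < h k by rewrite invr_gt0.
have h1 k : h k <= 1 by rewrite invf_le1// ler1n.
have i1 : leb.-integrable Omega (EFin \o (fun x => dquot 1 (y x))) by exact: integrable_dquot.
pose g k x := (dquot 1 (y x) - dquot (h k) (y x))%:E.
pose N := (\int[leb]_(x in Omega) (dquot 1 (y x) - y x)%:E)%E.
have mg k : measurable_fun Omega (g k).
  by apply/measurable_EFinP; apply: measurable_funB; exact: measurable_dquot.
have g0 k x : (0 <= g k x)%E by rewrite lee_fin subr_ge0 dquot_mono.
have cvgN : (\int[leb]_(x in Omega) g k x)%E @[k --> \oo] --> N.
  rewrite (_ : N = (\int[leb]_(x in Omega) limn (g ^~ x))%E).
    apply: cvg_monotone_convergence => //.
    move=> x _ i j ij; rewrite lee_fin lerB// dquot_mono//.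
    by rewrite lef_pV2 ?posrE// ler_nat ltnS.
  apply: eq_integral => x _; apply/esym/cvg_lim => //.
  apply: cvg_EFin; first exact: nearW.
  by apply: cvgB; [exact: cvg_cst|exact: cvg_dquot].
have Eg k : (\int[leb]_(x in Omega) g k x = (int_dquot 1 - int_dquot (h k))%:E)%E.
  have ik : leb.-integrable Omega (EFin \o (fun x => dquot (h k) (y x))) by exact: integrable_dquot.
  rewrite EFinB -!int_dquotE//.
  by rewrite -integralB.
have conv (A : R) : ((int_dquot 1 - A)%:E < N)%E ->
    exists2 r0 : R, 0 < r0 <= 1 & forall r, 0 < r -> r <= r0 -> int_dquot r < A.
  move=> AN; have [k gk] : exists k, ((int_dquot 1 - A)%:E < \int[leb]_(x in Omega) g k x)%E.
    apply/not_existsP => H; move: AN; rewrite ltNge => /negP; apply.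
    by apply: (cvge_le _ cvgN); apply: nearW => k; rewrite leNgt; exact/negP/H.
  exists (h k); first by rewrite h0 h1.
  move=> r r0 rk; apply: (le_lt_trans (int_dquot_mono r0 rk (h1 k))).
  by move: gk; rewrite Eg lte_fin; lra.
have d1y x : 0 <= dquot 1 (y x) - y x by rewrite subr_ge0 dquot_ge.
have [Noo|Noo] := eqVneq N +oo%E.
  by right => A; apply: conv; rewrite Noo ltry.
left; have iN : leb.-integrable Omega (EFin \o (fun x => dquot 1 (y x) - y x)).
  apply/integrableP; split.
    by apply/measurable_EFinP; apply: measurable_funB => //; exact: measurable_dquot.
  under eq_integral do rewrite /= ger0_norm//.
  by rewrite ltey.
have yE : EFin \o y = (fun x => (dquot 1 (y x))%:E - (dquot 1 (y x) - y x)%:E)%E.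
  by apply/funext => x /=; rewrite -EFinB subKr.
have iyy : leb.-integrable Omega (EFin \o y) by rewrite yE; exact: integrableB.
split => // A yA; apply: conv.
have NE : N = (int_dquot 1 - \int[leb]_(x in Omega) y x)%:E.
  rewrite EFinB -int_dquotE// /Rintegral fineK; last exact: (integrable_fin_num mO iyy).
  by rewrite -integralB.
by rewrite NE lte_fin; lra.
Qed.

(** Integrate the tangent line of exp at q times the mean of [y]. *)
Lemma jensen_expR (q : R) : 0 < q -> q <= 1 -> 0 < vol Omega ->
  leb.-integrable Omega (EFin \o y) ->
  vol Omega * expR (q * (\int[leb]_(x in Omega) y x) / vol Omega) <= vol Omega + q * int_dquot q.
Proof.
move=> q0 q1 vol0 iyy; set l := (\int[leb]_(x in Omega) y x)%R.
pose s := q * l / vol Omega.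
rewrite -lee_fin -integral_expR//.
have -> : ((vol Omega * expR s)%:E =
    \int[leb]_(x in Omega) ((expR s * (1 - s))%:E + (expR s * q)%:E * (y x)%:E))%E.
  have iZ : leb.-integrable Omega (fun x => (expR s * q)%:E * (y x)%:E)%E by exact: integrableZl.
  rewrite integralD//; last exact: (integrable_cst (expR s * (1 - s))).
  rewrite integralZl// (_ : \int[leb]_(x in Omega) (y x)%:E = l%:E)%E; last first.
    by rewrite /l /Rintegral fineK// integrable_fin_num.
  rewrite (_ : \int[leb]_(x in Omega) _ = (expR s * (1 - s) * vol Omega)%:E)%E; last first.
    exact: integral_cstE.
  rewrite -!EFinM -EFinD; congr EFin; rewrite /s; set E := expR _; field.
  by rewrite gt_eqF.
apply: le_integral => //.
- by apply: integrableD => //; [exact: (integrable_cst (expR s * (1 - s)))|exact: integrableZl].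
- exact: integrable_expR (ltW q0) q1.
- move=> x _; rewrite -EFinM -EFinD lee_fin.
  have -> : expR (q * y x) = expR s * expR (q * y x - s) by rewrite -expRD; congr expR; ring.
  have := expR_ge1Dx (q * y x - s); have := expR_gt0 s => E0 h.
  rewrite -mulrA -mulrDr ler_wpM2l ?(ltW E0)//; lra.
Qed.

End power_means.

(** * The constant mu and the normalization of the solution *)

Section limit_constant.
Context {R : realType} {n : nat}.
Local Notation leb := (@lebesgue_rV R n).
Variables (Omega : set 'rV[R]_n) (p : R) (u : 'rV[R]_n -> R).
Hypotheses (n0 : (0 < n)%N) (oO : open Omega) (fO : (leb Omega < +oo)%E).
Hypotheses (Opos : (0 < leb Omega)%E) (bO : bounded_set Omega) (p1 : 1 < p).
Hypothesis usol : weak_solution Omega p (mu Omega p / vol Omega) u.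
Implicit Types (v w : 'rV[R]_n -> R).

Let mO : measurable Omega. Proof. exact: measurable_open_rV. Qed.
Let p0 : 0 < p. Proof. exact: lt_trans p1. Qed.
Let pn0 : p != 0. Proof. by rewrite gt_eqF. Qed.
Let uW : W01p Omega p u. Proof. by have [] := usol. Qed.
Let uW1 : W1p Omega p u. Proof. by have [] := uW. Qed.
Let mu_ : measurable_fun Omega u. Proof. by have [[]] := uW1. Qed.
Let vol0 : 0 < vol Omega. Proof. by rewrite fine_gt0// Opos fO. Qed.
Let voln0 : vol Omega != 0. Proof. by rewrite gt_eqF. Qed.

Local Notation energy := (energy Omega p).
Local Notation mu := (mu Omega p).
Local Notation V := (vol Omega).
Local Notation w := (pos_rep u).
Local Notation y := (fun x => ln (pos_rep u x)).

Lemma mu_energy : energy u = mu.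
Proof. by rewrite (energy_solution oO fO p1 usol) divfK. Qed.

Lemma ae_contradiction : ~ {ae leb, forall x, Omega x -> False}.
Proof.
move=> H; have : leb.-negligible Omega by apply: negligibleS H => x Ox /(_ Ox).
by move=> /(measure_negligible mO) E; move: Opos; rewrite E ltxx.
Qed.

Lemma mu_gt0 : 0 < mu.
Proof.
rewrite lt_neqAle -mu_energy energy_ge0 andbT; apply/eqP => E.
have u0 := energy_eq0 oO fO p1 n0 bO uW (esym E).
apply: ae_contradiction; apply: filterS2 u0 (solution_gt0 oO usol) => x H1 H2 Ox.
by move: (H2 Ox); rewrite H1// ltxx.
Qed.

(** The sharp Sobolev-type inequality with the weight 1/u, obtained by inserting
the energy mu of u into the integrated equation. *)
Lemma energy_lower_bound v : W01p Omega p v ->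
  exists b : R, [/\ 0 <= b,
    (\int[leb]_(x in Omega) (`|v x| / w x)%:E = b%:E)%E &
    mu * (b / V) `^ p <= energy v].
Proof.
move=> vW; have := key_inequality oO fO p1 Opos usol vW.
have : (0 <= \int[leb]_(x in Omega) (`|v x| / w x)%:E)%E.
  by apply: integral_ge0 => x _; rewrite lee_fin divr_ge0// ltW// pos_rep_gt0.
have k0 : 0 < mu / V by rewrite divr_gt0// mu_gt0.
case: (\int[leb]_(x in Omega) _)%E => [b||]//; last by rewrite gt0_muley// ?leye_eq.
rewrite lee_fin => b0; rewrite -EFinM lee_fin mu_energy => H; exists b; split => //.
have m0 := mu_gt0; have E0 := energy_ge0 Omega p v.
have q0 : 0 <= p^-1 by rewrite invr_ge0 ltW.
have a0 : 0 < mu `^ p^-1 by rewrite powR_gt0.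
have muE : mu `^ (1 - p^-1) = mu / mu `^ p^-1.
  rewrite -[LHS](mulfK (lt0r_neq0 a0)) -powRD; last by rewrite (gt_eqF m0) implybT.
  by rewrite subrK powRr1 ?(ltW m0).
have H1 : mu `^ p^-1 * (b / V) <= energy v `^ p^-1.
  have -> : mu `^ p^-1 * (b / V) = (mu `^ (1 - p^-1))^-1 * (mu / V * b).
    by rewrite muE; field; rewrite voln0 (gt_eqF m0) (gt_eqF a0).
  by rewrite ler_pdivrMl ?powR_gt0.
have bV0 : 0 <= b / V by rewrite divr_ge0// ltW.
have H2 : (mu `^ p^-1 * (b / V)) `^ p <= (energy v `^ p^-1) `^ p.
  apply: ge0_ler_powR; rewrite ?nnegrE ?powR_ge0 ?(ltW p0)//.
  by rewrite mulr_ge0 ?powR_ge0.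
by move: H2; rewrite powRM ?powR_ge0// -!powRrM mulVf// !powRr1// ltW.
Qed.

Let measurable_pos_rep : measurable_fun Omega w.
Proof. exact: (measurable_pos_rep oO usol). Qed.

Let measurable_y : measurable_fun Omega y.
Proof. by apply: measurableT_comp => //; exact: measurable_ln. Qed.

Let expRy x : expR (y x) = w x.
Proof. by rewrite lnK// posrE pos_rep_gt0. Qed.

Lemma integrable_pos_rep : leb.-integrable Omega (EFin \o (fun x => expR (y x))).
Proof.
have [Lu _] := uW1; have /integrableP[mu' uoo] := Lp_integrable mO p1 fO Lu.
have mw : measurable_fun Omega (EFin \o (fun x => expR (y x))).
  by apply/measurable_EFinP; rewrite (_ : (fun x => _) = w)//; exact/funext.
apply/integrableP; split => //; apply: le_lt_trans uoo.
rewrite le_eqVlt; apply/orP; left; apply/eqP; apply: ge0_ae_eq_integral => //.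
- exact: measurableT_comp.
- exact: measurableT_comp.
- by apply: filterS (pos_repE oO usol) => x H Ox; rewrite /= expRy H.
Qed.

Local Notation dm := (int_dquot Omega y).

Lemma integral_pos_rep_powR (r : R) : 0 < r -> r <= 1 ->
  (\int[leb]_(x in Omega) (w x `^ r)%:E = (V + r * dm r)%:E)%E.
Proof.
move=> r0 r1; rewrite -(integral_expR mO fO measurable_y integrable_pos_rep r0 r1).
by apply: eq_integral => x _; rewrite -(expRy x) -expRM mulrC expRy.
Qed.

Definition scaled_lambda (q : R) : \bar R := (lambda_q Omega p q * (V `^ (p / q))%:E)%E.

(** The left-hand side is the integral of u^r; use 1 + t <= exp t. *)
Lemma power_mean_le (r : R) : V + r * dm r <= V * expR (r * dm r / V).
Proof.
have := expR_ge1Dx (r * dm r / V) => h.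
have -> : V + r * dm r = V * (1 + r * dm r / V) by field.
by rewrite ler_wpM2l// ltW.
Qed.

(** Hoelder's inequality for |v|^q = (|v|/u)^q u^q with the exponents 1/q and
1/(1-q) bounds the integral of |v|/u from below by a power mean of u of order
r = q/(1-q), and the energy of v is at least a power of this integral. *)
Lemma scaled_lambda_ge (q : R) : 0 < q -> q <= 2^-1 ->
  ((mu * expR (- (p * dm (q / (1 - q)) / V)))%:E <= scaled_lambda q)%E.
Proof.
move=> q0 q2; have q1 : 0 < 1 - q by lra.
set r := q / (1 - q); set d := dm r.
have r0 : 0 < r by rewrite divr_gt0.
have r1 : r <= 1 by rewrite ler_pdivrMr// mul1r; lra.
have Vq0 : 0 < V `^ (p / q) by rewrite powR_gt0.
rewrite /scaled_lambda -lee_pdivrMr//; apply: le_ereal_inf_tmp => _ [v [vW v1] <-].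
have [vW1 _] := vW; have [[mv _] _] := vW1.
rewrite (normLp_energy oO p1 vW1) poweR_EFin -powRrM mulVf// powRr1 ?energy_ge0//.
have [b [b0 bE H]] := energy_lower_bound vW.
rewrite -EFinM lee_fin ler_pdivrMr//; apply: le_trans (ler_wpM2r (ltW Vq0) H).
rewrite -[X in _ <= X]mulrA ler_wpM2l ?(ltW mu_gt0)//.
have W0 : 0 <= V + r * dm r.
  rewrite -lee_fin -integral_pos_rep_powR//.
  by apply: integral_ge0 => x _; rewrite lee_fin powR_ge0.
have h1 : 1 <= b `^ q * (V + r * d) `^ (1 - q).
  have mf : measurable_fun Omega (fun x => (`|v x| / w x) `^ q).
    apply: measurable_fun_powR; apply: measurable_funM; first exact: measurableT_comp.
    exact: (measurable_inv_pos_rep oO usol).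
  have mg : measurable_fun Omega (fun x => w x `^ q) by exact: measurable_fun_powR.
  have q0' : 0 < q^-1 by rewrite invr_gt0.
  have q1' : 0 < (1 - q)^-1 by rewrite invr_gt0.
  have := hoelder_on mO mf mg q0' q1'; rewrite !invrK => /(_ (subrKC _ _)).
  rewrite (_ : (\int[leb]_(x in Omega) _)%E = 1%E); last first.
    rewrite -v1; apply: eq_integral => x _; congr EFin.
    have w0 := pos_rep_gt0 u x.
    by rewrite -powRM ?divr_ge0 ?(ltW w0)// divfK ?gt_eqF// ger0_norm ?powR_ge0.
  rewrite (_ : (\int[leb]_(x in Omega) _)%E = b%:E); last first.
    rewrite -bE; apply: eq_integral => x _; congr EFin.
    rewrite ger0_norm ?powR_ge0// -powRrM divff ?gt_eqF// powRr1//.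
    by rewrite divr_ge0// ltW// pos_rep_gt0.
  rewrite (_ : (\int[leb]_(x in Omega) _)%E = (V + r * d)%:E); last first.
    rewrite -integral_pos_rep_powR//; apply: eq_integral => x _; congr EFin.
    by rewrite ger0_norm ?powR_ge0// -powRrM.
  by rewrite !poweR_EFin -EFinM lee_fin.
have h2 : 1 <= b `^ q * (V * expR (r * d / V)) `^ (1 - q).
  apply: le_trans h1 _; rewrite ler_wpM2l ?powR_ge0//.
  apply: ge0_ler_powR; rewrite ?nnegrE ?(ltW q1)// ?power_mean_le//.
  by rewrite mulr_ge0 ?expR_ge0 ?(ltW vol0).
have h3 : 1 <= (b `^ q * (V * expR (r * d / V)) `^ (1 - q)) `^ (p / q).
  have pq0 : 0 <= p / q by rewrite divr_ge0// ltW.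
  have X0 : 0 <= b `^ q * (V * expR (r * d / V)) `^ (1 - q) by exact: le_trans h2.
  by have := ge0_ler_powR pq0 _ X0 h2; rewrite powR1; apply; rewrite nnegrE.
have E : (b `^ q * (V * expR (r * d / V)) `^ (1 - q)) `^ (p / q) =
    (b / V) `^ p * V `^ (p / q) * expR (p * d / V).
  rewrite powRM ?powR_ge0// -!powRrM powRM ?expR_ge0 ?(ltW vol0)//.
  have Vp : V^-1 `^ p = V `^ (- p) by rewrite -powR_inv1 ?(ltW vol0)// -powRrM mulN1r.
  rewrite -expRM powRM ?invr_ge0 ?(ltW vol0)// Vp.
  rewrite -[X in X * expR (p * d / V)]mulrA -powRD ?voln0 ?implybT// -[RHS]mulrA.
  congr (_ `^ _ * (_ `^ _ * expR _)).
  - by field; rewrite gt_eqF.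
  - by field; rewrite gt_eqF.
  - by rewrite /r; field; rewrite voln0 !gt_eqF.
by rewrite E -ler_pdivrMr ?expR_gt0// mul1r -expRN in h3.
Qed.

(** The normalized multiple of u is admissible, and Jensen's inequality bounds
its normalizing factor. *)
Lemma scaled_lambda_le (q : R) : 0 < q -> q <= 1 -> leb.-integrable Omega (EFin \o y) ->
  (scaled_lambda q <= (mu * expR (- (p * (\int[leb]_(x in Omega) y x) / V)))%:E)%E.
Proof.
move=> q0 q1 iy; set l := (\int[leb]_(x in Omega) y x)%R.
have [Lu _] := uW1.
pose M := V + q * dm q.
have ME : V * expR (q * l / V) <= M.
  exact: (jensen_expR mO fO measurable_y integrable_pos_rep q0 q1 vol0 iy).
have M1 : 0 < V * expR (q * l / V) by rewrite mulr_gt0 ?expR_gt0.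
have M0 : 0 < M by exact: lt_le_trans ME.
pose t := M `^ (- q^-1); have t0 : 0 < t by rewrite powR_gt0.
have Vq0 : 0 < V `^ (p / q) by rewrite powR_gt0.
rewrite /scaled_lambda -lee_pdivlMr//; apply: ge_ereal_inf.
exists ((energy (fun x => t * u x))%:E).
  exists (fun x => t * u x); last first.
    rewrite (normLp_energy oO p1 (W1pZ oO fO p1 t uW1)) poweR_EFin -powRrM mulVf//.
    by rewrite powRr1 ?energy_ge0.
  split; first exact: (W01pZ oO fO p1).
  transitivity (\int[leb]_(x in Omega) ((t `^ q)%:E * (w x `^ q)%:E))%E.
    apply: ge0_ae_eq_integral => //.
    - apply/measurable_EFinP; apply: measurable_fun_powR; apply: measurableT_comp => //.
      exact: measurable_funM.
    - by apply/measurable_EFinP; apply: measurable_funM => //; exact: measurable_fun_powR.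
    - by move=> x _; rewrite -EFinM lee_fin; apply: mulr_ge0; exact: powR_ge0.
    - apply: filterS (pos_repE oO usol) => x H Ox; have w0 := pos_rep_gt0 u x.
      by rewrite H// gtr0_norm ?mulr_gt0// powRM// ltW.
  rewrite ge0_integralZl//; last 3 first.
  - by apply/measurable_EFinP; exact: measurable_fun_powR.
  - by move=> x _; rewrite lee_fin powR_ge0.
  - by rewrite lee_fin powR_ge0.
  rewrite integral_pos_rep_powR// -EFinM -/M; congr EFin.
  by rewrite /t -powRrM mulNr mulVf ?gt_eqF// powR_inv1 ?(ltW M0)// mulVf ?gt_eqF.
rewrite (energyZ oO fO p1 _ uW1) mu_energy gtr0_norm// -EFinM lee_fin.
rewrite ler_pdivlMr// mulrAC mulrC ler_wpM2l ?(ltW mu_gt0)//.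
have -> : t `^ p = (M `^ (p / q))^-1 by rewrite -powRN /t -powRrM mulNr mulrC.
rewrite expRN mulrC ler_pdivrMr ?powR_gt0// ler_pdivlMl ?expR_gt0//.
have -> : expR (p * l / V) * V `^ (p / q) = (V * expR (q * l / V)) `^ (p / q).
  rewrite powRM ?expR_ge0 ?(ltW vol0)// -expRM mulrC; congr (_ * expR _).
  by field; rewrite voln0 gt_eqF.
by rewrite ge0_ler_powR ?nnegrE ?divr_ge0// ltW.
Qed.

Lemma near_scaled_lambda_ge (A : R) :
  (exists2 r0 : R, 0 < r0 <= 1 & forall r, 0 < r -> r <= r0 -> dm r < A) ->
  \forall q \near 0^'+, ((mu * expR (- (p * A / V)))%:E <= scaled_lambda q)%E.
Proof.
move=> [r0 /andP[r00 r01] H].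
have h0 : 0 < r0 / 2 by rewrite divr_gt0.
(* q <= 1/2 gives q / (1 - q) <= 2 q <= r0. *)
near=> q.
have q0 : 0 < q by near: q; exact: nbhs_right_gt.
have qr : q <= r0 / 2 by near: q; exact: nbhs_right_le.
have q2 : q <= 2^-1 by apply: le_trans qr _; rewrite ler_pdivrMr// mulVf.
have q1 : 0 < 1 - q by lra.
apply: le_trans (scaled_lambda_ge q0 q2).
rewrite lee_fin ler_wpM2l ?(ltW mu_gt0)// ler_expR lerN2.
rewrite ler_wpM2r ?invr_ge0 ?(ltW vol0)// ler_wpM2l ?(ltW p0)//.
apply/ltW/H; first by rewrite divr_gt0.
by rewrite ler_pdivrMr//; nra.
Unshelve. all: by end_near. Qed.

Let level (c : R) : 0 < c -> exists A, mu * expR (- (p * A / V)) = c.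
Proof.
move=> c0; exists (- (V / p * ln (c / mu))).
have -> : - (p * - (V / p * ln (c / mu)) / V) = ln (c / mu) by field; rewrite voln0 pn0.
by rewrite lnK ?posrE ?divr_gt0 ?mu_gt0// mulrC divfK// gt_eqF// mu_gt0.
Qed.

(** As q tends to 0, the scaled minima tend to mu times a power of the geometric
mean of u; hence this geometric mean is 1. *)
Lemma geometric_mean_solution :
  leb.-integrable Omega (EFin \o y) /\ \int[leb]_(x in Omega) y x = 0.
Proof.
have m0 := mu_gt0.
have limE (l : \bar R) : scaled_lambda q @[q --> 0^'+] --> l -> mu = fine l.
  by move=> /cvg_lim <-.
have [[iy H]|H] := int_dquot_limit mO fO measurable_y integrable_pos_rep; last first.
  suff /limE E : scaled_lambda q @[q --> 0^'+] --> +oo%E by move: m0; rewrite E ltxx.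
  apply/cvgeyPge => B; have [|A AE] := @level (Num.max B 1); first by rewrite lt_max ltr01 orbT.
  apply: filterS (near_scaled_lambda_ge (H A)) => q; apply: le_trans.
  by rewrite AE lee_fin le_max lexx.
split => //; set l := (\int[leb]_(x in Omega) y x)%R.
pose L := mu * expR (- (p * l / V)).
have L0 : 0 < L by rewrite mulr_gt0 ?expR_gt0.
have le_F : \forall q \near 0^'+, (scaled_lambda q <= L%:E)%E.
  near=> q; have q0 : 0 < q by near: q; exact: nbhs_right_gt.
  have q1 : q <= 1 by near: q; exact: nbhs_right_le.
  exact: scaled_lambda_le.
have ge_F (c : R) : c < L -> \forall q \near 0^'+, (c%:E <= scaled_lambda q)%E.
  move=> cL; have [|A AE] := @level (Num.max c (L / 2)).
    by rewrite lt_max divr_gt0 ?orbT.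
  have lA : l < A.
    have : mu * expR (- (p * A / V)) < L by rewrite AE gt_max cL/=; lra.
    rewrite ltr_pM2l// ltr_expR ltrN2 ltr_pM2r ?invr_gt0// ltr_pM2l//.
  apply: filterS (near_scaled_lambda_ge (H A lA)) => q; apply: le_trans.
  by rewrite AE lee_fin le_max lexx.
suff /limE/= E : scaled_lambda q @[q --> 0^'+] --> L%:E.
  have : expR (- (p * l / V)) = 1 by apply: (mulfI (lt0r_neq0 m0)); rewrite mulr1.
  rewrite -[X in _ = X -> _](expR0) => /expR_inj /eqP.
  by rewrite oppr_eq0 !mulf_eq0 invr_eq0 (negbTE voln0) (negbTE pn0) orbF => /eqP.
apply: cvg_EFin.
  near=> q; rewrite fin_numE; apply/andP; split.
    by rewrite -ltNye; apply: (@lt_le_trans _ _ 0%:E); [exact: ltNyr|near: q; exact: ge_F].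
  by rewrite -ltey; apply: (@le_lt_trans _ _ L%:E); [near: q; exact: le_F|exact: ltry].
apply/cvgrPdist_le => e e0; near=> q.
have h1 : (scaled_lambda q <= L%:E)%E by near: q.
have h2 : ((L - e)%:E <= scaled_lambda q)%E by near: q; apply: ge_F; rewrite gtrBl.
move: h1 h2; rewrite /=; case: (scaled_lambda q) => [z||]//.
rewrite !lee_fin => h1 h2; rewrite ger0_norm ?subr_ge0//=; lra.
Unshelve. all: by end_near. Qed.

End limit_constant.

(** * The minimizers *)

Section minimizers.
Context {R : realType} {n : nat}.
Local Notation leb := (@lebesgue_rV R n).
Variables (Omega : set 'rV[R]_n) (p lam : R) (u : 'rV[R]_n -> R).
Hypotheses (n0 : (0 < n)%N) (oO : open Omega) (fO : (leb Omega < +oo)%E).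
Hypotheses (Opos : (0 < leb Omega)%E) (bO : bounded_set Omega) (p1 : 1 < p).
Hypotheses (cO : connected Omega) (lam0 : 0 < lam).
Hypothesis usol : weak_solution Omega p (mu Omega p / vol Omega) u.
Implicit Types (v w : 'rV[R]_n -> R).

Let mO : measurable Omega. Proof. exact: measurable_open_rV. Qed.
Let p0 : 0 < p. Proof. exact: lt_trans p1. Qed.
Let pn0 : p != 0. Proof. by rewrite gt_eqF. Qed.
Let uW : W01p Omega p u. Proof. by have [] := usol. Qed.
Let uW1 : W1p Omega p u. Proof. by have [] := uW. Qed.
Let vol0 : 0 < vol Omega. Proof. by rewrite fine_gt0// Opos fO. Qed.
Let voln0 : vol Omega != 0. Proof. by rewrite gt_eqF. Qed.
Let volE : leb Omega = (vol Omega)%:E.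
Proof. by rewrite fineK// ge0_fin_numE// measure_ge0. Qed.
Let mu0 : 0 < mu Omega p. Proof. exact: (mu_gt0 n0 oO fO Opos bO p1 usol). Qed.

Local Notation energy := (energy Omega p).
Local Notation mu := (mu Omega p).
Local Notation V := (vol Omega).
Local Notation w := (pos_rep u).
Local Notation y := (fun x => ln (pos_rep u x)).
Local Notation c := (lam * V / mu).
Local Notation s := (c `^ p^-1).
Local Notation m := (lam * V / p * (1 - ln c)).

Let c0 : 0 < c. Proof. by rewrite divr_gt0// mulr_gt0. Qed.
Let s0 : 0 < s. Proof. by rewrite powR_gt0. Qed.
Let spE : s `^ p = c. Proof. by rewrite -powRrM mulVf// powRr1// ltW. Qed.
Let ln_s : ln s = ln c / p. Proof. by rewrite ln_powR mulrC. Qed.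

Lemma ln_le_subr1 (x : R) : 0 < x -> ln x <= x - 1.
Proof.
move=> x0; have := @le_ln1Dx R (x - 1); rewrite ltrBrDl subrr => /(_ x0).
by rewrite addrCA subrr addr0.
Qed.

Lemma ln_eq_subr1 (x : R) : 0 < x -> ln x = x - 1 -> x = 1.
Proof.
move=> x0 xE; have [h0|/expR_gt1Dx] := eqVneq (ln x) 0.
  by apply/eqP; rewrite -subr_eq0 -xE h0.
by rewrite lnK// xE addrCA subrr addr0 ltxx.
Qed.

(** Convexity of exp between 0 and p ln z, with weight 1/p. *)
Lemma bernoulli_powR (z : R) : 0 <= z -> 1 + p * (z - 1) <= z `^ p.
Proof.
rewrite le_eqVlt => /predU1P[<-|z0]; first by rewrite powR0// sub0r mulrN1 subr_le0 ltW.
have ip1 : p^-1 <= 1 by rewrite invf_le1// ltW.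
have ip0 : 0 <= p^-1 by rewrite invr_ge0 ltW.
have := expR_convex (p * ln z) ip0 ip1.
rewrite mulrA mulVf// mul1r lnK// -ln_powR lnK ?posrE ?powR_gt0// => H.
have := ler_wpM2l (ltW p0) H; rewrite mulrDr mulrA divff// mul1r; lra.
Qed.

(** The majorant controls the positive part, so only the negative part can make
the integral infinite. *)
Lemma integrable_of_majorant (f g : 'rV[R]_n -> \bar R) : measurable_fun Omega f ->
  leb.-integrable Omega g -> (forall x, Omega x -> (f x <= g x)%E) ->
  (\int[leb]_(x in Omega) f x)%E != -oo%E -> leb.-integrable Omega f.
Proof.
move=> mf ig fg foo.
have iP : leb.-integrable Omega (f^\+)%E.
  apply: (@le_integrable _ _ _ _ _ mO _ (g^\+)%E) => //.
  - exact: measurable_funepos.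
  - move=> x Ox; rewrite !gee0_abs//.
    by rewrite !funeposE ge_max !le_max lexx fg ?orbT.
  - exact: integrable_funepos.
have iN : leb.-integrable Omega (f^\-)%E.
  apply/integrableP; split; first exact: measurable_funeneg.
  rewrite (eq_integral (f^\-)%E); last by move=> x _; rewrite gee0_abs.
  rewrite ltey; apply/eqP => E; move: foo; rewrite integralE E.
  have := integrable_fin_num mO iP; case: (\int[leb]_(x in Omega) _)%E => //=.
by rewrite (funeposneg f); exact: integrableB.
Qed.

Lemma measurable_lne_norm v : measurable_fun Omega v ->
  measurable_fun Omega (fun x => lne (`|v x|%R)%:E).
Proof.
move=> mv; have mn : measurable_fun Omega (fun x => `|v x|) by exact: measurableT_comp.
apply: (@measurable_fun_if _ _ _ _ (cst -oo%E) (fun x => (ln `|v x|)%:E) _ mO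
  (fun x => `|v x| <= 0)) => //.
- by apply: measurable_fun_ler.
- apply: (measurable_funS mO); first exact: subIsetl.
  by apply/measurable_EFinP; apply: measurableT_comp => //; exact: measurable_ln.
Qed.

(** The tangent line of ln at s w, evaluated at |v|: it is affine in |v|, with the
weight 1/w for which the energy bound is sharp. *)
Let tangent v x : R := y x + (ln s - 1) + s^-1 * (`|v x| / w x).

Let tangentE v x : v x != 0 ->
  tangent v x - ln `|v x| = (`|v x| / (s * w x) - 1) - ln (`|v x| / (s * w x)).
Proof.
move=> vx; have w0 := pos_rep_gt0 u x; have v0 : 0 < `|v x| by rewrite normr_gt0.
rewrite /tangent ln_div ?posrE ?mulr_gt0// lnM ?posrE//.
have -> : s^-1 * (`|v x| / w x) = `|v x| / (s * w x) by field; rewrite !gt_eqF.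
by ring.
Qed.

Let lne_le_tangent v x : (lne (`|v x|%R)%:E <= (tangent v x)%:E)%E.
Proof.
have [->|vx] := eqVneq (v x) 0; first by rewrite normr0 le0_lneNy ?lexx// leNye.
have w0 := pos_rep_gt0 u x; have v0 : 0 < `|v x| by rewrite normr_gt0.
rewrite lne_EFin// lee_fin -subr_ge0 tangentE// subr_ge0 ln_le_subr1//.
by rewrite divr_gt0 ?mulr_gt0.
Qed.

Let defect_ge0 v x : (0 <= (tangent v x)%:E - lne (`|v x|%R)%:E)%E.
Proof. have := lne_le_tangent v x; by case: (lne _) => [r||] /= +; [rewrite -EFinB !lee_fin subr_ge0|rewrite leye_eq|rewrite addey]. Qed.

Let integral_tangent v (b : R) : W01p Omega p v ->
  (\int[leb]_(x in Omega) (`|v x| / w x)%:E = b%:E)%E ->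
  leb.-integrable Omega (EFin \o tangent v) /\
  (\int[leb]_(x in Omega) (tangent v x)%:E = (V * (ln s - 1) + s^-1 * b)%:E)%E.
Proof.
move=> [[[mv _] _] _] bE.
have [iy y0] := geometric_mean_solution n0 oO fO Opos bO p1 usol.
have iq : leb.-integrable Omega (fun x => (`|v x| / w x)%:E).
  apply/integrableP; split.
    apply/measurable_EFinP; apply: measurable_funM; first exact: measurableT_comp.
    exact: (measurable_inv_pos_rep oO usol).
  rewrite (_ : (\int[leb]_(x in Omega) _)%E = b%:E) ?ltry// -bE.
  apply: eq_integral => x _; rewrite gee0_abs// lee_fin divr_ge0// ltW//.
  exact: pos_rep_gt0.
have ik : leb.-integrable Omega (fun x => (ln s - 1)%:E).
  exact: (integrable_cst mO fO).
have ig : leb.-integrable Omega (fun x => (y x)%:E + (ln s - 1)%:E)%E by exact: integrableD.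
have isq : leb.-integrable Omega (fun x => s^-1%:E * (`|v x| / w x)%:E)%E.
  exact: integrableZl.
split; first exact: (integrableD mO ig isq).
transitivity (\int[leb]_(x in Omega) (((y x)%:E + (ln s - 1)%:E) + s^-1%:E * (`|v x| / w x)%:E))%E.
  by apply: eq_integral.
rewrite integralD// integralD// integralZl// bE.
have -> : (\int[leb]_(x in Omega) (y x)%:E)%E = 0%E.
  by rewrite -[LHS](fineK (integrable_fin_num mO iy)); congr EFin; exact: y0.
rewrite add0e -EFinM [RHS]EFinD; congr (_ + _)%E.
by transitivity ((ln s - 1)%:E * leb Omega)%E; [exact: integral_cst|rewrite volE muleC].
Qed.

Lemma J_finite v (L : R) : W1p Omega p v -> int_log Omega v = L%:E ->
  J Omega p lam v = (p^-1 * energy v - lam * L)%:E.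
Proof.
by move=> vW vL; rewrite /J vL (energy_fin oO p1 vW).
Qed.

(** Replacing ln |v| by its tangent line leaves a function of the integral b of
|v|/w alone; with z = b / (V s), the energy bound reduces its minimization to the
Bernoulli inequality. The error is the integrated tangent line defect. *)
Lemma J_lower_bound v : W01p Omega p v -> J Omega p lam v = +oo%E \/
  leb.-integrable Omega (fun x => lne (`|v x|%R)%:E) /\
  (m%:E + lam%:E * \int[leb]_(x in Omega) ((tangent v x)%:E - lne (`|v x|%R)%:E)
    <= J Omega p lam v)%E.
Proof.
move=> vW; have [b [b0 bE H]] := energy_lower_bound n0 oO fO Opos bO p1 usol vW.
have [vW1 _] := vW; have [[mv _] _] := vW1.
have [it tE] := integral_tangent vW bE.
have [Loo|Lfin] := eqVneq (int_log Omega v) -oo%E; [by left; rewrite /J Loo|right].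
have il := integrable_of_majorant (measurable_lne_norm mv) it
  (fun x _ => lne_le_tangent v x) Lfin.
split => //; rewrite integralB// tE.
have [L LE] : exists L, int_log Omega v = L%:E.
  by exists (fine (int_log Omega v)); rewrite fineK//; exact: (integrable_fin_num mO il).
rewrite (J_finite vW1 LE) -/(int_log Omega v) LE -EFinB -EFinM -EFinD lee_fin.
have z0 : 0 <= b / (V * s) by rewrite divr_ge0// mulr_ge0// ltW.
have B := bernoulli_powR z0.
have E : mu * (b / V) `^ p = lam * V * (b / (V * s)) `^ p.
  have -> : b / V = s * (b / (V * s)) by field; rewrite voln0 gt_eqF.
  by rewrite powRM ?(ltW s0)// spE; set Z := (_ / _) `^ p; field; rewrite gt_eqF.
have H1 : lam * V * (1 + p * (b / (V * s) - 1)) <= energy v.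
  by apply: le_trans H; rewrite E ler_wpM2l// mulr_ge0 ?ltW.
have pinv0 : 0 <= p^-1 by rewrite invr_ge0 ltW.
have H2 := ler_wpM2l pinv0 H1.
have H3 : p^-1 * (lam * V * (1 + p * (b / (V * s) - 1))) =
    m + lam * (V * (ln s - 1) + s^-1 * b).
  by rewrite ln_s; set lc := ln c; field; rewrite pn0 voln0 gt_eqF.
by rewrite H3 in H2; lra.
Qed.

Lemma J_lower v : W01p Omega p v -> (m%:E <= J Omega p lam v)%E.
Proof.
move=> /J_lower_bound[->|[_]]; first exact: leey.
apply: le_trans; rewrite leeDl// mule_ge0 ?lee_fin ?(ltW lam0)//.
by apply: integral_ge0 => x _.
Qed.

(** At a minimizer the tangent line defect vanishes, and ln meets its tangent
line only at the point of tangency. *)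
Lemma J_eq_abs v : W01p Omega p v -> J Omega p lam v = m%:E ->
  {ae leb, forall x, Omega x -> `|v x| = s * u x}.
Proof.
move=> vW Jv; have [[[mv _] _] _] := vW.
have [b [b0 bE _]] := energy_lower_bound n0 oO fO Opos bO p1 usol vW.
have [it _] := integral_tangent vW bE.
have [|[il]] := J_lower_bound vW; first by rewrite Jv.
rewrite Jv => H.
have I0 : (\int[leb]_(x in Omega) ((tangent v x)%:E - lne (`|v x|%R)%:E) = 0)%E.
  have : (0 <= \int[leb]_(x in Omega) ((tangent v x)%:E - lne (`|v x|%R)%:E))%E.
    by apply: integral_ge0.
  move: H; case: (\int[leb]_(x in Omega) _)%E => [r||]//.
    rewrite -EFinM -EFinD !lee_fin gerDl => H r0; congr EFin; apply/eqP.
    by rewrite eq_le r0 andbT -(pmulr_rle0 _ lam0).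
  by rewrite gt0_muley// addey// leye_eq.
have mD : measurable_fun Omega (fun x => (tangent v x)%:E - lne (`|v x|%R)%:E)%E.
  by apply: emeasurable_funB; [case/integrableP: it|exact: measurable_lne_norm].
have E0 : (\int[leb]_(x in Omega) `|(tangent v x)%:E - lne (`|v x|%R)%:E| = 0)%E.
  by rewrite -I0; apply: eq_integral => x _; rewrite gee0_abs.
have := (ae_eq_integral_abs leb mO mD).1 E0.
apply: filterS2 (pos_repE oO usol) => x uE DE Ox.
have := DE Ox; have w0 := pos_rep_gt0 u x.
have [vx0|vx] := eqVneq (v x) 0; first by rewrite vx0 normr0 le0_lneNy ?lexx.
have v0 : 0 < `|v x| by rewrite normr_gt0.
have q0 : 0 < `|v x| / (s * w x) by rewrite divr_gt0 ?mulr_gt0.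
rewrite lne_EFin// -EFinB => -[]; rewrite tangentE// => /subr0_eq E.
by rewrite uE// -[LHS](divfK (lt0r_neq0 (mulr_gt0 s0 w0))) (ln_eq_subr1 q0 (esym E)) mul1r.
Qed.

Lemma energy_ae v v' : W1p Omega p v -> W1p Omega p v' -> eq_ae Omega v v' ->
  energy v = energy v'.
Proof.
move=> vW vW' vv'; have [Lv _] := vW; have [Lv' _] := vW'.
have [Lg H] := weak_gradient_wgrad vW.
have gv' : weak_gradient Omega p v' (wgrad Omega p v).
  split => // phi tphi i; rewrite -H// /Rintegral; congr fine.
  have mphi : measurable_fun Omega (partial i phi).
    by apply: measurable_test; exact: test_function_partial tphi.
  apply: ae_eq_integral => //.
  - by apply/measurable_EFinP; apply: measurable_funM => //; case: Lv'.
  - by apply/measurable_EFinP; apply: measurable_funM => //; case: Lv.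
  - by apply: filterS vv' => x E Ox; rewrite E.
have E := wgrad_ae oO fO p1 gv' Lv'.
by apply/eqP; rewrite eq_le !(energy_le oO p1)//; apply: filterS E => x E /E ->.
Qed.

Lemma J_minimizer v (t : R) : W01p Omega p v -> eq_ae Omega v (fun x => t * u x) ->
  `|t| = s -> J Omega p lam v = m%:E.
Proof.
move=> vW vE ts; have [vW1 _] := vW; have [[mv _] _] := vW1.
have [iy y0] := geometric_mean_solution n0 oO fO Opos bO p1 usol.
have lE : int_log Omega v = (V * ln s)%:E.
  transitivity (\int[leb]_(x in Omega) ((y x)%:E + (ln s)%:E))%E.
    apply: ae_eq_integral => //; first exact: measurable_lne_norm.
      by apply: emeasurable_funD => //; case/integrableP: iy.
    apply: filterS2 vE (pos_repE oO usol) => x vx ux Ox; have w0 := pos_rep_gt0 u x.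
    rewrite vx// ux// normrM ts (gtr0_norm w0) lne_EFin ?mulr_gt0//.
    by rewrite lnM ?posrE// addrC.
  rewrite integralD//; last exact: (integrable_cst mO fO).
  have -> : (\int[leb]_(x in Omega) (y x)%:E)%E = 0%E.
    by rewrite -[LHS](fineK (integrable_fin_num mO iy)); congr EFin; exact: y0.
  rewrite add0e EFinM.
  by transitivity ((ln s)%:E * leb Omega)%E; [exact: integral_cst|rewrite volE muleC].
rewrite (J_finite vW1 lE) (energy_ae vW1 (W1pZ oO fO p1 t uW1) vE).
rewrite (energyZ oO fO p1 _ uW1) ts spE (mu_energy oO fO Opos p1 usol) ln_s; congr EFin.
by set lc := ln c; field; rewrite pn0 gt_eqF.
Qed.

(** Since |v| = s u is bounded below on compact boxes, a minimizer cannot change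
sign. *)
Lemma minimizerP v : W01p Omega p v -> J Omega p lam v = m%:E <->
  eq_ae Omega v (fun x => s * u x) \/ eq_ae Omega v (fun x => - (s * u x)).
Proof.
move=> vW; split => [Jv|[vE|vE]]; last 2 first.
- by apply: (J_minimizer vW vE); rewrite gtr0_norm.
- apply: (@J_minimizer v (- s) vW); last by rewrite normrN gtr0_norm.
  by rewrite (_ : (fun x => - s * u x) = fun x => - (s * u x))//; apply/funext => x; rewrite mulNr.
have vA := J_eq_abs vW Jv.
have [|v0|v0] := constant_sign oO fO p1 cO vW.
- move=> a b abO; have [d d0 H] := solution_ge_cbox usol abO.
  exists (s * d / 2); first by rewrite divr_gt0// mulr_gt0.
  apply: filterS2 vA H => x vx ux xab.
  by rewrite mulrC divfK// vx ?ler_wpM2l ?(ltW s0) ?ux//; exact: abO.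
- left; apply: filterS2 vA v0 => x vx v0 Ox.
  by rewrite -(vx Ox) gtr0_norm ?v0.
- right; apply: filterS2 vA v0 => x vx v0 Ox.
  by rewrite -(vx Ox) ltr0_norm ?opprK ?v0.
Qed.

End minimizers.

Theorem mainTheorem9 (R : realType) (N : nat) (p : R) (Omega : set 'rV[R]_N)
    (lam : R) (u : 'rV[R]_N -> R) :
  (2 <= N)%N -> 1 < p -> smooth_bounded_domain Omega -> 0 < lam ->
  weak_solution Omega p (mu Omega p / vol Omega) u ->
  let c := lam * vol Omega / mu Omega p in
  let ulam := fun x => c `^ p^-1 * u x in
  let m := lam * vol Omega / p * (1 - ln c) in
  [/\ W01p Omega p ulam,
      forall v, W01p Omega p v -> (m%:E <= J Omega p lam v)%E &
      forall v, W01p Omega p v ->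
        (J Omega p lam v = m%:E <->
         eq_ae Omega v ulam \/ eq_ae Omega v (fun x => - ulam x))].
Proof.
move=> N2 p1 [oO cO nO bO _] lam0 usol c ulam m.
have N0 : (0 < N)%N by exact: leq_trans N2.
have Opos : (0 < lebesgue_rV N Omega)%E by exact: lebesgue_open_gt0.
have fO : (lebesgue_rV N Omega < +oo)%E.
  have [M [_ OM]] := bounded_sub_cbox bO.
  apply: le_lt_trans (lebesgue_cbox_lty (const_mx (- M)) (const_mx M)).
  by apply: le_measure; rewrite ?inE//; [exact: measurable_open_rV|exact: measurable_cbox].
split.
- by apply: (W01pZ oO fO p1); have [] := usol.
- by move=> v; exact: (J_lower N0 oO fO Opos bO p1 lam0 usol).
- by move=> v; exact: (minimizerP N0 oO fO Opos bO p1 cO lam0 usol).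
Qed.
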